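(* Let $X = H^1_{\mathrm{per}}([0,2\pi],\mathbb{C})$. There exist positive constants $C_0$, $\epsilon_0$, and $\delta_0$ such that the following holds. Let $p,k\in\mathbb{R}$ with $|p-1|\le\delta_0$, $|k-1|\le\delta_0$, and let $Q_{\mathrm{per}}\in X$ with $\|Q_{\mathrm{per}}\|_X\le\delta_0$ be such that $W(x) = e^{i p x}\,Q_{\mathrm{per}}(2kx)$ is a solution of $$W_{xx}(x) + W(x) - |W(x)|^2 W(x) = 0,\qquad x\in\mathbb{R}.$$ Then for all $R\in X$ with $\|R\|_X\le\epsilon_0$, the solution $U(x,t) = e^{i(px-t)}Q(2kx,t)$ (with $Q(\cdot,t)\in X$ for all $t$) of the defocusing nonlinear Schrödinger equation $$ i U_t(x,t) + U_{xx}(x,t) - |U(x,t)|^2U(x,t) = 0,\qquad x\in\mathbb{R},\ t\in\mathbb{R},$$ with initial data $U(x,0) = e^{ipx}\bigl(Q_{\mathrm{per}}(2kx)+R(2kx)\bigr)$ satisfies, for all $t\in\mathbb{R}$, $$\inf_{\phi,\xi\in[0,2\pi]}\bigl\|Q(\cdot,t) - e^{i\phi}Q_{\mathrm{per}}(\cdot-\xi)\bigr\|_X \le C_0\|R\|_X.$$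
   Context: $X=H^1_{\mathrm{per}}([0,2\pi],\mathbb{C})$ is the space of $2\pi$-periodic functions $u\in H^1_{\mathrm{loc}}(\mathbb{R},\mathbb{C})$, with norm $\|u\|_X^2=\int_0^{2\pi}(|u(z)|^2+|u_z(z)|^2)\,dz$. Writing $U(x,t)=e^{i(px-t)}Q(2kx,t)$, the Schrödinger equation is equivalent to the evolution equation $iQ_t+4ipkQ_z+4k^2Q_{zz}+(1-p^2)Q-|Q|^2Q=0$ for $Q(z,t)$, $2\pi$-periodic in $z$, whose Cauchy problem is globally well-posed in $X$; $Q(\cdot,t)$ is the resulting solution with $Q(\cdot,0)=Q_{\mathrm{per}}+R$. The constants $C_0,\epsilon_0,\delta_0$ do not depend on $p,k,Q_{\mathrm{per}},R$. *)

(* Defs.v *)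
From HB Require Import structures.
From mathcomp Require Import all_boot all_order all_algebra.
From mathcomp Require Import all_classical all_reals all_analysis.
From mathcomp Require Import complex.
Set Implicit Arguments.
Unset Strict Implicit.
Unset Printing Implicit Defensive.
Import Order.TTheory GRing.Theory Num.Theory.
Import numFieldNormedType.Exports.
Local Open Scope classical_set_scope.
Local Open Scope ring_scope.
Local Open Scope complex_scope.

Definition expi (R : realType) (theta : R) : R[i] := cos theta +i* sin theta.

(* Calculus of functions R -> R[i] is taken componentwise. *)

Definition cderivable (R : realType) (f : R -> R[i]) (x : R) : Prop :=
  derivable (fun y => complex.Re (f y)) x 1 /\
  derivable (fun y => complex.Im (f y)) x 1.

Definition cderive (R : realType) (f : R -> R[i]) (x : R) : R[i] :=
  derive1 (fun y => complex.Re (f y)) x +i*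
  derive1 (fun y => complex.Im (f y)) x.

Definition cintegral (R : realType) (f : R -> R[i]) : R[i] :=
  (\int[@lebesgue_measure R]_x complex.Re (f x)) +i*
  (\int[@lebesgue_measure R]_x complex.Im (f x)).

Definition cmeasurable (R : realType) (f : R -> R[i]) : Prop :=
  measurable_fun [set: R] (fun x => complex.Re (f x)) /\
  measurable_fun [set: R] (fun x => complex.Im (f x)).

(* Real-valued test functions suffice for distributions with complex values,
   all the pairings below being linear in the test function. *)
Definition test_function (R : realType) (psi : R -> R) : Prop :=
  (forall (n : nat) (x : R), derivable (derive1n n psi) x 1) /\
  compact (closure [set x | psi x != 0]).

Definition L2loc (R : realType) : set (R -> R[i]) :=
  [set f | cmeasurable f /\
    forall K : set R, compact K ->
      (\int[@lebesgue_measure R]_(x in K) ((Normc.normc (f x) ^+ 2)%:E) < +oo)%E].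

Definition weak_derivative (R : realType) (u v : R -> R[i]) : Prop :=
  forall psi : R -> R, test_function psi ->
    cintegral (fun x => u x * (derive1 psi x)%:C) =
    - cintegral (fun x => v x * (psi x)%:C).

Definition H1loc (R : realType) : set (R -> R[i]) :=
  [set u | L2loc u /\ exists2 v, L2loc v & weak_derivative u v].

(* The space X. Its elements are represented by arbitrary measurable
   representatives, two functions equal almost everywhere being the same
   element of X. *)
Definition H1per (R : realType) : set (R -> R[i]) :=
  [set u | H1loc u /\ forall z, u (z + 2 * pi) = u z].

(* A choice of u_z, determined up to a null set when u is in H1loc; outside
   H1loc it is the junk value 0, so normX is only meaningful on H1per. *)
Definition wderive (R : realType) (u : R -> R[i]) : R -> R[i] :=
  xget (fun=> 0) [set v | L2loc v /\ weak_derivative u v].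

Definition normX (R : realType) (u : R -> R[i]) : R :=
  Num.sqrt (\int[@lebesgue_measure R]_(z in `[0, 2 * pi])
    (Normc.normc (u z) ^+ 2 + Normc.normc (wderive u z) ^+ 2)).

(* Classical solutions of W_xx + W - |W|^2 W = 0. *)
Definition stationary_solution (R : realType) (W : R -> R[i]) : Prop :=
  (forall x, cderivable W x) /\ (forall x, cderivable (cderive W) x) /\
  forall x, cderive (cderive W) x + W x - `|W x| ^+ 2 * W x = 0.

(* i U_t + U_xx - |U|^2 U = 0 for U = U(x, t): the equation holds at every
   time t in the sense of distributions in x. *)
Definition NLS_solution (R : realType) (U : R -> R -> R[i]) : Prop :=
  forall psi : R -> R, test_function psi ->
    let pairing t := cintegral (fun x => U x t * (psi x)%:C) in
    forall t : R, cderivable pairing t /\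
      (0 +i* 1) * cderive pairing t
        + cintegral (fun x => U x t * (derive1n 2 psi x)%:C)
        - cintegral (fun x => `|U x t| ^+ 2 * U x t * (psi x)%:C) = 0.

(* t |-> Q(., t) is a continuous curve in X. *)
Definition continuous_curve (R : realType) (Q : R -> R -> R[i]) : Prop :=
  (forall t, H1per (Q^~ t)) /\
  forall t, normX (fun z => Q z s - Q z t) @[s --> t] --> (0 : R).

(* Main.v *)
Require Import Defs.
From HB Require Import structures.
From mathcomp Require Import all_boot all_order all_algebra.
From mathcomp Require Import all_classical all_reals all_analysis.
From mathcomp Require Import complex ring lra zify measurable_realfun.
Import Order.TTheory GRing.Theory Num.Theory.
Import numFieldNormedType.Exports.
Set Implicit Arguments.
Unset Strict Implicit.
Unset Printing Implicit Defensive.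
Local Open Scope classical_set_scope.
Local Open Scope ring_scope.
Local Open Scope complex_scope.

(** The equation is Hamiltonian, and a wave of small amplitude is orbitally stable
    because it almost minimises a conserved functional in every direction
    except the two in which the linear part degenerates, and in those two
    directions the conserved charge and momentum take over.

    In terms of the Fourier coefficients [q_n] of [Q] the equation reads
    [i q_n' = lam_n q_n + f_n], where [lam_n = (2kn+p)^2 - 1] and [f_n] is the
    coefficient of [|Q|^2 Q]. The flow preserves the charge [sum |q_n|^2], the
    momentum [sum n |q_n|^2] and the energy
    [Lam = sum lam_n |q_n|^2 + 1/2 mean |Q|^4], and [Q_per] is a critical point
    of [Lam]. For [p] and [k] close to 1, [lam_n] is close to [4n(n+1)]: it is
    tiny for the two modes 0 and -1 and at least [1 + n^2] for all the other
    ones. Let [r] be the difference between the solution and the wave, the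
    phase and the translation being chosen so that the modes 0 and -1 of the
    two are aligned.

    - The equation is defocusing, so that the quartic part of [Lam] only adds a
      nonnegative term to the expansion of [Lam] at the wave ([Lam_expand],
      [qrem_ge0]). Hence conservation of [Lam] controls the high modes of [r],
      up to a small multiple of its two low modes.
    - The combinations [sum (n+1) |q_n|^2] and [- sum n |q_n|^2] of the
      conserved quantities see the mode 0 (resp. the mode -1) but not the other
      low mode. They control the modulus of that low mode by the high modes
      ([charge_close]), which closes the estimate as soon as the parameters
      are close enough to 1 ([finite_stability]). The high modes of the wave
      are here dominated by either of its low modes ([high_modes_le]), because
      the cube of a single mode is a multiple of the same mode; this is what
      makes the constants independent of the wave.

    All this is done on the trigonometric polynomials obtained by truncation,
    where the sums are finite. The truncation of the solution satisfies the
    equation up to an error that vanishes locally uniformly in time, so that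
    the conservation laws hold in the limit ([conservation], [orbital_seq]);
    this only uses that the nonlinearity is locally Lipschitz in H^1.

    It remains to translate the statement, in which functions are only
    measurable and derivatives are weak, into one on coefficients. Fourier
    coefficients determine an integrable function almost everywhere
    ([fcoef0_ae]), hence a function of class H^1 is the uniform sum of its
    Fourier series ([h1_limit]); its norm is bounded from below by the
    coefficients by Bessel's inequality ([normX_hn]) and from above by
    mollification and Fatou's lemma ([h1_norm_le]). Testing the equation
    against a cut-off plane wave whose translates form a partition of unity
    isolates one coefficient and yields the differential equation above
    ([nls_ode]); the equation of [Q_per] is the particular case of a standing
    wave ([stationary_fcoef]). *)

(** * Complex numbers and Fourier modes *)

Section ComplexNumbers.
Context {R : realType}.
Implicit Types (x y z : R[i]) (a b t : R) (m n : int).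

(** The squared modulus as a real number; the norm of [R[i]] takes its values in
    [R[i]]. *)
Definition nsq z : R := complex.Re z ^+ 2 + complex.Im z ^+ 2.

Lemma cReD x y : complex.Re (x + y) = complex.Re x + complex.Re y.
Proof. by case: x; case: y. Qed.
Lemma cImD x y : complex.Im (x + y) = complex.Im x + complex.Im y.
Proof. by case: x; case: y. Qed.
Lemma cReN x : complex.Re (- x) = - complex.Re x.
Proof. by case: x. Qed.
Lemma cImN x : complex.Im (- x) = - complex.Im x.
Proof. by case: x. Qed.
Lemma cReM x y : complex.Re (x * y) =
  complex.Re x * complex.Re y - complex.Im x * complex.Im y.
Proof. by case: x; case: y. Qed.
Lemma cImM x y : complex.Im (x * y) =
  complex.Re x * complex.Im y + complex.Im x * complex.Re y.
Proof. by case: x; case: y. Qed.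
Lemma cReJ x : complex.Re x^* = complex.Re x. Proof. by case: x. Qed.
Lemma cImJ x : complex.Im x^* = - complex.Im x. Proof. by case: x. Qed.

Definition ReImE := (cReD, cImD, cReN, cImN, cReM, cImM, cReJ, cImJ).

Lemma cRe_sum I (s : seq I) (P : pred I) (F : I -> R[i]) :
  complex.Re (\sum_(i <- s | P i) F i) = \sum_(i <- s | P i) complex.Re (F i).
Proof. by apply: (big_morph _ cReD). Qed.
Lemma cIm_sum I (s : seq I) (P : pred I) (F : I -> R[i]) :
  complex.Im (\sum_(i <- s | P i) F i) = \sum_(i <- s | P i) complex.Im (F i).
Proof. by apply: (big_morph _ cImD). Qed.

Lemma complexP x y :
  complex.Re x = complex.Re y -> complex.Im x = complex.Im y -> x = y.
Proof. by case: x => a b; case: y => c d /= -> ->. Qed.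

Lemma normrc z : `|z| = (Normc.normc z)%:C. Proof. by []. Qed.

Lemma normc_nsq z : Normc.normc z ^+ 2 = nsq z.
Proof. by case: z => a b /=; rewrite sqr_sqrtr // addr_ge0 // sqr_ge0. Qed.

Lemma nsq_normr z : `|z| ^+ 2 = (nsq z)%:C.
Proof. by rewrite normrc -normc_nsq rmorphXn. Qed.

Lemma normc_ge0 z : 0 <= Normc.normc z.
Proof. by case: z => a b /=; rewrite sqrtr_ge0. Qed.

Lemma normc_sqrt z : Normc.normc z = Num.sqrt (nsq z).
Proof. by case: z. Qed.

Lemma nsq_ge0 z : 0 <= nsq z. Proof. by rewrite addr_ge0 // sqr_ge0. Qed.

Lemma nsqM x y : nsq (x * y) = nsq x * nsq y.
Proof. by rewrite /nsq !ReImE; ring. Qed.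
Lemma nsqJ x : nsq x^* = nsq x.
Proof. by rewrite /nsq !ReImE; ring. Qed.
Lemma nsqN x : nsq (- x) = nsq x.
Proof. by rewrite /nsq !ReImE; ring. Qed.
Lemma nsqC a : nsq a%:C = a ^+ 2.
Proof. by rewrite /nsq /= expr0n addr0. Qed.
Lemma nsq0 : nsq 0 = 0. Proof. by rewrite /nsq /=; ring. Qed.
Lemma nsqE z : nsq z = complex.Re (z * z^*).
Proof. by rewrite /nsq !ReImE; ring. Qed.
Lemma mulcJ z : z * z^* = (nsq z)%:C.
Proof. by apply: complexP; rewrite /nsq !ReImE /=; ring. Qed.

Lemma nsqD_le x y : nsq (x + y) <= 2 * nsq x + 2 * nsq y.
Proof.
rewrite /nsq !ReImE -subr_ge0.
have := addr_ge0 (sqr_ge0 (complex.Re x - complex.Re y))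
  (sqr_ge0 (complex.Im x - complex.Im y)).
by congr (0 <= _); ring.
Qed.
Lemma nsqB_le x y : nsq (x - y) <= 2 * nsq x + 2 * nsq y.
Proof. by rewrite -(nsqN y); exact: nsqD_le. Qed.

Lemma ReMJ_le x y : 2 * `|complex.Re (x * y^*)| <= nsq x + nsq y.
Proof.
have p1 := nsq_ge0 (x + y); have p2 := nsq_ge0 (x - y).
rewrite -{1}[2]normr_nat -normrM ler_norml.
move: p1 p2; rewrite /nsq !ReImE => p1 p2; apply/andP; split; lra.
Qed.

(** The defect in the Cauchy-Schwarz inequality is the square of the imaginary
    part. *)
Lemma ReMJ_CS x y : complex.Re (x * y^*) ^+ 2 <= nsq x * nsq y.
Proof.
rewrite -subr_ge0; have := sqr_ge0 (complex.Im (x * y^*)).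
by rewrite /nsq !ReImE; congr (0 <= _); ring.
Qed.

Lemma expiD a b : expi (a + b) = expi a * expi b :> R[i].
Proof.
by apply: complexP; rewrite /expi ReImE /= ?cosD ?sinD; ring.
Qed.
Lemma expi0 : expi 0 = 1 :> R[i].
Proof. by rewrite /expi cos0 sin0. Qed.
Lemma expiN a : expi (- a) = (expi a)^* :> R[i].
Proof. by rewrite /expi cosN sinN. Qed.
Lemma nsq_expi a : nsq (expi a) = 1.
Proof. by rewrite /nsq /expi /= cos2Dsin2. Qed.

Definition en n t : R[i] := expi (n%:~R * t).

Lemma enD n m t : en (n + m) t = en n t * en m t.
Proof. by rewrite /en intrD mulrDl expiD. Qed.
Lemma en0 t : en 0 t = 1. Proof. by rewrite /en mul0r expi0. Qed.
Lemma enN n t : en (- n) t = (en n t)^*.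
Proof. by rewrite /en intrN mulNr expiN. Qed.
Lemma nsq_en n t : nsq (en n t) = 1. Proof. exact: nsq_expi. Qed.

Lemma expi_periodicz n a : expi (a + n%:~R * (2 * pi)) = expi a :> R[i].
Proof.
have cospos (j : nat) (b : R) : cos (b + (pi *+ 2) *+ j) = cos b.
  elim: j => [|j IH]; first by rewrite mulr0n addr0.
  by rewrite mulrSr addrA cosD2pi.
have sinpos (j : nat) (b : R) : sin (b + (pi *+ 2) *+ j) = sin b.
  elim: j => [|j IH]; first by rewrite mulr0n addr0.
  by rewrite mulrSr addrA sinD2pi.
case: n => j.
  rewrite (_ : j%:~R * _ = (pi *+ 2) *+ j); last first.
    by rewrite -pmulrn !mulr_natl.
  by rewrite /expi cospos sinpos.
rewrite NegzE intrN mulNr (_ : j.+1%:~R * _ = (pi *+ 2) *+ j.+1); last first.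
  by rewrite -pmulrn !mulr_natl.
by rewrite /expi -(cospos j.+1) -(sinpos j.+1) subrK.
Qed.

Lemma en_periodic n t : en n (t + 2 * pi) = en n t.
Proof. by rewrite /en mulrDr expi_periodicz. Qed.

End ComplexNumbers.

(** * Continuity, means over a period and componentwise derivatives *)

Section Continuity.
Context {R : realType}.
Implicit Types (f g : R -> R) (u v : R -> R[i]).

(** An alias of [continuous] on the line, whose lemmas speak of functions written
    with a bound variable, as needed under integrals. *)
Definition rcont f := continuous (f : R -> R).

Lemma rcont_cst (c : R) : rcont (fun=> c).
Proof. by move=> x; apply: cvg_cst. Qed.
Lemma rcont_id : rcont (fun x => x).
Proof. by move=> x; apply: cvg_id. Qed.
Lemma rcontD f g : rcont f -> rcont g -> rcont (fun x => f x + g x).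
Proof. by move=> cf cg x; apply: continuousD (cf x) (cg x). Qed.
Lemma rcontN f : rcont f -> rcont (fun x => - f x).
Proof. by move=> cf x; apply: continuousN (cf x). Qed.
Lemma rcontB f g : rcont f -> rcont g -> rcont (fun x => f x - g x).
Proof. by move=> cf cg; apply/rcontD/rcontN. Qed.
Lemma rcontM f g : rcont f -> rcont g -> rcont (fun x => f x * g x).
Proof. by move=> cf cg x; apply: continuousM (cf x) (cg x). Qed.
Lemma rcontX n f : rcont f -> rcont (fun x => f x ^+ n).
Proof.
move=> cf; elim: n => [|n IH]; first exact: rcont_cst.
rewrite (_ : (fun x => _) = (fun x => f x * f x ^+ n)); first exact: rcontM.
by apply/funext => x; rewrite exprS.
Qed.
Lemma rcont_comp f g : rcont f -> rcont g -> rcont (fun x => f (g x)).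
Proof. by move=> cf cg x; apply: (continuous_comp (cg x) (cf _)). Qed.
Lemma rcont_cos f : rcont f -> rcont (fun x => cos (f x)).
Proof. exact/rcont_comp/continuous_cos. Qed.
Lemma rcont_sin f : rcont f -> rcont (fun x => sin (f x)).
Proof. exact/rcont_comp/continuous_sin. Qed.
Lemma rcont_sum I (s : seq I) (F : I -> R -> R) :
  (forall i, rcont (F i)) -> rcont (fun x => \sum_(i <- s) F i x).
Proof.
move=> cF; elim: s => [|i s IH].
  by rewrite (_ : (fun x => _) = fun=> 0) ?big_nil; [exact: rcont_cst|
    apply/funext => x; rewrite big_nil].
rewrite (_ : (fun x => _) = fun x => F i x + \sum_(j <- s) F j x).
  exact: rcontD.
by apply/funext => x; rewrite big_cons.
Qed.

Definition ccont u :=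
  rcont (fun x => complex.Re (u x)) /\ rcont (fun x => complex.Im (u x)).

Lemma ccont_Re u : ccont u -> rcont (fun x => complex.Re (u x)).
Proof. by case. Qed.
Lemma ccont_Im u : ccont u -> rcont (fun x => complex.Im (u x)).
Proof. by case. Qed.
Lemma ccont_nsq u : ccont u -> rcont (fun x => nsq (u x)).
Proof. by case=> c1 c2; apply: rcontD; apply: rcontX. Qed.
Lemma ccont_cst c : ccont (fun=> c). Proof. by split; apply: rcont_cst. Qed.
Lemma ccontC f : rcont f -> ccont (fun x => (f x)%:C).
Proof. by move=> cf; split; [|exact: rcont_cst]. Qed.
Lemma ccontD u v : ccont u -> ccont v -> ccont (fun x => u x + v x).
Proof.
move=> [u1 u2] [v1 v2]; split.
  by under eq_fun do rewrite cReD; apply: rcontD.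
by under eq_fun do rewrite cImD; apply: rcontD.
Qed.
Lemma ccontN u : ccont u -> ccont (fun x => - u x).
Proof.
move=> [u1 u2]; split.
  by under eq_fun do rewrite cReN; apply: rcontN.
by under eq_fun do rewrite cImN; apply: rcontN.
Qed.
Lemma ccontB u v : ccont u -> ccont v -> ccont (fun x => u x - v x).
Proof. by move=> cf cg; apply/ccontD/ccontN. Qed.
Lemma ccontM u v : ccont u -> ccont v -> ccont (fun x => u x * v x).
Proof.
move=> [u1 u2] [v1 v2]; split.
  by under eq_fun do rewrite cReM; apply: rcontB; apply: rcontM.
by under eq_fun do rewrite cImM; apply: rcontD; apply: rcontM.
Qed.
Lemma ccontJ u : ccont u -> ccont (fun x => (u x)^*).
Proof.
move=> [u1 u2]; split.
  by under eq_fun do rewrite cReJ.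
by under eq_fun do rewrite cImJ; apply: rcontN.
Qed.
Lemma ccontX n u : ccont u -> ccont (fun x => u x ^+ n).
Proof.
move=> cf; elim: n => [|n IH]; first exact: ccont_cst.
rewrite (_ : (fun x => _) = (fun x => u x * u x ^+ n)); first exact: ccontM.
by apply/funext => x; rewrite exprS.
Qed.
Lemma ccont_sum I (s : seq I) (F : I -> R -> R[i]) :
  (forall i, ccont (F i)) -> ccont (fun x => \sum_(i <- s) F i x).
Proof.
move=> cF; split.
  by under eq_fun do rewrite cRe_sum; apply: rcont_sum => i; case: (cF i).
by under eq_fun do rewrite cIm_sum; apply: rcont_sum => i; case: (cF i).
Qed.
Lemma ccont_expi f : rcont f -> ccont (fun x => expi (f x)).
Proof. by move=> cf; split=> /=; [apply: rcont_cos | apply: rcont_sin]. Qed.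
Lemma ccont_en n : ccont (@en R n).
Proof. exact/ccont_expi/rcontM/rcont_id/rcont_cst. Qed.
Lemma ccont_comp u f : ccont u -> rcont f -> ccont (fun x => u (f x)).
Proof.
by move=> [u1 u2] cf; split; [exact: (rcont_comp u1)|exact: (rcont_comp u2)].
Qed.

End Continuity.

Create HintDb cont.
#[export] Hint Resolve rcont_cst rcont_id rcontD rcontB rcontN rcontM rcontX
  rcont_cos rcont_sin ccont_cst ccont_Re ccont_Im ccont_nsq ccontC ccontD
  ccontB ccontN ccontM ccontJ ccontX ccont_expi ccont_en : cont.
#[export] Hint Extern 3 (ccont _) => apply: ccontJ : cont.

Section Mean.
Context {R : realType}.
Local Notation mu := (@lebesgue_measure R).
Implicit Types (f g : R -> R) (u v : R -> R[i]).

Definition rint f := mu.-integrable `[0, 2 * pi] (EFin \o f).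

Lemma pi2_gt0 : 0 < 2 * pi :> R.
Proof. by rewrite mulr_gt0 // pi_gt0. Qed.

Lemma rint_cont f : rcont f -> rint f.
Proof.
move=> cf; apply: continuous_compact_integrable.
  exact: segment_compact.
exact: continuous_subspaceT.
Qed.

Lemma rintD f g : rint f -> rint g -> rint (fun x => f x + g x).
Proof. by move=> i1 i2; exact: (integrableD _ i1 i2). Qed.
Lemma rintN f : rint f -> rint (fun x => - f x).
Proof. by move=> i1; exact: (integrableN i1). Qed.
Lemma rintB f g : rint f -> rint g -> rint (fun x => f x - g x).
Proof. by move=> i1 i2; apply/rintD/rintN. Qed.
Lemma rintZ c f : rint f -> rint (fun x => c * f x).
Proof. by move=> i1; exact: (integrableZl _ c i1). Qed.

Definition rmean f : R := (2 * pi)^-1 * \int[mu]_(x in `[0, 2 * pi]) f x.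

Lemma rmeanD f g : rint f -> rint g ->
  rmean (fun x => f x + g x) = rmean f + rmean g.
Proof. by move=> i1 i2; rewrite /rmean RintegralD // mulrDr. Qed.
Lemma rmeanZ c f : rint f -> rmean (fun x => c * f x) = c * rmean f.
Proof. by move=> i1; rewrite /rmean RintegralZl // mulrCA. Qed.
Lemma rmeanN f : rint f -> rmean (fun x => - f x) = - rmean f.
Proof.
move=> i1; rewrite -mulN1r -rmeanZ //; congr rmean.
by apply/funext => x; rewrite mulN1r.
Qed.
Lemma rmeanB f g : rint f -> rint g ->
  rmean (fun x => f x - g x) = rmean f - rmean g.
Proof. by move=> i1 i2; rewrite rmeanD ?rmeanN //; exact: rintN. Qed.
Lemma rmean_cst c : rmean (fun=> c) = c.
Proof.
have E : mu `[0, 2 * pi]%classic = (2 * pi)%:E.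
  by rewrite lebesgue_measure_itv /= lte_fin pi2_gt0 sube0.
rewrite /rmean Rintegral_cst //; have -> /= := congr1 fine E.
by rewrite mulrC mulfK // gt_eqF // pi2_gt0.
Qed.
Lemma rmean0 : rmean (fun=> 0) = 0. Proof. exact: rmean_cst. Qed.
Lemma rmean_ge0 f : (forall x, 0 <= f x) -> 0 <= rmean f.
Proof.
move=> f0; rewrite mulr_ge0 ?invr_ge0 ?(ltW pi2_gt0) //.
by apply: Rintegral_ge0 => x _.
Qed.
Lemma rmean_le f g : rint f -> rint g -> (forall x, f x <= g x) ->
  rmean f <= rmean g.
Proof.
move=> i1 i2 fg; rewrite ler_pM2l ?invr_gt0 ?pi2_gt0 //.
by apply: le_Rintegral => // x _.
Qed.
Lemma rint_sum I (s : seq I) (F : I -> R -> R) : (forall i, rint (F i)) ->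
  rint (fun x => \sum_(i <- s) F i x).
Proof.
move=> iF; elim: s => [|i s IH].
  rewrite (_ : (fun x => _) = fun=> 0); first exact/rint_cont/rcont_cst.
  by apply/funext => x; rewrite big_nil.
rewrite (_ : (fun x => _) = fun x => F i x + \sum_(j <- s) F j x).
  exact: rintD.
by apply/funext => x; rewrite big_cons.
Qed.
Lemma rmean_sum I (s : seq I) (F : I -> R -> R) : (forall i, rint (F i)) ->
  rmean (fun x => \sum_(i <- s) F i x) = \sum_(i <- s) rmean (F i).
Proof.
move=> iF; elim: s => [|i s IH].
  rewrite big_nil (_ : (fun x => _) = fun=> 0) ?rmean0 //.
  by apply/funext => x; rewrite big_nil.
rewrite (_ : (fun x => _) = fun x => F i x + \sum_(j <- s) F j x).
  by rewrite rmeanD ?IH ?big_cons //; exact: rint_sum.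
by apply/funext => x; rewrite big_cons.
Qed.
Lemma rmean_norm_le f g : rint f -> rint g -> (forall x, `|f x| <= g x) ->
  `|rmean f| <= rmean g.
Proof.
move=> i1 i2 fg; rewrite ler_norml -rmeanN //; apply/andP; split.
  apply: rmean_le => //; first exact: rintN.
  by move=> x; have := fg x; rewrite ler_norml => /andP[].
by apply: rmean_le => // x; have := fg x; rewrite ler_norml => /andP[].
Qed.

Lemma Rintegral_derive f g (a b : R) : a < b -> rcont g ->
  (forall x : R, is_derive x 1 f (g x)) ->
  \int[mu]_(x in `[a, b]) g x = f b - f a.
Proof.
move=> ab cg df; rewrite /Rintegral (@continuous_FTC2 _ g f) //.
- exact: continuous_subspaceT.
- have cf : continuous f.
    move=> x; apply/differentiable_continuous/derivable1_diffP.
    by have [] := df x.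
  split.
  + by move=> x _; have [] := df x.
  + exact: (cvg_at_right_filter (cf _)).
  + exact: (cvg_at_left_filter (cf _)).
- by move=> x _; rewrite derive1E; have [] := df x.
Qed.

Lemma rmean_derive f g : rcont g -> (forall x : R, is_derive x 1 f (g x)) ->
  f (2 * pi) = f 0 -> rmean g = 0.
Proof.
move=> cg df fper; rewrite /rmean (Rintegral_derive pi2_gt0 cg df).
by rewrite fper subrr mulr0.
Qed.

Definition cint u :=
  rint (fun x => complex.Re (u x)) /\ rint (fun x => complex.Im (u x)).

Definition mean u : R[i] :=
  rmean (fun x => complex.Re (u x)) +i* rmean (fun x => complex.Im (u x)).

Lemma Re_mean u : complex.Re (mean u) = rmean (fun x => complex.Re (u x)).
Proof. by []. Qed.
Lemma Im_mean u : complex.Im (mean u) = rmean (fun x => complex.Im (u x)).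
Proof. by []. Qed.

Lemma cint_cont u : ccont u -> cint u.
Proof. by case=> c1 c2; split; exact: rint_cont. Qed.
Lemma cintD u v : cint u -> cint v -> cint (fun x => u x + v x).
Proof.
move=> [u1 u2] [v1 v2]; split.
  by under eq_fun do rewrite cReD; apply: rintD.
by under eq_fun do rewrite cImD; apply: rintD.
Qed.
Lemma cintZ c u : cint u -> cint (fun x => c * u x).
Proof.
move=> [u1 u2]; split.
  by under eq_fun do rewrite cReM; apply: rintB; apply: rintZ.
by under eq_fun do rewrite cImM; apply: rintD; apply: rintZ.
Qed.
Lemma meanD u v : cint u -> cint v ->
  mean (fun x => u x + v x) = mean u + mean v.
Proof.
move=> [u1 u2] [v1 v2]; apply: complexP.
  rewrite cReD !Re_mean -rmeanD //.
  by congr rmean; apply/funext => x; rewrite cReD.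
rewrite cImD !Im_mean -rmeanD //.
by congr rmean; apply/funext => x; rewrite cImD.
Qed.
Lemma meanZ c u : cint u -> mean (fun x => c * u x) = c * mean u.
Proof.
move=> [u1 u2]; apply: complexP.
  rewrite cReM !Re_mean Im_mean -!rmeanZ // -rmeanB; try exact: rintZ.
  by congr rmean; apply/funext => x; rewrite cReM.
rewrite cImM !Im_mean Re_mean -!rmeanZ // -rmeanD; try exact: rintZ.
by congr rmean; apply/funext => x; rewrite cImM.
Qed.
Lemma meanB u v : cint u -> cint v ->
  mean (fun x => u x - v x) = mean u - mean v.
Proof.
move=> iu iv; rewrite -mulN1r -meanZ // -meanD //; last exact: cintZ.
by congr mean; apply/funext => x; rewrite mulN1r.
Qed.
Lemma mean_sum I (s : seq I) (F : I -> R -> R[i]) : (forall i, cint (F i)) ->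
  mean (fun x => \sum_(i <- s) F i x) = \sum_(i <- s) mean (F i).
Proof.
move=> iF; apply: complexP.
  rewrite cRe_sum Re_mean -rmean_sum; last by move=> i; case: (iF i).
  by congr rmean; apply/funext => x; rewrite cRe_sum.
rewrite cIm_sum Im_mean -rmean_sum; last by move=> i; case: (iF i).
by congr rmean; apply/funext => x; rewrite cIm_sum.
Qed.
Lemma mean_cst c : mean (fun=> c) = c.
Proof. by case: c => a b; rewrite /mean /= !rmean_cst. Qed.

Definition cis_derive u v := forall x : R,
  is_derive x 1 (fun y => complex.Re (u y)) (complex.Re (v x)) /\
  is_derive x 1 (fun y => complex.Im (u y)) (complex.Im (v x)).

Lemma mean_derive u v : ccont v -> cis_derive u v ->
  u (2 * pi) = u 0 -> mean v = 0.
Proof.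
move=> [v1 v2] duv uper; rewrite /mean.
rewrite (rmean_derive v1 (fun x => (duv x).1)) ?uper //.
by rewrite (rmean_derive v2 (fun x => (duv x).2)) ?uper.
Qed.

End Mean.

Section Derivatives.
Context {R : realType}.
Implicit Types (f g : R -> R) (u v du dv : R -> R[i]).

Lemma is_derive_fun (f g : R -> R) (x d e : R) :
  (forall y, f y = g y) -> d = e -> is_derive x 1 g d -> is_derive x 1 f e.
Proof. by move=> /funext -> ->. Qed.

Lemma is_deriveMfun (f g : R -> R) (x d e : R) :
  is_derive x 1 f d -> is_derive x 1 g e ->
  is_derive x 1 (fun y => f y * g y) (d * g x + f x * e).
Proof.
move=> h1 h2; apply: (is_derive_fun (g := (f * g)%R)
  (d := (f x *: e + g x *: d))) => //.
by rewrite /GRing.scale /= addrC (mulrC (g x)).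
Qed.

Lemma is_deriveDfun (f g : R -> R) (x d e : R) :
  is_derive x 1 f d -> is_derive x 1 g e ->
  is_derive x 1 (fun y => f y + g y) (d + e).
Proof. by move=> h1 h2; exact: is_deriveD. Qed.

Lemma is_deriveNfun (f : R -> R) (x d : R) :
  is_derive x 1 f d -> is_derive x 1 (fun y => - f y) (- d).
Proof. by move=> h1; exact: is_deriveN. Qed.

Lemma is_deriveBfun (f g : R -> R) (x d e : R) :
  is_derive x 1 f d -> is_derive x 1 g e ->
  is_derive x 1 (fun y => f y - g y) (d - e).
Proof. by move=> h1 h2; exact: is_deriveB. Qed.

Lemma cis_deriveD u v du dv : cis_derive u du -> cis_derive v dv ->
  cis_derive (fun x => u x + v x) (fun x => du x + dv x).
Proof.
move=> h1 h2 x; have [a1 a2] := h1 x; have [b1 b2] := h2 x; split.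
  apply: (is_derive_fun _ _ (is_deriveDfun a1 b1)); last by rewrite cReD.
  by move=> y; rewrite cReD.
apply: (is_derive_fun _ _ (is_deriveDfun a2 b2)); last by rewrite cImD.
by move=> y; rewrite cImD.
Qed.

Lemma cis_deriveM u v du dv : cis_derive u du -> cis_derive v dv ->
  cis_derive (fun x => u x * v x) (fun x => du x * v x + u x * dv x).
Proof.
move=> h1 h2 x; have [a1 a2] := h1 x; have [b1 b2] := h2 x; split.
  apply: (is_derive_fun _ _
    (is_deriveBfun (is_deriveMfun a1 b1) (is_deriveMfun a2 b2))).
    by move=> y; rewrite cReM.
  by rewrite !ReImE; ring.
apply: (is_derive_fun _ _
    (is_deriveDfun (is_deriveMfun a1 b2) (is_deriveMfun a2 b1))).
  by move=> y; rewrite cImM.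
by rewrite !ReImE; ring.
Qed.

Lemma cis_deriveJ u du : cis_derive u du ->
  cis_derive (fun x => (u x)^*) (fun x => (du x)^*).
Proof.
move=> h1 x; have [a1 a2] := h1 x; split.
  by apply: (is_derive_fun _ _ a1) => [y|]; rewrite cReJ.
by apply: (is_derive_fun _ _ (is_deriveNfun a2)) => [y|]; rewrite cImJ.
Qed.

Lemma cis_derive_cst (c : R[i]) : cis_derive (fun=> c) (fun=> 0).
Proof. by move=> x; split; exact: is_derive_cst. Qed.

Lemma cis_deriveZ c u du : cis_derive u du ->
  cis_derive (fun x => c * u x) (fun x => c * du x).
Proof.
move=> h; have := cis_deriveM (cis_derive_cst c) h.
by congr cis_derive; apply/funext => x; rewrite mul0r add0r.
Qed.

Lemma cis_derive_sum I (s : seq I) (F dF : I -> R -> R[i]) :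
  (forall i, cis_derive (F i) (dF i)) ->
  cis_derive (fun x => \sum_(i <- s) F i x) (fun x => \sum_(i <- s) dF i x).
Proof.
move=> h; elim: s => [|i s IH].
  have := cis_derive_cst 0.
  by congr cis_derive; apply/funext => x; rewrite big_nil.
have := cis_deriveD (h i) IH.
by congr cis_derive; apply/funext => x; rewrite big_cons.
Qed.

Lemma is_derive_comp (f g : R -> R) (x d e : R) :
  is_derive (g x) 1 f d -> is_derive x 1 g e ->
  is_derive x 1 (fun y => f (g y)) (e * d).
Proof. by move=> h1 h2; rewrite mulrC; exact: is_derive1_comp. Qed.

Lemma is_derive_lin (a x : R) : is_derive x 1 (fun y => a * y) a.
Proof.
have := is_deriveMfun (is_derive_cst a x 1) (is_derive_id x (1 : R)).
by rewrite mul0r add0r mulr1.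
Qed.

Lemma cis_derive_expi (a : R) :
  cis_derive (fun x => expi (a * x)) (fun x => (0 +i* a) * expi (a * x)).
Proof.
move=> x; split.
  apply: (is_derive_fun _ _
    (is_derive_comp (is_derive_cos (a * x)) (is_derive_lin a x))) => //.
  by rewrite cReM /=; ring.
apply: (is_derive_fun _ _
    (is_derive_comp (is_derive_sin (a * x)) (is_derive_lin a x))) => //.
by rewrite cImM /=; ring.
Qed.

Lemma cis_derive_en n :
  cis_derive (@en R n) (fun x => (0 +i* n%:~R) * en n x).
Proof. exact: cis_derive_expi. Qed.

End Derivatives.

(** * Trigonometric polynomials *)

Section Modes.
Implicit Types (n : int) (N M : nat).

Fixpoint modes N : seq int :=
  if N is N'.+1 then Posz N :: - Posz N :: modes N' else [:: 0].

Lemma mem_modes N n : (n \in modes N) = (`|n| <= N)%N.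
Proof.
elim: N n => [|N IH] n /=; first by rewrite inE; lia.
rewrite !inE IH; lia.
Qed.

Lemma uniq_modes N : uniq (modes N).
Proof.
elim: N => [|N IH] //; rewrite /= inE !mem_modes IH andbT; lia.
Qed.

End Modes.

Section Sums.
Context {R : realType}.

Lemma intr_norm_le_sqr (n : int) : `|n%:~R| <= n%:~R ^+ 2 :> R.
Proof.
have [->|n0] := eqVneq n 0; first by rewrite normr0 expr0n.
have : 1 <= `|n%:~R| :> R by rewrite -intr_norm ler1z; lia.
rewrite -(real_normK (num_real (n%:~R : R))) => h.
by rewrite expr2 ler_peMl.
Qed.

Lemma sum_CS I (s : seq I) (x y : I -> R) :
  (\sum_(i <- s) x i * y i) ^+ 2 <=
  (\sum_(i <- s) x i ^+ 2) * (\sum_(i <- s) y i ^+ 2).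
Proof.
elim: s => [|i s IH]; first by rewrite !big_nil expr0n mulr0.
rewrite !big_cons.
have X0 : 0 <= \sum_(i <- s) x i ^+ 2 by apply: sumr_ge0 => j _; exact: sqr_ge0.
have Y0 : 0 <= \sum_(i <- s) y i ^+ 2 by apply: sumr_ge0 => j _; exact: sqr_ge0.
move: IH X0 Y0; set p := \sum_(i <- s) _; set X := \sum_(i <- s) _.
set Y := \sum_(i <- s) _; move: p X Y (x i) (y i) => p X Y a b IH X0 Y0.
have h : 2 * (p * (a * b)) <= X * b ^+ 2 + Y * a ^+ 2.
  have h0 : 0 <= X * b ^+ 2 + Y * a ^+ 2.
    by rewrite addr_ge0 // mulr_ge0 // sqr_ge0.
  have h1 : (2 * (p * (a * b))) ^+ 2 <= (X * b ^+ 2 + Y * a ^+ 2) ^+ 2.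
    rewrite -subr_ge0 (_ : _ - _ = (X * b ^+ 2 - Y * a ^+ 2) ^+ 2 +
      4 * (a * b) ^+ 2 * (X * Y - p ^+ 2)); last by ring.
    rewrite addr_ge0 ?sqr_ge0 // mulr_ge0 ?subr_ge0 //.
    by rewrite mulr_ge0 // sqr_ge0.
  apply: le_trans (ler_norm _) _.
  by rewrite -(ger0_norm h0) -ler_sqr ?nnegrE // -!normrX !ger0_norm ?sqr_ge0.
nra.
Qed.

(** Cauchy-Schwarz for the weights [v] and their inverses. *)
Lemma nsq_sum_CS I (s : seq I) (v : I -> R) (a : I -> R[i]) :
  (forall i, 0 < v i) ->
  nsq (\sum_(i <- s) a i) <=
  (\sum_(i <- s) (v i)^-1) * (\sum_(i <- s) v i * nsq (a i)).
Proof.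
move=> v0.
have h (x : I -> R) : (\sum_(i <- s) x i) ^+ 2 <=
    (\sum_(i <- s) (v i)^-1) * (\sum_(i <- s) v i * x i ^+ 2).
  have := sum_CS s (fun i => Num.sqrt (v i)^-1) (fun i => Num.sqrt (v i) * x i).
  congr (_ <= _ * _).
  - congr (_ ^+ 2); apply: eq_bigr => i _.
    by rewrite mulrA -sqrtrM ?invr_ge0 ?ltW // mulVf ?gt_eqF // sqrtr1 mul1r.
  - by apply: eq_bigr => i _; rewrite sqr_sqrtr // invr_ge0 ltW.
  - by apply: eq_bigr => i _; rewrite exprMn sqr_sqrtr // ltW.
rewrite /nsq cRe_sum cIm_sum; apply: le_trans (lerD (h _) (h _)) _.
rewrite -mulrDr -big_split /= le_eqVlt; apply/orP; left; apply/eqP.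
by congr (_ * _); apply: eq_bigr => i _; rewrite mulrDr.
Qed.

End Sums.

Section TrigPoly.
Context {R : realType}.
Implicit Types (c d : int -> R[i]) (u v : R -> R[i]) (n : int) (N M : nat).

Definition wgt n : R := 1 + n%:~R ^+ 2.

Lemma wgt_gt0 n : 0 < wgt n.
Proof. by rewrite ltr_pwDl // sqr_ge0. Qed.
Lemma wgt_ge0 n : 0 <= wgt n. Proof. exact/ltW/wgt_gt0. Qed.
Lemma wgt_ge1 n : 1 <= wgt n.
Proof. by rewrite lerDl sqr_ge0. Qed.

(** By comparison with a telescoping series: [1/(1+n^2)] is at most [2/n - 2/(n+1)]
    for positive [n]. *)
Lemma sum_wgtV N : \sum_(n <- modes N) (wgt n)^-1 <= 5.
Proof.
suff : \sum_(n <- modes N) (wgt n)^-1 <= 5 - 4 / N.+1%:R.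
  move=> h; apply: (le_trans h); rewrite lerBlDr lerDl divr_ge0 //.
elim: N => [|N IH]; first by rewrite big_seq1 /wgt expr0n addr0 divr1; lra.
rewrite /= !big_cons {1 2}/wgt intrN sqrrN -pmulrn.
have -> : N.+2%:R = N.+1%:R + 1 :> R by rewrite -natr1.
have : 1 <= N.+1%:R :> R by rewrite ler1n.
move: IH; set S := \sum_(n <- _) _; move: (N.+1%:R) => m IH m1.
suff : 2 / (1 + m ^+ 2) <= 4 / m - 4 / (m + 1) by move: IH; lra.
have h1 : m != 0 by lra. have h2 : m + 1 != 0 by lra.
have h3 : 1 + m ^+ 2 != 0 by nra.
rewrite -subr_ge0 (_ : _ - _ =
  2 * (m ^+ 2 - m + 2) / (m * (m + 1) * (1 + m ^+ 2))); last first.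
  by field; rewrite h1 h2 h3.
by rewrite divr_ge0 //; nra.
Qed.

(** The square of the norm of H^1, up to the factor [2 pi] and restricted to the
    modes of index at most [N]. *)
Definition hn N c : R := \sum_(n <- modes N) wgt n * nsq (c n).
Definition l2n N c : R := \sum_(n <- modes N) nsq (c n).

Lemma hn_ge0 N c : 0 <= hn N c.
Proof. by apply: sumr_ge0 => n _; rewrite mulr_ge0 ?wgt_ge0 ?nsq_ge0. Qed.
Lemma l2n_le_hn N c : l2n N c <= hn N c.
Proof.
by apply: ler_sum => n _; rewrite ler_peMl ?nsq_ge0 ?wgt_ge1.
Qed.
Lemma hnD N c d : hn N (fun n => c n + d n) <= 2 * hn N c + 2 * hn N d.
Proof.
rewrite /hn !mulr_sumr -big_split; apply: ler_sum => n _ /=.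
rewrite !(mulrCA 2) -mulrDr ler_wpM2l ?wgt_ge0 //; exact: nsqD_le.
Qed.
Lemma hnB N c d : hn N (fun n => c n - d n) <= 2 * hn N c + 2 * hn N d.
Proof.
rewrite /hn !mulr_sumr -big_split; apply: ler_sum => n _ /=.
rewrite !(mulrCA 2) -mulrDr ler_wpM2l ?wgt_ge0 //; exact: nsqB_le.
Qed.
Lemma hn_mono N M c : (N <= M)%N -> hn N c <= hn M c.
Proof.
move=> NM; rewrite -(subnK NM); elim: (M - N)%N => [|k IH] //.
apply: (le_trans IH); rewrite addSn {2}/hn /= !big_cons addrA lerDr.
by rewrite addr_ge0 // mulr_ge0 ?wgt_ge0 ?nsq_ge0.
Qed.
Lemma hn_term N c n : (`|n| <= N)%N -> wgt n * nsq (c n) <= hn N c.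
Proof.
rewrite -mem_modes => nN; rewrite /hn (bigD1_seq n) ?uniq_modes //= lerDl.
by apply: sumr_ge0 => m _; rewrite mulr_ge0 ?wgt_ge0 ?nsq_ge0.
Qed.

Definition tp N c t : R[i] := \sum_(n <- modes N) c n * en n t.

Lemma ccont_tp N c : ccont (tp N c).
Proof. by apply: ccont_sum => n; auto with cont. Qed.

Lemma tp_periodic N c t : tp N c (t + 2 * pi) = tp N c t.
Proof. by apply: eq_bigr => n _; rewrite en_periodic. Qed.

(** The Sobolev embedding, from Cauchy-Schwarz and the convergence of the series
    of the inverse weights. *)
Lemma nsq_tp_le N c t : nsq (tp N c t) <= 5 * hn N c.
Proof.
apply: le_trans (nsq_sum_CS _ _ wgt_gt0) _.
rewrite (_ : \sum_(i <- _) wgt i * _ = hn N c); last first.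
  by apply: eq_bigr => n _; rewrite nsqM nsq_en mulr1.
by rewrite ler_wpM2r ?hn_ge0 // sum_wgtV.
Qed.

Lemma tpD N c d t : tp N (fun n => c n + d n) t = tp N c t + tp N d t.
Proof. by rewrite /tp -big_split; apply: eq_bigr => n _; rewrite mulrDl. Qed.
Lemma tpB N c d t : tp N (fun n => c n - d n) t = tp N c t - tp N d t.
Proof. by rewrite /tp -sumrB; apply: eq_bigr => n _; rewrite mulrBl. Qed.

Definition dcoef c n : R[i] := (0 +i* n%:~R) * c n.

Lemma cis_derive_tp N c : cis_derive (tp N c) (tp N (dcoef c)).
Proof.
have := @cis_derive_sum R _ (modes N) (fun n t => c n * en n t)
  (fun n t => c n * ((0 +i* n%:~R) * en n t)) _.
move=> /(_ (fun n => cis_deriveZ (c n) (cis_derive_en n))).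
congr cis_derive; apply/funext => t; apply: eq_bigr => n _.
by rewrite /dcoef mulrA (mulrC (c n)).
Qed.

Lemma nsq_dcoef c n : nsq (dcoef c n) = n%:~R ^+ 2 * nsq (c n).
Proof. by rewrite nsqM {1}/nsq /= expr0n add0r. Qed.

Lemma hnE N c : hn N c = l2n N c + l2n N (dcoef c).
Proof.
rewrite -big_split; apply: eq_bigr => n _ /=.
by rewrite nsq_dcoef mulrDl mul1r.
Qed.

Definition fcoef u n : R[i] := mean (fun t => u t * en (- n) t).

Lemma mean_en n : mean (@en R n) = (n == 0)%:R.
Proof.
have [->|n0] := eqVneq n 0.
  rewrite (_ : en 0 = fun=> 1) ?mean_cst //.
  by apply/funext => t; rewrite en0.
have /mean_derive := cis_derive_en (R := R) n.
rewrite -[X in en n X]add0r en_periodic => /(_ _ erefl).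
rewrite meanZ; last exact/cint_cont/ccont_en.
have cc : ccont (fun x : R => (0 +i* n%:~R) * en n x) by auto with cont.
move=> /(_ cc) /eqP; rewrite mulf_eq0 => /orP[|/eqP->//].
by rewrite eq_complex /= intr_eq0 (negbTE n0) andbF.
Qed.

Lemma fcoef_en n m : fcoef (en m) n = (m == n)%:R.
Proof.
rewrite /fcoef (_ : (fun t => _) = en (m - n)) ?mean_en ?subr_eq0 //.
by apply/funext => t; rewrite enD.
Qed.

Lemma cint_bounded u v : ccont u -> cint v ->
  cint (fun x => v x * u x).
Proof.
have key (f g : R -> R) : rcont f -> rint g -> rint (fun x => g x * f x).
  move=> cf ig; apply: (integrableMl _ ig) => //.
    by apply: measurable_funTS; exact: continuous_measurable_fun.
  have cK : compact `[0, 2 * pi : R]%classic by exact: segment_compact.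
  have cfK : {within `[0, 2 * pi : R]%classic, continuous f}.
    exact: continuous_subspaceT.
  have /compact_bounded[M [Mr Mb]] := continuous_compact cfK cK.
  by exists M; split => // x Mx y Dy; apply: Mb => //; exists y.
move=> [u1 u2] [v1 v2]; split.
  by under eq_fun do rewrite cReM; apply: rintB; apply: key.
by under eq_fun do rewrite cImM; apply: rintD; apply: key.
Qed.

Lemma cint_en v n : cint v -> cint (fun x => v x * en n x).
Proof. exact/cint_bounded/ccont_en. Qed.

Lemma fcoefD u v n : cint u -> cint v ->
  fcoef (fun t => u t + v t) n = fcoef u n + fcoef v n.
Proof.
move=> iu iv; rewrite /fcoef -meanD; try exact: cint_en.
by congr mean; apply/funext => t; rewrite mulrDl.
Qed.
Lemma fcoefB u v n : cint u -> cint v ->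
  fcoef (fun t => u t - v t) n = fcoef u n - fcoef v n.
Proof.
move=> iu iv; rewrite /fcoef -meanB; try exact: cint_en.
by congr mean; apply/funext => t; rewrite mulrBl.
Qed.
Lemma fcoefZ a u n : cint u -> fcoef (fun t => a * u t) n = a * fcoef u n.
Proof.
move=> iu; rewrite /fcoef -meanZ; last exact: cint_en.
by congr mean; apply/funext => t; rewrite mulrA.
Qed.

Lemma fcoef_tp N c n : fcoef (tp N c) n = if (`|n| <= N)%N then c n else 0.
Proof.
rewrite /fcoef /tp.
rewrite (_ : (fun t => _) = fun t => \sum_(m <- modes N) c m * en (m - n) t).
  rewrite mean_sum; last by move=> m; apply/cint_cont; auto with cont.
  transitivity (\sum_(m <- modes N) if m == n then c m else 0).
    apply: eq_bigr => m _; rewrite meanZ; last exact/cint_cont/ccont_en.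
    by rewrite mean_en subr_eq0; case: eqP => _; rewrite ?mulr1 ?mulr0.
  rewrite -big_mkcond /= -mem_modes; case: ifPn => nN.
    by rewrite -big_filter filter_pred1_uniq ?uniq_modes // big_seq1.
  by rewrite big_seq_cond big1 // => m /andP[mN /eqP mn]; rewrite -mn mN in nN.
by apply/funext => t; rewrite mulr_suml; apply: eq_bigr => m _; rewrite enD mulrA.
Qed.

Lemma mean_tpJ N c v : cint v ->
  mean (fun t => v t * (tp N c t)^*) = \sum_(n <- modes N) fcoef v n * (c n)^*.
Proof.
move=> iv; transitivity (mean (fun t =>
    \sum_(n <- modes N) (c n)^* * (v t * en (- n) t))).
  congr mean; apply/funext => t; rewrite /tp rmorph_sum mulr_sumr.
  by apply: eq_bigr => n _; rewrite rmorphM enN /= mulrCA.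
rewrite mean_sum; last by move=> n; exact/cintZ/cint_en.
by apply: eq_bigr => n _; rewrite meanZ 1?mulrC //; exact: cint_en.
Qed.

Lemma rmean_tpJ N c v : cint v ->
  rmean (fun t => complex.Re (v t * (tp N c t)^*)) =
  \sum_(n <- modes N) complex.Re (fcoef v n * (c n)^*).
Proof. by move=> iv; rewrite -cRe_sum -mean_tpJ. Qed.

Lemma rmean_nsq_tp N c : rmean (fun t => nsq (tp N c t)) = l2n N c.
Proof.
rewrite (_ : (fun t => _) = fun t => complex.Re (tp N c t * (tp N c t)^*)).
  rewrite rmean_tpJ; last exact/cint_cont/ccont_tp.
  rewrite big_seq [RHS]big_seq; apply: eq_bigr => n.
  by rewrite mem_modes fcoef_tp => ->; rewrite nsqE.
by apply/funext => t; rewrite nsqE.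
Qed.

(** The mean square of the difference between [v] and its Fourier polynomial is
    nonnegative. *)
Lemma bessel N v : cint v -> rint (fun t => nsq (v t)) ->
  l2n N (fcoef v) <= rmean (fun t => nsq (v t)).
Proof.
move=> iv iv2; have cT := ccont_tp N (fcoef v).
have i1 : rint (fun t => complex.Re (v t * (tp N (fcoef v) t)^*)).
  by have [] := cint_bounded (ccontJ cT) iv.
have i2 : rint (fun t => nsq (tp N (fcoef v) t)).
  exact/rint_cont/ccont_nsq.
have : 0 <= rmean (fun t => nsq (v t - tp N (fcoef v) t)).
  by apply: rmean_ge0 => t; exact: nsq_ge0.
rewrite (_ : (fun t => _) = fun t => nsq (v t) +
  ((- 2) * complex.Re (v t * (tp N (fcoef v) t)^*) + nsq (tp N (fcoef v) t))).
  rewrite (rmeanD iv2 (rintD (rintZ _ i1) i2)) (rmeanD (rintZ _ i1) i2).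
  rewrite (rmeanZ _ i1) rmean_nsq_tp rmean_tpJ //.
  rewrite (eq_bigr (fun n => nsq (fcoef v n))); last first.
    by move=> n _; rewrite nsqE.
  rewrite -/(l2n N (fcoef v)); lra.
by apply/funext => t; rewrite /nsq !ReImE; ring.
Qed.

(** Integration by parts; the boundary terms cancel because [u] takes the same
    value at both ends of the period. *)
Lemma fcoef_derive u du n : cis_derive u du -> ccont u -> ccont du ->
  u (2 * pi) = u 0 -> fcoef du n = (0 +i* n%:~R) * fcoef u n.
Proof.
move=> hu cu cdu uper; have h := cis_deriveM hu (cis_derive_en (- n)).
have /mean_derive : ccont (fun x => du x * en (- n) x +
    u x * ((0 +i* (- n)%:~R) * en (- n) x)) by auto 10 with cont.
move=> /(_ _ h); rewrite uper -[X in en _ X]add0r en_periodic => /(_ erefl).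
rewrite meanD; try by apply/cint_cont; auto 10 with cont.
rewrite (_ : (fun x => u x * _) =
    fun x => (0 +i* (- n)%:~R) * (u x * en (- n) x)); last first.
  by apply/funext => x; ring.
rewrite meanZ; last by apply/cint_cont; auto with cont.
rewrite -/(fcoef du n) -/(fcoef u n) => /eqP; rewrite addr_eq0 => /eqP ->.
by rewrite intrN -mulNr; congr (_ * _); apply: complexP; rewrite ?ReImE /= ?oppr0 ?opprK.
Qed.

End TrigPoly.

(** * The cubic nonlinearity and the Lyapunov functional *)

Section CubicLipschitz.
Context {R : realType}.
Implicit Types (x y z : R[i]).

Definition cub x : R[i] := (nsq x)%:C * x.

Lemma nsqB x y : nsq (x - y) = nsq x + nsq y - 2 * complex.Re (x * y^*).
Proof. by rewrite /nsq !ReImE; ring. Qed.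
Lemma nsqD x y : nsq (x + y) = nsq x + nsq y + 2 * complex.Re (x * y^*).
Proof. by rewrite /nsq !ReImE; ring. Qed.

Lemma Re_normc_le x y :
  `|complex.Re (x * y^*)| <= Normc.normc x * Normc.normc y.
Proof.
rewrite -[leRHS]ger0_norm ?mulr_ge0 ?normc_ge0 // -ler_sqr ?nnegrE //.
by rewrite -!normrX !ger0_norm ?sqr_ge0 // exprMn !normc_nsq ReMJ_CS.
Qed.

(** With [a], [b] the moduli and [r] the real inner product of the two numbers, the
    difference of the two sides is a nonnegative multiple of [a b - r] plus the
    same difference for two nonnegative reals. *)
Lemma nsq_cubB_le x y :
  nsq (cub x - cub y) <= 3 * (nsq x + nsq y) ^+ 2 * nsq (x - y).
Proof.
rewrite /cub !nsqB !nsqM !nsqC.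
have -> : complex.Re ((nsq x)%:C * x * ((nsq y)%:C * y)^*) =
    nsq x * nsq y * complex.Re (x * y^*).
  by rewrite !ReImE /=; ring.
have := Re_normc_le x y; rewrite -!normc_nsq.
have := normc_ge0 y; have := normc_ge0 x.
move: (Normc.normc x) (Normc.normc y) (complex.Re _) => a b r a0 b0.
rewrite ler_norml => /andP[_ rab].
have B0 : 0 <= 6 * (a ^+ 2 + b ^+ 2) ^+ 2 - 2 * (a ^+ 2 * b ^+ 2).
  by have := sqr_ge0 (a ^+ 2); have := sqr_ge0 (b ^+ 2);
    have := mulr_ge0 (sqr_ge0 a) (sqr_ge0 b); lra.
have h : 0 <= (6 * (a ^+ 2 + b ^+ 2) ^+ 2 - 2 * (a ^+ 2 * b ^+ 2)) * (a * b - r).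
  by rewrite mulr_ge0 // subr_ge0.
have h2 : 0 <= (a - b) ^+ 2 *
    (3 * (a ^+ 2 + b ^+ 2) ^+ 2 - (a ^+ 2 + a * b + b ^+ 2) ^+ 2).
  rewrite mulr_ge0 ?sqr_ge0 //.
  have := mulr_ge0 (sqr_ge0 (a - b)) (addr_ge0 (sqr_ge0 a) (sqr_ge0 b)).
  have := mulr_ge0 (sqr_ge0 (a - b)) (mulr_ge0 a0 b0).
  have := sqr_ge0 (a ^+ 2 - b ^+ 2); have := sqr_ge0 ((a - b) ^+ 2).
  have := sqr_ge0 (a ^+ 2 + b ^+ 2); have := mulr_ge0 (sqr_ge0 a) (sqr_ge0 b).
  nra.
by rewrite -subr_ge0; have := addr_ge0 h h2; congr (0 <= _); ring.
Qed.

End CubicLipschitz.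

Section FiniteLevel.
Context {R : realType} (p k : R).
Implicit Types (c d s : int -> R[i]) (n : int) (N : nat).

(** The symbol of minus [(2k d/dz + ip)^2 + 1]. For [p = k = 1] it is [4n(n+1)],
    which vanishes exactly for the modes 0 and -1. *)
Definition lam n : R := (2 * k * n%:~R + p) ^+ 2 - 1.

(** The energy, in the frame that moves with the phase of the wave. *)
Definition Lam N c : R := \sum_(n <- modes N) lam n * nsq (c n) +
  2^-1 * rmean (fun t => nsq (tp N c t) ^+ 2).

(** Half of the differential of [Lam]. *)
Definition dLam N c d : R :=
  \sum_(n <- modes N) lam n * complex.Re (c n * (d n)^*) +
  rmean (fun t => nsq (tp N c t) * complex.Re (tp N c t * (tp N d t)^*)).

(** What remains of the quartic density [nsq ^+ 2] beyond its first order. *)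
Definition qrem N c d t : R :=
  (2 * complex.Re (tp N c t * (tp N d t)^*) + nsq (tp N d t)) ^+ 2 +
  2 * nsq (tp N c t) * nsq (tp N d t).

Lemma rcont_qrem N c d : rcont (qrem N c d).
Proof.
have c1 := ccont_tp N c; have c2 := ccont_tp N d.
by rewrite /qrem; auto 20 with cont.
Qed.

(** The quartic remainder is kept in the form of a sum of squares: it is
    nonnegative whatever the size of the perturbation, because the equation is
    defocusing. *)
Lemma Lam_expand N c d : Lam N (fun n => c n + d n) = Lam N c +
  2 * dLam N c d + \sum_(n <- modes N) lam n * nsq (d n) +
  2^-1 * rmean (qrem N c d).
Proof.
have c1 := ccont_tp N c; have c2 := ccont_tp N d.
have i1 : rint (fun t => nsq (tp N c t) ^+ 2).
  by apply: rint_cont; auto with cont.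
have i2 : rint (fun t => nsq (tp N c t) * complex.Re (tp N c t * (tp N d t)^*)).
  by apply: rint_cont; auto with cont.
have i3 := rint_cont (@rcont_qrem N c d).
rewrite /Lam /dLam (_ : (fun t => nsq (tp N _ t) ^+ 2) = fun t =>
    nsq (tp N c t) ^+ 2 + (4 * (nsq (tp N c t) *
    complex.Re (tp N c t * (tp N d t)^*)) + qrem N c d t)); last first.
  by apply/funext => t; rewrite tpD nsqD /qrem; ring.
rewrite (rmeanD i1 (rintD (rintZ _ i2) i3)) (rmeanD (rintZ _ i2) i3).
rewrite (rmeanZ _ i2).
have -> : \sum_(n <- modes N) lam n * nsq (c n + d n) =
    \sum_(n <- modes N) lam n * nsq (c n) +
    2 * \sum_(n <- modes N) lam n * complex.Re (c n * (d n)^*) +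
    \sum_(n <- modes N) lam n * nsq (d n).
  by rewrite mulr_sumr -!big_split; apply: eq_bigr => n _ /=; rewrite nsqD; ring.
by field.
Qed.

Lemma qrem_ge0 N c d t : 0 <= qrem N c d t.
Proof. by rewrite addr_ge0 ?sqr_ge0 // !mulr_ge0 ?nsq_ge0. Qed.

Lemma rmean_qrem_le N c d :
  rmean (qrem N c d) <= (50 * hn N c + 10 * hn N d) * l2n N d.
Proof.
have c2 := ccont_tp N d.
rewrite -rmean_nsq_tp -rmeanZ; last by apply: rint_cont; auto with cont.
apply: rmean_le => [||t].
- exact: rint_cont (@rcont_qrem N c d).
- by apply: rint_cont; auto with cont.
have := nsq_tp_le N c t; have := nsq_tp_le N d t; rewrite /qrem.
have := ReMJ_CS (tp N c t) (tp N d t).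
have := nsq_ge0 (tp N c t); have := nsq_ge0 (tp N d t).
move: (nsq (tp N d t)) (nsq (tp N c t)) (complex.Re _) (hn N c) (hn N d).
move=> y x r hc hd.
move=> y0 x0 r2 yd xc.
have h1 : 0 <= y * (5 * hd - y) by rewrite mulr_ge0 // subr_ge0.
have h2 : 0 <= y * (5 * hc - x) by rewrite mulr_ge0 // subr_ge0.
have h3 : 0 <= (2 * r - y) ^+ 2 by exact: sqr_ge0.
nra.
Qed.

(** The modes on which [lam] is bounded from below. *)
Definition hi n := (n != 0) && (n != -1).
Definition hh N c : R := \sum_(n <- modes N | hi n) wgt n * nsq (c n).

Lemma modes_split N (F : int -> R) : (0 < N)%N ->
  \sum_(n <- modes N) F n = F 0 + F (-1) + \sum_(n <- modes N | hi n) F n.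
Proof.
move=> N0; rewrite (bigD1_seq 0) ?uniq_modes ?mem_modes //=.
rewrite -big_filter (bigD1_seq (-1)) ?filter_uniq ?uniq_modes //=; last first.
  by rewrite mem_filter mem_modes.
by rewrite big_filter_cond addrA.
Qed.

Lemma hh_ge0 N c : 0 <= hh N c.
Proof. by apply: sumr_ge0 => n _; rewrite mulr_ge0 ?wgt_ge0 ?nsq_ge0. Qed.

Lemma hn_split N c : (0 < N)%N ->
  hn N c = nsq (c 0) + 2 * nsq (c (-1)) + hh N c.
Proof.
move=> N0; rewrite /hn modes_split // /wgt -/(hh N c).
by rewrite expr0n addr0 mul1r rmorphN1 sqrrN expr1n.
Qed.

Definition high c n : R[i] := if hi n then c n else 0.

Lemma high_sum N c (G : int -> R[i] -> R) :
  (forall n, G n 0 = 0) ->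
  \sum_(n <- modes N) G n (high c n) = \sum_(n <- modes N | hi n) G n (c n).
Proof.
move=> G0; rewrite [RHS]big_mkcond; apply: eq_bigr => n _; rewrite /high.
by case: ifP.
Qed.

Lemma l2n_high N c : l2n N (high c) <= hh N c.
Proof.
rewrite /l2n (@high_sum N c (fun n z => nsq z)) => [|n]; last exact: nsq0.
by apply: ler_sum => n _; rewrite ler_peMl ?nsq_ge0 ?wgt_ge1.
Qed.

Lemma tp_high N c t : (0 < N)%N ->
  tp N c t = c 0 * en 0 t + c (-1) * en (-1) t + tp N (high c) t.
Proof.
move=> N0; rewrite /tp (bigD1_seq 0) ?uniq_modes ?mem_modes //=.
rewrite -big_filter (bigD1_seq (-1)) ?filter_uniq ?uniq_modes //=; last first.
  by rewrite mem_filter mem_modes.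
rewrite big_filter_cond addrA; congr (_ + _).
rewrite [in RHS](bigID hi) /= [X in _ + X]big1 ?addr0.
  by apply: eq_bigr => n nh; rewrite /high /hi nh.
by move=> n /negbTE nh; rewrite /high nh mul0r.
Qed.

Section SmallParameters.
Variable e : R.
Hypotheses (e100 : e <= 1 / 100) (hp : `|p - 1| <= e) (hk : `|k - 1| <= e).

Let bounds : [/\ 1 - e <= p, p <= 1 + e, 1 - e <= k & k <= 1 + e].
Proof.
by move: hp hk; rewrite !ler_norml => /andP[p1 p2] /andP[k1 k2]; split; lra.
Qed.

(** For [p] and [k] close to 1, [lam n] is close to [4n(n+1)], which is at least
    [8/5 (1 + n^2)] off the two low modes, the worst case being [n = -2]. *)
Lemma lam_hi n : hi n -> wgt n <= lam n.
Proof.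
have e1 := e100; have [p1 p2 k1 k2] := bounds; rewrite /hi /wgt /lam => /andP[n0 n1].
have [n2|n2] : (1 <= n)%R \/ (n <= - 2%:Z)%R by lia.
  have : 1 <= n%:~R :> R by rewrite -(ler_int R) in n2.
  move: (n%:~R) => x x1.
  have h : 0 <= (k - 19 / 20) * x by rewrite mulr_ge0 //; lra.
  have h1 : 0 <= x * (x - 1) by rewrite mulr_ge0 //; lra.
  have : (19 / 10 * x + 9 / 10) ^+ 2 <= (2 * k * x + p) ^+ 2.
    by apply: lerXn2r; rewrite ?nnegrE; lra.
  move: ((2 * k * x + p) ^+ 2) => y; lra.
have : n%:~R <= - 2 :> R.
  by move: n2; rewrite -(ler_int R) intrN.
move: (n%:~R) => x x1.
have h : 0 <= (k - 99 / 100) * (- x) by rewrite mulr_ge0 //; lra.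
have h1 : 0 <= (- x) * (- x - 2) by rewrite mulr_ge0 //; lra.
have : (99 / 50 * (- x) - 101 / 100) ^+ 2 <= (- (2 * k * x + p)) ^+ 2.
  by apply: lerXn2r; rewrite ?nnegrE; lra.
rewrite sqrrN; move: ((2 * k * x + p) ^+ 2) => y; lra.
Qed.

Lemma lam_le n : `|lam n| <= 20 * wgt n.
Proof.
have e1 := e100; have [p1 p2 k1 k2] := bounds.
rewrite /lam /wgt; move: (n%:~R) => x.
have h1 : 0 <= (5 / 4 - k ^+ 2) * x ^+ 2.
  by rewrite mulr_ge0 ?sqr_ge0 // subr_ge0; nra.
have h2 : p ^+ 2 <= 2 by nra.
have h3 : 0 <= (2 * k * x - p) ^+ 2 by exact: sqr_ge0.
have h4 : 0 <= (2 * k * x + p) ^+ 2 by exact: sqr_ge0.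
have h5 : 0 <= x ^+ 2 by exact: sqr_ge0.
rewrite ler_norml; apply/andP; split; lra.
Qed.

Lemma lam_0 : `|lam 0| <= 8 * e.
Proof.
have e1 := e100; have [p1 p2 k1 k2] := bounds.
have e0 : 0 <= e by apply: le_trans hp; exact: normr_ge0.
by rewrite /lam mulr0 add0r ler_norml; apply/andP; split; nra.
Qed.

Lemma lam_m1 : `|lam (-1)| <= 8 * e.
Proof.
have e1 := e100; have [p1 p2 k1 k2] := bounds; rewrite /lam rmorphN1.
have e0 : 0 <= e by apply: le_trans hp; exact: normr_ge0.
have : 1 - 3 * e <= 2 * k - p by lra.
have : 2 * k - p <= 1 + 3 * e by lra.
rewrite (_ : 2 * k * -1 + p = - (2 * k - p)) ?sqrrN; last by ring.
move: (2 * k - p) => y y1 y2.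
by rewrite ler_norml; apply/andP; split; nra.
Qed.

End SmallParameters.
End FiniteLevel.

(** * Orbital stability on finitely many modes *)

Section Stability.
Context {R : realType} (p k e : R).
Hypotheses (e100 : e <= 1 / 100) (hp : `|p - 1| <= e) (hk : `|k - 1| <= e).
Implicit Types (c d s : int -> R[i]) (n : int) (N : nat).
Local Notation lam := (lam p k).
Local Notation Lam := (Lam p k).
Local Notation dLam := (dLam p k).

Lemma ReMJ_le4 (x y : R[i]) :
  `|complex.Re (x * y^*)| <= nsq x + nsq y / 4.
Proof.
have p1 := nsq_ge0 (x + (2^-1)%:C * y); have p2 := nsq_ge0 (x - (2^-1)%:C * y).
move: p1 p2; rewrite nsqB nsqD !nsqM !nsqC !ReImE /=.
rewrite ler_norml => p1 p2; apply/andP; split; lra.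
Qed.

(** The high modes of an almost critical point are dominated by either of its low
    modes. Test the equation against the high modes: the linear part controls
    their norm, and the cubic term of the single mode [m'] is orthogonal to
    them, so that it contributes only through the mode [m] and the high modes
    themselves, with a small factor. *)
Lemma high_modes_le N c m m' (rho : R) :
  (0 < N)%N -> hn N c <= 1 / 100 -> (`|m'| <= N)%N -> ~~ hi m' ->
  (forall t, tp N c t = c m * en m t + c m' * en m' t + tp N (high c) t) ->
  dLam N c (high c) <= rho ^+ 2 ->
  hh N c <= 2 * rho ^+ 2 + nsq (c m).
Proof.
move=> N0 hc m'N m'h cE dl; set h := high c.
have cP := ccont_tp N c; have ch := ccont_tp N h.
pose u t : R[i] := c m' * en m' t.
have cu : ccont u by rewrite /u; auto with cont.
have i1 : rint (fun t => nsq (tp N c t) * complex.Re (tp N c t * (tp N h t)^*)).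
  by apply: rint_cont; auto with cont.
have i2 : rint (fun t => nsq (u t) * complex.Re (u t * (tp N h t)^*)).
  by apply: rint_cont; auto with cont.
have i3 : rint (fun t => nsq (tp N h t)) by apply: rint_cont; auto with cont.
have i4 : rint (fun t : R => nsq (c m) / 8) by exact/rint_cont/rcont_cst.
(* |u|^2 u is a multiple of the mode m', which the high modes do not see *)
have ortho : rmean (fun t => nsq (u t) * complex.Re (u t * (tp N h t)^*)) = 0.
  have -> : (fun t => nsq (u t) * complex.Re (u t * (tp N h t)^*)) =
      fun t => nsq (c m') * complex.Re (u t * (tp N h t)^*).
    by apply/funext => t; rewrite {1}/u nsqM nsq_en mulr1.
  rewrite rmeanZ; last by apply: rint_cont; auto with cont.
  rewrite rmean_tpJ; last exact: cint_cont.
  rewrite big1 ?mulr0 // => n _; rewrite fcoefZ; last exact/cint_cont/ccont_en.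
  rewrite fcoef_en; case: eqP => [<-|_]; last by rewrite mulr0 mul0r.
  by rewrite /h /high (negbTE m'h) rmorph0 mulr0.
have lamh : hh N c <= \sum_(n <- modes N) lam n * complex.Re (c n * (h n)^*).
  rewrite (@high_sum _ N c (fun n z => lam n * complex.Re (c n * z^*))); last first.
    by move=> n; rewrite rmorph0 !mulr0.
  apply: ler_sum => n hn0; rewrite -nsqE ler_wpM2r ?nsq_ge0 //.
  exact: (lam_hi e100).
have cub_close : `|rmean (fun t =>
    nsq (tp N c t) * complex.Re (tp N c t * (tp N h t)^*))| <=
    nsq (c m) / 8 + 3 / 8 * l2n N h.
  rewrite -[X in `|X|]subr0 -ortho -(rmeanB i1 i2).
  rewrite -rmean_nsq_tp -rmeanZ // -[nsq (c m) / 8]rmean_cst.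
  rewrite -(rmeanD i4 (rintZ _ i3)).
  apply: rmean_norm_le => [||t]; [exact: rintB|exact/rintD/rintZ|].
  have -> : nsq (tp N c t) * complex.Re (tp N c t * (tp N h t)^*) -
      nsq (u t) * complex.Re (u t * (tp N h t)^*) =
      complex.Re ((cub (tp N c t) - cub (u t)) * (tp N h t)^*).
    by rewrite /cub !ReImE /=; ring.
  apply: le_trans (ReMJ_le4 _ _) _.
  have h1 := nsq_cubB_le (tp N c t) (u t).
  have h2 : nsq (tp N c t - u t) <= 2 * nsq (c m) + 2 * nsq (tp N h t).
    rewrite cE /u (_ : _ - _ = c m * en m t + tp N h t); last by ring.
    by apply: le_trans (nsqD_le _ _) _; rewrite nsqM nsq_en mulr1.
  have h3 := nsq_tp_le N c t.
  have h4 : nsq (u t) <= 1 / 100.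
    rewrite /u nsqM nsq_en mulr1; apply: le_trans hc.
    apply: le_trans (hn_term c m'N).
    by rewrite ler_peMl ?nsq_ge0 ?wgt_ge1.
  have h5 : nsq (tp N c t) + nsq (u t) <= 6 / 100 by lra.
  have h6 : 3 * (nsq (tp N c t) + nsq (u t)) ^+ 2 <= 1 / 16.
    move: h5 (addr_ge0 (nsq_ge0 (tp N c t)) (nsq_ge0 (u t))).
    by move: (nsq (tp N c t) + nsq (u t)) => y h5 y0; nra.
  have h7 : 3 * (nsq (tp N c t) + nsq (u t)) ^+ 2 * nsq (tp N c t - u t) <=
      1 / 16 * nsq (tp N c t - u t) by rewrite ler_wpM2r ?nsq_ge0.
  lra.
have := sqr_ge0 rho; have := nsq_ge0 (c m).
move: dl; rewrite /dLam; move: lamh cub_close (l2n_high N c); rewrite -/h.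
move: (\sum_(n <- _) _) (rmean _) => S M h1.
rewrite ler_norml => /andP[h2 _] h3 h4 h5 h6; lra.
Qed.

(** If [a] dominates [sg], divide by [X + a]; otherwise the bound on the difference
    of the squares is of the order of [sg ^+ 2]. That the result does not
    depend on the size of [a] is essential: the wave may be arbitrarily small. *)
Lemma modulus_close (a X sg : R) : 0 <= a -> 0 <= X -> 0 < sg ->
  `|X ^+ 2 - a ^+ 2| <= 7 * sg ^+ 2 + 4 * a * sg -> `|X - a| <= 11 * sg.
Proof.
move=> a0 X0 sg0; rewrite subr_sqr normrM (ger0_norm (addr_ge0 X0 a0)).
set y := `|X - a| => h.
have y0 : 0 <= y by exact: normr_ge0.
have ya : y <= X + a by rewrite ler_norml; lra.
have h1 : y * a <= 7 * sg ^+ 2 + 4 * a * sg.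
  by apply: le_trans h; rewrite ler_wpM2l //; lra.
have h2 : y * y <= 7 * sg ^+ 2 + 4 * a * sg.
  by apply: le_trans h; rewrite ler_wpM2l.
have [sa|sa] := leP sg a.
  rewrite -(ler_pM2r (lt_le_trans sg0 sa)); apply: (le_trans h1).
  have : 0 <= sg * (a - sg) by rewrite mulr_ge0 ?subr_ge0 // ltW.
  lra.
rewrite leNgt; apply/negP => yb.
have : sg * (11 * sg) < y * y.
  by apply: (@lt_le_trans _ _ (y * (11 * sg))); [rewrite ltr_pM2r|rewrite ler_wpM2l //]; lra.
have : 0 <= sg * (sg - a) by rewrite mulr_ge0 ?subr_ge0 // ltW.
lra.
Qed.

Lemma hi_nsqD N c d (kap : int -> R) : (forall n, hi n -> `|kap n| <= wgt n) ->
  `|\sum_(n <- modes N | hi n) kap n * (nsq (c n + d n) - nsq (c n))| <=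
  2 * Num.sqrt (hh N c) * Num.sqrt (hh N d) + hh N d.
Proof.
move=> hk0; apply: le_trans (ler_norm_sum _ _ _) _.
have [w [w0 wE]] : exists w : int -> R,
    (forall n, 0 <= w n) /\ (forall n, w n ^+ 2 = wgt n).
  exists (fun n => Num.sqrt (wgt n)); split=> n; first exact: sqrtr_ge0.
  by rewrite sqr_sqrtr ?wgt_ge0.
have CS : \sum_(n <- modes N | hi n)
    (w n * Normc.normc (c n)) * (w n * Normc.normc (d n))
    <= Num.sqrt (hh N c) * Num.sqrt (hh N d).
  rewrite -big_filter -sqrtrM ?hh_ge0 //.
  apply: le_trans (ler_norm _) _; rewrite -sqrtr_sqr ler_wsqrtr //.
  apply: le_trans (sum_CS _ _ _) _; rewrite !big_filter le_eqVlt; apply/orP; left.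
  apply/eqP; congr (_ * _); apply: eq_bigr => n _;
    by rewrite exprMn wE normc_nsq.
apply: (@le_trans _ _ (\sum_(n <- modes N | hi n)
   (2 * ((w n * Normc.normc (c n)) *
   (w n * Normc.normc (d n))) + wgt n * nsq (d n)))).
  apply: ler_sum => n nh; rewrite normrM.
  have -> : 2 * ((w n * Normc.normc (c n)) *
     (w n * Normc.normc (d n))) + wgt n * nsq (d n) =
     wgt n * (2 * (Normc.normc (c n) * Normc.normc (d n)) + nsq (d n)).
    by rewrite -wE; ring.
  apply: ler_pM; rewrite ?normr_ge0 ?hk0 //.
  have -> : nsq (c n + d n) - nsq (c n) =
      2 * complex.Re (c n * (d n)^*) + nsq (d n) by rewrite nsqD; ring.
  apply: le_trans (ler_normD _ _) _; rewrite (ger0_norm (nsq_ge0 _)) lerD2r.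
  by rewrite normrM normr_nat ler_wpM2l // Re_normc_le.
by rewrite big_split /= -mulr_sumr lerD2r -mulrA ler_wpM2l.
Qed.

(** Control of one aligned low mode. The weights [kap] single out the mode [m]: the
    weighted charge, which is almost conserved, is [nsq (s m)] plus a
    contribution of the high modes. The latter is quadratic in the high modes
    of the perturbation up to a cross term with those of the wave, themselves
    dominated by [c m]. *)
Lemma charge_close N c s0 s (kap : int -> R) m m' (rho : R) :
  (0 < N)%N -> 0 < rho -> kap m = 1 -> kap m' = 0 ->
  (m = 0 /\ m' = -1) \/ (m = -1 /\ m' = 0) ->
  (forall n, hi n -> `|kap n| <= wgt n) ->
  hn N (fun n => s0 n - c n) <= rho ^+ 2 ->
  hh N c <= 2 * rho ^+ 2 + nsq (c m) ->
  `|\sum_(n <- modes N) kap n * (nsq (s n) - nsq (s0 n))| <= rho ^+ 2 ->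
  nsq (s m - c m) = (Normc.normc (s m) - Normc.normc (c m)) ^+ 2 ->
  nsq (s m - c m) <= (11 * (rho + Num.sqrt (hh N (fun n => s n - c n)))) ^+ 2.
Proof.
move=> N0 r0 km km' mm hkap hR hh1 cons al.
set r := fun n => s n - c n; set q := fun n => s0 n - c n.
set g := Num.sqrt (hh N r); set h := Num.sqrt (hh N c).
have g0 : 0 <= g by exact: sqrtr_ge0.
have h0 : 0 <= h by exact: sqrtr_ge0.
have gE : g ^+ 2 = hh N r by rewrite sqr_sqrtr ?hh_ge0.
have hE : h ^+ 2 = hh N c by rewrite sqr_sqrtr ?hh_ge0.
set a := Normc.normc (c m); have a0 : 0 <= a by exact: normc_ge0.
have aE : a ^+ 2 = nsq (c m) by exact: normc_nsq.
have ha : h <= 2 * rho + a.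
  have h1 : 0 <= 2 * rho + a by lra.
  rewrite -ler_sqr ?nnegrE // hE; apply: (le_trans hh1).
  by rewrite -aE; have := mulr_ge0 (ltW r0) a0; have := sqr_ge0 rho; lra.
have qh : hh N q <= rho ^+ 2.
  apply: le_trans hR; rewrite hn_split // lerDr.
  by rewrite addr_ge0 ?mulr_ge0 ?nsq_ge0.
have qh' : Num.sqrt (hh N q) <= rho.
  by rewrite -(ger0_norm (ltW r0)) -sqrtr_sqr ler_wsqrtr.
have qm : Normc.normc (q m) <= rho.
  rewrite normc_sqrt -(ger0_norm (ltW r0)) -sqrtr_sqr ler_wsqrtr //.
  apply: le_trans hR; apply: (@le_trans _ _ (wgt m * nsq (q m))).
    by rewrite ler_peMl ?nsq_ge0 ?wgt_ge1.
  by apply: (hn_term q); case: mm => -[-> _].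
have split (F : int -> R) :
    \sum_(n <- modes N) kap n * F n = F m + \sum_(n <- modes N | hi n) kap n * F n.
  rewrite modes_split //; congr (_ + _).
  by case: mm km km' => -[-> ->] -> ->; rewrite mul1r mul0r ?addr0 ?add0r.
have e1 := hi_nsqD N c r hkap; have e2 := hi_nsqD N c q hkap.
have sE n : c n + r n = s n by rewrite /r; ring.
have s0E n : c n + q n = s0 n by rewrite /q; ring.
rewrite (eq_bigr (fun n => kap n * (nsq (s n) - nsq (c n)))) in e1; last first.
  by move=> n _; rewrite sE.
rewrite (eq_bigr (fun n => kap n * (nsq (s0 n) - nsq (c n)))) in e2; last first.
  by move=> n _; rewrite s0E.
have e3 : `|nsq (s0 m) - nsq (c m)| <= 2 * a * rho + rho ^+ 2.
  rewrite -s0E nsqD (_ : _ - _ = 2 * complex.Re (c m * (q m)^*) + nsq (q m));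
    last by ring.
  apply: le_trans (ler_normD _ _) _; rewrite normrM normr_nat.
  rewrite (ger0_norm (nsq_ge0 _)) -normc_nsq -mulrA lerD //.
    rewrite ler_wpM2l //; apply: le_trans (Re_normc_le _ _) _.
    by rewrite ler_wpM2l.
  by apply: lerXn2r; rewrite ?nnegrE ?normc_ge0 // ltW.
have key : nsq (s m) - nsq (c m) =
    \sum_(n <- modes N) kap n * (nsq (s n) - nsq (s0 n)) +
    (nsq (s0 m) - nsq (c m)) +
    \sum_(n <- modes N | hi n) kap n * (nsq (s0 n) - nsq (c n)) -
    \sum_(n <- modes N | hi n) kap n * (nsq (s n) - nsq (c n)).
  rewrite split.
  have -> : \sum_(n <- modes N | hi n) kap n * (nsq (s n) - nsq (s0 n)) =
    \sum_(n <- modes N | hi n) kap n * (nsq (s n) - nsq (c n)) -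
    \sum_(n <- modes N | hi n) kap n * (nsq (s0 n) - nsq (c n)).
    by rewrite -sumrB; apply: eq_bigr => n _; ring.
  by ring.
have : `|Normc.normc (s m) - a| <= 11 * (rho + g).
  apply: modulus_close; rewrite ?normc_ge0 ?ltr_wpDr //.
  rewrite /a !normc_nsq key -/a.
  apply: le_trans (ler_normB _ _) _.
  have := ler_normD (\sum_(n <- modes N) kap n * (nsq (s n) - nsq (s0 n)) +
    (nsq (s0 m) - nsq (c m)))
    (\sum_(n <- modes N | hi n) kap n * (nsq (s0 n) - nsq (c n))).
  have := ler_normD (\sum_(n <- modes N) kap n * (nsq (s n) - nsq (s0 n)))
    (nsq (s0 m) - nsq (c m)).
  move: e1 e2; rewrite -/h -/g -gE.
  have t1 : h * g <= (2 * rho + a) * g by rewrite ler_wpM2r.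
  have t2 : h * Num.sqrt (hh N q) <= (2 * rho + a) * rho.
    by apply: ler_pM; rewrite ?sqrtr_ge0.
  have t3 := mulr_ge0 (ltW r0) g0; have t4 := mulr_ge0 a0 g0.
  have t5 := sqr_ge0 g; have t6 := sqr_ge0 rho; have t7 := mulr_ge0 a0 (ltW r0).
  by move=> e1 e2 e4 e5; lra.
rewrite al -/a => h1; rewrite -[leLHS]ger0_norm ?sqr_ge0 // normrX.
by apply: lerXn2r; rewrite ?nnegrE ?normr_ge0 // mulr_ge0 // addr_ge0 // ltW.
Qed.

(** The energy controls the high modes of [r = s - c] by [rho ^+ 2] and by [e] times
    the low modes, and the charges control the low modes by [rho] and the high
    modes. The hypothesis on [e] makes the product of the two constants at most
    [1/2], so that the high modes can be absorbed. *)
Lemma finite_stability N c s0 s (rho : R) : e * 88 ^+ 2 <= 1 ->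
  (0 < N)%N -> 0 < rho -> rho <= 1 -> hn N c <= 1 / 100 ->
  hn N (fun n => s0 n - c n) <= rho ^+ 2 ->
  Lam N s <= Lam N s0 + rho ^+ 2 ->
  `|\sum_(n <- modes N) nsq (s n) - \sum_(n <- modes N) nsq (s0 n)|
    <= rho ^+ 2 / 2 ->
  `|\sum_(n <- modes N) n%:~R * nsq (s n) -
    \sum_(n <- modes N) n%:~R * nsq (s0 n)| <= rho ^+ 2 / 2 ->
  - rho ^+ 2 <= dLam N c (fun n => s n - c n) ->
  dLam N c (fun n => s0 n - c n) <= rho ^+ 2 ->
  dLam N c (high c) <= rho ^+ 2 ->
  nsq (s 0 - c 0) = (Normc.normc (s 0) - Normc.normc (c 0)) ^+ 2 ->
  nsq (s (-1) - c (-1)) =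
    (Normc.normc (s (-1)) - Normc.normc (c (-1))) ^+ 2 ->
  hn N (fun n => s n - c n) <= (220 * rho) ^+ 2.
Proof.
move=> e88 N0 r0 r1 hc hR hLam hA hB hd hd0 hdh al be.
set r := fun n => s n - c n; set q := fun n => s0 n - c n.
have sE : (fun n => c n + r n) = s by apply/funext => n; rewrite /r; ring.
have s0E : (fun n => c n + q n) = s0 by apply/funext => n; rewrite /q; ring.
have hh0 : hh N c <= 2 * rho ^+ 2 + nsq (c 0).
  apply: (@high_modes_le N c 0 (-1)) => // t.
  by rewrite tp_high.
have hh1 : hh N c <= 2 * rho ^+ 2 + nsq (c (-1)).
  apply: (@high_modes_le N c (-1) 0) => // t.
  by rewrite tp_high // (addrC (c 0 * _)).
have wA n : hi n -> `|n%:~R + 1 : R| <= wgt n.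
  move=> _; apply: le_trans (ler_normD _ _) _.
  by rewrite normr1 addrC lerD2l intr_norm_le_sqr.
have wB n : hi n -> `|- n%:~R : R| <= wgt n.
  move=> _; rewrite normrN; apply: le_trans (intr_norm_le_sqr _) _.
  by rewrite lerDr.
have rho2 := sqr_ge0 rho.
have al1 : nsq (r 0) <= (11 * (rho + Num.sqrt (hh N r))) ^+ 2.
  apply: (@charge_close N c s0 s (fun n => n%:~R + 1) 0 (-1)) => //.
  - by rewrite add0r.
  - by rewrite rmorphN1 addNr.
  - by left.
  - rewrite (_ : \sum_(n <- _) _ = \sum_(n <- modes N) n%:~R * nsq (s n) -
      \sum_(n <- modes N) n%:~R * nsq (s0 n) +
      (\sum_(n <- modes N) nsq (s n) - \sum_(n <- modes N) nsq (s0 n))).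
      by apply: le_trans (ler_normD _ _) _; lra.
    by rewrite -!sumrB -big_split; apply: eq_bigr => n _ /=; ring.
have be1 : nsq (r (-1)) <= (11 * (rho + Num.sqrt (hh N r))) ^+ 2.
  apply: (@charge_close N c s0 s (fun n => - n%:~R) (-1) 0) => //.
  - by rewrite rmorphN1 opprK.
  - by rewrite oppr0.
  - by right.
  - rewrite (_ : \sum_(n <- _) _ = - (\sum_(n <- modes N) n%:~R * nsq (s n) -
      \sum_(n <- modes N) n%:~R * nsq (s0 n))); first by rewrite normrN; lra.
    by rewrite -sumrB -sumrN; apply: eq_bigr => n _ /=; ring.
have G0 := hh_ge0 N r; have := sqr_sqrtr G0; have := sqrtr_ge0 (hh N r).
move: al1 be1; set g := Num.sqrt _ => al1 be1 g0 gE.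
(* each of the two low modes costs [8 * e * 242], a quarter of [e * 88 ^+ 2] *)
have sig : (11 * (rho + g)) ^+ 2 <= 242 * (rho ^+ 2 + hh N r).
  by rewrite -gE; have := sqr_ge0 (rho - g); lra.
have e0 : 0 <= e by apply: le_trans hp; exact: normr_ge0.
have l0 := lam_0 e100 hp hk; have l1 := lam_m1 e100 hp hk.
have E1 : \sum_(n <- modes N) lam n * nsq (r n) <= Lam N s - Lam N c + 2 * rho ^+ 2.
  have := Lam_expand p k N c r; rewrite sE.
  have := rmean_ge0 (qrem_ge0 N c r); move: hd.
  by move: (rmean _) (dLam _ _ _) (\sum_(n <- _) _) => *; lra.
have E2 : Lam N s0 - Lam N c <= 28 * rho ^+ 2.
  have := Lam_expand p k N c q; rewrite s0E.
  have := rmean_qrem_le N c q.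
  have h1 : (50 * hn N c + 10 * hn N q) * l2n N q <= 11 * rho ^+ 2.
    have : l2n N q <= rho ^+ 2 by apply: le_trans (l2n_le_hn _ _) _.
    have : 0 <= l2n N q by apply: sumr_ge0 => n _; exact: nsq_ge0.
    have : 50 * hn N c + 10 * hn N q <= 11.
      have : rho ^+ 2 <= 1 by rewrite expr_le1 // ltW.
      move: hR hc; rewrite -/q; lra.
    have := hn_ge0 N c; have := hn_ge0 N q.
    move: (hn N c) (hn N q) (l2n N q) => x y z x0 y0 h z0 z1.
    apply: (@le_trans _ _ (11 * z)); first by rewrite ler_wpM2r.
    by rewrite ler_wpM2l.
  have h2 : \sum_(n <- modes N) lam n * nsq (q n) <= 20 * rho ^+ 2.
    apply: (@le_trans _ _ (20 * hn N q)); last by rewrite ler_wpM2l.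
    rewrite mulr_sumr; apply: ler_sum => n _.
    rewrite mulrA ler_wpM2r ?nsq_ge0 //.
    by apply: le_trans (ler_norm _) _; exact: (lam_le e100).
  move: h1 h2 hd0; rewrite -/q.
  move: (rmean _) (dLam _ _ _) (\sum_(n <- _) _) => x y z.
  move: (_ * l2n N q) => w; lra.
have E3 : hh N r <= \sum_(n <- modes N | hi n) lam n * nsq (r n).
  apply: ler_sum => n nh; rewrite ler_wpM2r ?nsq_ge0 //.
  exact: (lam_hi e100).
move: E1; rewrite modes_split // => E1.
have E4 : - (8 * e * nsq (r 0)) <= lam 0 * nsq (r 0).
  rewrite -mulNr ler_wpM2r ?nsq_ge0 //; move: l0.
  by rewrite ler_norml => /andP[].
have E5 : - (8 * e * nsq (r (-1))) <= lam (-1) * nsq (r (-1)).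
  rewrite -mulNr ler_wpM2r ?nsq_ge0 //; move: l1.
  by rewrite ler_norml => /andP[].
have F1 : nsq (r 0) <= 242 * (rho ^+ 2 + hh N r) by exact: le_trans sig.
have F2 : nsq (r (-1)) <= 242 * (rho ^+ 2 + hh N r) by exact: le_trans sig.
have F x : x <= 242 * (rho ^+ 2 + hh N r) -> 8 * e * x <= (rho ^+ 2 + hh N r) / 4.
  move=> xS; have h : 0 <= (1 - e * 88 ^+ 2) * (rho ^+ 2 + hh N r).
    by rewrite mulr_ge0 ?subr_ge0 // addr_ge0.
  have {}xS : 8 * e * x <= 8 * e * (242 * (rho ^+ 2 + hh N r)).
    by rewrite ler_wpM2l // mulr_ge0.
  clear -h xS; lra.
have F3 := F _ F1; have F4 := F _ F2.
have hG : hh N r <= 63 * rho ^+ 2.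
  move: E1 E2 E3 E4 E5 F3 F4 hLam; clear.
  move: (Lam N s) (Lam N s0) (Lam N c) (\sum_(n <- _ | _) _) => *; lra.
rewrite hn_split // exprMn.
apply: (@le_trans _ _ (726 * (rho ^+ 2 + hh N r) + hh N r)); first lra.
suff : 726 * 64 + 63 <= 220 ^+ 2 :> R.
  move=> h; have : 0 <= (220 ^+ 2 - (726 * 64 + 63)) * rho ^+ 2.
    by rewrite mulr_ge0 ?subr_ge0.
  move: (220 ^+ 2) h => y h; lra.
by rewrite -!natrM -natrD -natrX ler_nat.
Qed.

End Stability.

(** * Fourier coefficients of the cubic term *)

Section CubicTerm.
Context {R : realType}.
Implicit Types (c d : int -> R[i]) (n : int) (L M N : nat) (x y z : R[i]).

Definition Fc N c n : R[i] := fcoef (fun t => cub (tp N c t)) n.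

Lemma ccont_cub (u : R -> R[i]) : ccont u -> ccont (fun t => cub (u t)).
Proof. by move=> cu; rewrite /cub; auto with cont. Qed.

Lemma rmean_cubJ N c d :
  rmean (fun t => nsq (tp N c t) * complex.Re (tp N c t * (tp N d t)^*)) =
  \sum_(n <- modes N) complex.Re (Fc N c n * (d n)^*).
Proof.
rewrite -rmean_tpJ; last exact/cint_cont/ccont_cub/ccont_tp.
by congr rmean; apply/funext => t; rewrite /cub !ReImE /=; ring.
Qed.

Lemma dLamE (p k : R) N c d : dLam p k N c d =
  \sum_(n <- modes N)
    complex.Re (((lam p k n)%:C * c n + Fc N c n) * (d n)^*).
Proof.
rewrite /dLam rmean_cubJ -big_split; apply: eq_bigr => n _ /=.
by rewrite !ReImE /=; ring.
Qed.

(** The nonlinearity is the product of [P] with a real function, hence orthogonal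
    to [i P]: it does not change the charge. *)
Lemma sum_Fc_charge N c :
  \sum_(n <- modes N) complex.Re (Fc N c n * ((0 +i* 1) * c n)^*) = 0.
Proof.
rewrite -rmean_cubJ -[RHS]rmean0; congr rmean; apply/funext => t.
have -> : tp N (fun n => (0 +i* 1) * c n) t = (0 +i* 1) * tp N c t.
  by rewrite /tp mulr_sumr; apply: eq_bigr => n _; rewrite mulrA.
by rewrite !ReImE /=; ring.
Qed.

Lemma is_derive_nsq (u : R -> R[i]) (du : R[i]) (x : R) :
  is_derive x 1 (fun s => complex.Re (u s)) (complex.Re du) ->
  is_derive x 1 (fun s => complex.Im (u s)) (complex.Im du) ->
  is_derive x 1 (fun s => nsq (u s)) (2 * complex.Re (u x * du^*)).
Proof.
move=> h1 h2; apply: (is_derive_fun _ _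
   (is_deriveDfun (is_deriveMfun h1 h1) (is_deriveMfun h2 h2))).
  by move=> y; rewrite /nsq !expr2.
by rewrite !ReImE; ring.
Qed.

(** The integrand is a quarter of the derivative of [nsq P ^+ 2]: by invariance
    under translation, the nonlinearity does not change the momentum. *)
Lemma sum_Fc_momentum N c :
  \sum_(n <- modes N) complex.Re (Fc N c n * (dcoef c n)^*) = 0.
Proof.
rewrite -rmean_cubJ; set g := (fun t => _).
have cP := ccont_tp N c; have cP' := ccont_tp N (dcoef c).
have cg : rcont g by rewrite /g; auto with cont.
have := @rmean_derive _ (fun t => nsq (tp N c t) ^+ 2 / 4) g cg.
apply=> [x|]; last by rewrite -[in LHS](add0r (2 * pi)) tp_periodic.
have [h1 h2] := cis_derive_tp N c x; have h := is_derive_nsq h1 h2.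
apply: (is_derive_fun _ _
  (is_deriveMfun (is_deriveMfun h h) (is_derive_cst (4^-1 : R) x (1 : R)))).
  by move=> y; rewrite expr2.
rewrite /g /cst; move: (nsq _) (complex.Re _) => a b; by field.
Qed.

Definition dcub x y : R[i] := 2 * (x * x^*) * y + x ^+ 2 * y^*.

Lemma cubE x : cub x = x * x * x^*.
Proof. by rewrite /cub -mulcJ; ring. Qed.

Lemma cis_derive_cub (u du : R -> R[i]) : cis_derive u du ->
  cis_derive (fun t => cub (u t)) (fun t => dcub (u t) (du t)).
Proof.
move=> h; have := cis_deriveM (cis_deriveM h h) (cis_deriveJ h).
by congr cis_derive; apply/funext => t; rewrite ?cubE /dcub; ring.
Qed.

Lemma nsq2 : nsq (2 : R[i]) = 4.
Proof. by rewrite (_ : 2 = (2 : R)%:C) ?nsqC ?rmorph_nat //; ring. Qed.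

Lemma nsq_dcub_le x y : nsq (dcub x y) <= 10 * nsq x ^+ 2 * nsq y.
Proof.
apply: le_trans (nsqD_le _ _) _; rewrite !nsqM !nsqJ nsq2.
by rewrite le_eqVlt; apply/orP; left; apply/eqP; ring.
Qed.

Lemma nsq_dcubB_le x z y : nsq (dcub x y - dcub z y) <=
  20 * nsq (x - z) * (nsq x + nsq z) * nsq y.
Proof.
have -> : dcub x y - dcub z y =
  2 * (x * x^* - z * z^*) * y + (x - z) * (x + z) * y^* by rewrite /dcub; ring.
apply: le_trans (nsqD_le _ _) _; rewrite !nsqM nsqJ nsq2.
have -> : x * x^* - z * z^* = (complex.Re ((x - z) * (x + z)^*))%:C.
  by apply: complexP; rewrite ?ReImE /=; ring.
rewrite nsqC; have h1 := ReMJ_CS (x - z) (x + z); have h2 := nsqD_le x z.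
have D0 := nsq_ge0 (x - z); have y0 := nsq_ge0 y.
move: h1 h2 D0 y0; move: (complex.Re _ ^+ 2) (nsq (x - z)) (nsq (x + z)) (nsq y).
move=> r D s w h1 h2 D0 w0.
have h3 : 0 <= w * (D * s - r) by rewrite mulr_ge0 // subr_ge0.
have h4 : 0 <= (w * D) * (2 * nsq x + 2 * nsq z - s).
  by rewrite !mulr_ge0 // subr_ge0.
lra.
Qed.

(** Bessel's inequality for a function and for its derivative. *)
Lemma hn_fcoef_le L (u du : R -> R[i]) : cis_derive u du -> ccont u ->
  ccont du -> u (2 * pi) = u 0 ->
  hn L (fcoef u) <= rmean (fun t => nsq (u t)) + rmean (fun t => nsq (du t)).
Proof.
move=> h cu cdu uper; rewrite hnE; apply: lerD.
  by apply: bessel; [exact: cint_cont|apply: rint_cont; auto with cont].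
rewrite (_ : dcoef _ = fcoef du).
  by apply: bessel; [exact: cint_cont|apply: rint_cont; auto with cont].
by apply/funext => n; rewrite (fcoef_derive _ h).
Qed.

Lemma ccont_dcub (u v : R -> R[i]) : ccont u -> ccont v ->
  ccont (fun t => dcub (u t) (v t)).
Proof. by move=> cu cv; rewrite /dcub; auto 20 with cont. Qed.

(** H^1 is an algebra. The bound is uniform in the number [L] of coefficients
    that are kept. *)
Lemma hn_Fc_lip L M c d :
  hn L (fun n => Fc M c n - Fc M d n) <=
  40 ^+ 2 * (hn M c + hn M d) ^+ 2 * hn M (fun n => c n - d n).
Proof.
pose P := tp M c; pose S := tp M d; pose P' := tp M (dcoef c).
pose S' := tp M (dcoef d).
have cP : ccont P := @ccont_tp _ M c. have cS : ccont S := @ccont_tp _ M d.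
have cP' : ccont P' := @ccont_tp _ M (dcoef c).
have cS' : ccont S' := @ccont_tp _ M (dcoef d).
pose u t := cub (P t) - cub (S t).
pose du t := dcub (P t) (P' t) - dcub (S t) (S' t).
have hu : cis_derive u du.
  have := cis_deriveD (cis_derive_cub (cis_derive_tp M c))
    (cis_deriveZ (-1) (cis_derive_cub (cis_derive_tp M d))).
  by congr cis_derive; apply/funext => t; rewrite mulN1r.
have cu : ccont u by apply: ccontB; exact: ccont_cub.
have cdu : ccont du by apply: ccontB; exact: ccont_dcub.
have uE : fcoef u = fun n => Fc M c n - Fc M d n.
  apply/funext => n; apply: fcoefB; exact/cint_cont/ccont_cub/ccont_tp.
have uper : u (2 * pi) = u 0.
  by rewrite /u /P /S -[2 * pi]add0r !tp_periodic.
rewrite -uE; apply: le_trans (hn_fcoef_le L hu cu cdu uper) _.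
set hc := hn M c; set hd := hn M d; set hcd := hn M (fun n => c n - d n).
have hc0 : 0 <= hc := hn_ge0 M c. have hd0 : 0 <= hd := hn_ge0 M d.
have hcd0 : 0 <= hcd := hn_ge0 M _.
have PS t : P t - S t = tp M (fun n => c n - d n) t by rewrite tpB.
have PS' t : P' t - S' t = tp M (dcoef (fun n => c n - d n)) t.
  by rewrite /P' /S' -tpB; apply: eq_bigr => n _; rewrite /dcoef mulrBr.
have hP t : nsq (P t) <= 5 * hc := nsq_tp_le M c t.
have hS t : nsq (S t) <= 5 * hd := nsq_tp_le M d t.
have hPS t : nsq (P t - S t) <= 5 * hcd by rewrite PS; exact: nsq_tp_le.
have l1 : rmean (fun t => nsq (P t - S t)) <= hcd.
  by under eq_fun do rewrite PS; rewrite rmean_nsq_tp l2n_le_hn.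
have l2 : rmean (fun t => nsq (P' t - S' t)) <= hcd.
  under eq_fun do rewrite PS'; rewrite rmean_nsq_tp /hcd hnE.
  by rewrite lerDr; apply: sumr_ge0 => n _; exact: nsq_ge0.
have l3 : rmean (fun t => nsq (S' t)) <= hd.
  rewrite rmean_nsq_tp /hd hnE.
  by rewrite lerDr; apply: sumr_ge0 => n _; exact: nsq_ge0.
have i1 : rint (fun t => nsq (P t - S t)) by apply: rint_cont; auto with cont.
have i2 : rint (fun t => nsq (P' t - S' t)) by apply: rint_cont; auto with cont.
have i3 : rint (fun t => nsq (S' t)) by apply: rint_cont; auto with cont.
have A1 : rmean (fun t => nsq (u t)) <= 3 * (5 * (hc + hd)) ^+ 2 * hcd.
  apply: (@le_trans _ _ (3 * (5 * (hc + hd)) ^+ 2 *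
      rmean (fun t => nsq (P t - S t)))); last first.
    by rewrite ler_wpM2l // mulr_ge0 // sqr_ge0.
  rewrite -rmeanZ //; apply: rmean_le => [||t]; [|exact: rintZ|].
    by apply: rint_cont; auto with cont.
  apply: le_trans (nsq_cubB_le _ _) _; rewrite ler_wpM2r ?nsq_ge0 //.
  rewrite ler_wpM2l //; apply: lerXn2r; rewrite ?nnegrE.
  - by rewrite addr_ge0 ?nsq_ge0.
  - by rewrite mulr_ge0 // addr_ge0.
  - by rewrite mulrDr lerD.
have A2 : rmean (fun t => nsq (du t)) <=
    20 * (5 * hc) ^+ 2 * hcd + 40 * (5 * hcd) * (5 * (hc + hd)) * hd.
  apply: (@le_trans _ _ (20 * (5 * hc) ^+ 2 * rmean (fun t => nsq (P' t - S' t))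
     + 40 * (5 * hcd) * (5 * (hc + hd)) * rmean (fun t => nsq (S' t)))).
    rewrite -rmeanZ // -rmeanZ // -(rmeanD (rintZ _ i2) (rintZ _ i3)).
    apply: rmean_le => [||t]; [|by apply: rintD; exact: rintZ|].
      by apply: rint_cont; auto with cont.
    have -> : du t = dcub (P t) (P' t - S' t) +
      (dcub (P t) (S' t) - dcub (S t) (S' t)) by rewrite /du /dcub rmorphB; ring.
    apply: le_trans (nsqD_le _ _) _; apply: lerD.
      have h1 := nsq_dcub_le (P t) (P' t - S' t).
      have h2 : nsq (P t) ^+ 2 * nsq (P' t - S' t) <=
          (5 * hc) ^+ 2 * nsq (P' t - S' t).
        rewrite ler_wpM2r ?nsq_ge0 //.
        by apply: lerXn2r; rewrite ?nnegrE ?nsq_ge0 // mulr_ge0.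
      lra.
    have h1 := nsq_dcubB_le (P t) (S t) (S' t).
    have h2 : nsq (P t - S t) * (nsq (P t) + nsq (S t)) * nsq (S' t) <=
        5 * hcd * (5 * (hc + hd)) * nsq (S' t).
      rewrite ler_wpM2r ?nsq_ge0 //.
      have h3 : nsq (P t) + nsq (S t) <= 5 * (hc + hd).
        by have := hP t; have := hS t; lra.
      apply: ler_pM => //; first exact: nsq_ge0.
      by apply: addr_ge0; exact: nsq_ge0.
    lra.
  by apply: lerD; apply: ler_wpM2l; rewrite ?mulr_ge0 ?sqr_ge0 ?addr_ge0.
apply: le_trans (lerD A1 A2) _; rewrite -subr_ge0.
have t1 := mulr_ge0 (mulr_ge0 hc0 hc0) hcd0.
have t2 := mulr_ge0 (mulr_ge0 hc0 hd0) hcd0.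
have t3 := mulr_ge0 (mulr_ge0 hd0 hd0) hcd0.
have -> : 40 ^+ 2 * (hc + hd) ^+ 2 * hcd - (3 * (5 * (hc + hd)) ^+ 2 * hcd +
    (20 * (5 * hc) ^+ 2 * hcd + 40 * (5 * hcd) * (5 * (hc + hd)) * hd)) =
  (40 ^+ 2 - 3 * 5 ^+ 2 - 20 * 5 ^+ 2) * (hc * hc * hcd) +
  (2 * (40 ^+ 2 - 3 * 5 ^+ 2) - 40 * 5 ^+ 2) * (hc * hd * hcd) +
  (40 ^+ 2 - 3 * 5 ^+ 2 - 40 * 5 ^+ 2) * (hd * hd * hcd) by ring.
by rewrite !addr_ge0 // mulr_ge0 // subr_ge0; lra.
Qed.

End CubicTerm.

(** * Limits and truncation *)

Section Calculus.
Context {R : realType}.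

Lemma is_derive_sum_seq I (s : seq I) (F : I -> R -> R) (dF : I -> R) (x : R) :
  (forall i, is_derive x 1 (F i) (dF i)) ->
  is_derive x 1 (fun t => \sum_(i <- s) F i t) (\sum_(i <- s) dF i).
Proof.
move=> h; elim: s => [|i s IH].
  apply: (is_derive_fun _ _ (is_derive_cst (0 : R) x (1 : R))).
    by move=> y; rewrite big_nil.
  by rewrite big_nil.
apply: (is_derive_fun _ _ (is_deriveDfun (h i) IH)).
  by move=> y; rewrite big_cons.
by rewrite big_cons.
Qed.

Lemma is_deriveZfun (c : R) (f : R -> R) (x d : R) :
  is_derive x 1 f d -> is_derive x 1 (fun y => c * f y) (c * d).
Proof.
move=> h; apply: (is_derive_fun _ _
  (is_deriveMfun (is_derive_cst c x (1 : R)) h)) => //.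
by rewrite mul0r add0r.
Qed.

Lemma is_deriveP (f : R -> R) (x d : R) :
  is_derive x 1 f d <-> h^-1 * (f (h + x) - f x) @[h --> 0^'] --> d.
Proof.
have E : (fun h : R => h^-1 *: ((f \o shift x) (h *: 1) - f x)) =
    (fun h => h^-1 * (f (h + x) - f x)).
  by apply/funext => h; rewrite /= [h *: 1]mulr1.
split=> [[df <-]|h].
  by rewrite -E /derive; exact: df.
split; first by rewrite /derivable E; apply/cvg_ex; exists d.
by rewrite /derive E; apply/cvg_lim.
Qed.

(** This spares the differentiation of the quartic mean under the integral sign:
    its remainder is nonnegative and of second order. *)
Lemma is_derive_squeeze (f g : R -> R) (x : R) : (forall y, 0 <= f y <= g y) ->
  g x = 0 -> is_derive x 1 g 0 -> is_derive x 1 f 0.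
Proof.
move=> fg gx /is_deriveP; rewrite gx => hg; apply/is_deriveP.
have fx : f x = 0.
  by have := fg x; rewrite gx -eq_le => /eqP.
rewrite fx; move/cvgrPdist_le: hg => hg; apply/cvgrPdist_le => eps e0.
near=> h; have : `|0 - h^-1 * (g (h + x) - 0)| <= eps.
  by near: h; exact: hg.
apply: le_trans; rewrite !subr0 !sub0r !normrN !normrM ler_wpM2l //.
have /andP[f0 fgh] := fg (h + x).
by rewrite !ger0_norm // (le_trans f0).
Unshelve. all: by end_near.
Qed.

(** By compactness of the segment between 0 and [t] the convergence of the
    derivatives is uniform on it, and the mean value inequality applies. *)
Lemma cvg_variation0 (J dJ : nat -> R -> R) :
  (forall N (s : R), is_derive s 1 (J N) (dJ N s)) ->
  (forall s0 eps : R, 0 < eps ->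
    \forall s \near s0 & N \near \oo, `|dJ N s| <= eps) ->
  forall t eps, 0 < eps -> \forall N \near \oo, `|J N t - J N 0| <= eps.
Proof.
move=> dJE small t eps e0; pose T := `|t| + 1.
have T0 : 0 < T by rewrite ltr_wpDl.
have cK : compact `[- T, T] by exact: segment_compact.
have e1 : 0 < eps / T by rewrite divr_gt0.
have : \forall N \near \oo, `[- T, T] `<=` [set s | `|dJ N s| <= eps / T].
  move/compact_near_coveringP: cK; apply => s0 _; exact: small.
apply: filterS => N KN.
have bnd a b : a <= b -> - T <= a -> b <= T -> `|J N b - J N a| <= eps / T * (b - a).
  move=> ab Ta bT.
  have cJ : {within `[a, b], continuous (J N)}.
    apply: continuous_subspaceT => x.
    by apply/differentiable_continuous/derivable1_diffP; have [] := dJE N x.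
  have [c cab ->] := MVT_segment ab (fun x _ => dJE N x) cJ.
  rewrite normrM (@ger0_norm _ (b - a)) ?subr_ge0 // ler_wpM2r ?subr_ge0 //.
  apply: KN; rewrite /= in_itv /=; move: cab; rewrite in_itv /= => /andP[ac cb].
  by rewrite (le_trans Ta) // (le_trans cb).
have tT : `|t| <= T by rewrite lerDl.
have fin y : `|y| <= T -> eps / T * `|y| <= eps.
  by move=> yT; rewrite mulrAC ler_pdivrMr // ler_wpM2l // ltW.
have [t0|t0] := leP 0 t.
  apply: (le_trans (bnd 0 t t0 _ _)).
  - by rewrite oppr_le0 ltW.
  - by apply: le_trans tT; exact: ler_norm.
  - by rewrite subr0 -[X in _ * X](ger0_norm t0) fin.
rewrite distrC; apply: (le_trans (bnd t 0 (ltW t0) _ _)).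
- by rewrite lerNl; apply: le_trans tT; rewrite -normrN ler_norm.
- exact: ltW.
- by rewrite sub0r -(ltr0_norm t0) fin.
Qed.

Definition ccvg (u : nat -> R[i]) (l : R[i]) : Prop :=
  complex.Re (u M) @[M --> \oo] --> complex.Re l /\
  complex.Im (u M) @[M --> \oo] --> complex.Im l.

Lemma cvg_sum_seq I (s : seq I) (u : I -> nat -> R) (l : I -> R) :
  (forall i, u i M @[M --> \oo] --> l i) ->
  \sum_(i <- s) u i M @[M --> \oo] --> \sum_(i <- s) l i.
Proof.
move=> h; elim: s => [|i s IH].
  by under eq_cvg do rewrite big_nil; rewrite big_nil; exact: cvg_cst.
by under eq_cvg do rewrite big_cons; rewrite big_cons; apply: cvgD.
Qed.

Lemma ccvg_nsqB (u : nat -> R[i]) (l d : R[i]) : ccvg u l ->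
  nsq (u M - d) @[M --> \oo] --> nsq (l - d).
Proof.
move=> [h1 h2]; rewrite /nsq.
under eq_cvg do rewrite cReD cImD cReN cImN; rewrite cReD cImD cReN cImN.
have g1 : complex.Re (u M) - complex.Re d @[M --> \oo] -->
    complex.Re l - complex.Re d by apply: cvgB => //; exact: cvg_cst.
have g2 : complex.Im (u M) - complex.Im d @[M --> \oo] -->
    complex.Im l - complex.Im d by apply: cvgB => //; exact: cvg_cst.
by apply: cvgD; rewrite expr2; under eq_cvg do rewrite expr2; apply: cvgM.
Qed.

Lemma hn_lim_le N (u : nat -> int -> R[i]) (l d : int -> R[i]) (B : R) :
  (forall n, ccvg (u^~ n) (l n)) ->
  (\forall M \near \oo, hn N (fun n => u M n - d n) <= B) ->
  hn N (fun n => l n - d n) <= B.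
Proof.
move=> ul uB; have : hn N (fun n => u M n - d n) @[M --> \oo] -->
    hn N (fun n => l n - d n).
  apply: cvg_sum_seq => n; apply: cvgM; first exact: cvg_cst.
  exact: ccvg_nsqB.
by move/cvgr_to_le; apply.
Qed.

End Calculus.

Section Truncation.
Context {R : realType}.
Implicit Types (c d z : int -> R[i]) (M N : nat).

(** Truncation allows the comparison of Fourier polynomials of different degrees
    as polynomials of the larger one. *)
Definition trunc N c n : R[i] := if (`|n| <= N)%N then c n else 0.

Lemma sum_trunc N M (F : int -> R) : (N <= M)%N ->
  \sum_(n <- modes M) (if (`|n| <= N)%N then F n else 0) = \sum_(n <- modes N) F n.
Proof.
move=> NM; rewrite -big_mkcond /= -big_filter; apply: perm_big.
apply: uniq_perm; rewrite ?filter_uniq ?uniq_modes // => n.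
by rewrite mem_filter !mem_modes; apply: andb_idr => h; exact: leq_trans NM.
Qed.

Lemma csum_trunc N M (F : int -> R[i]) : (N <= M)%N ->
  \sum_(n <- modes M) (if (`|n| <= N)%N then F n else 0) = \sum_(n <- modes N) F n.
Proof.
move=> NM; rewrite -big_mkcond /= -big_filter; apply: perm_big.
apply: uniq_perm; rewrite ?filter_uniq ?uniq_modes // => n.
by rewrite mem_filter !mem_modes; apply: andb_idr => h; exact: leq_trans NM.
Qed.

Lemma tp_trunc N M c : (N <= M)%N -> tp M (trunc N c) = tp N c.
Proof.
move=> NM; apply/funext => t; rewrite /tp -(csum_trunc _ NM).
by apply: eq_bigr => n _; rewrite /trunc; case: ifP => //; rewrite mul0r.
Qed.

Lemma Fc_trunc N M c : (N <= M)%N -> Fc M (trunc N c) = Fc N c.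
Proof. by move=> NM; rewrite /Fc tp_trunc. Qed.

Lemma hn_trunc_le N M c : hn M (trunc N c) <= hn M c.
Proof.
apply: ler_sum => n _; rewrite ler_wpM2l ?wgt_ge0 // /trunc.
by case: ifP => // _; rewrite nsq0 nsq_ge0.
Qed.

Lemma hn_tail N M c : (N <= M)%N ->
  hn M (fun n => c n - trunc N c n) = hn M c - hn N c.
Proof.
move=> NM; rewrite /hn -(sum_trunc (fun n => wgt n * nsq (c n)) NM) -sumrB.
apply: eq_bigr => n _; rewrite /trunc; case: ifP => _.
  by rewrite !subrr nsq0 mulr0.
by rewrite !subr0.
Qed.

Lemma hn_tail_le N M c : hn M (fun n => c n - trunc N c n) <= hn M c.
Proof.
apply: ler_sum => n _; rewrite ler_wpM2l ?wgt_ge0 // /trunc.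
by case: ifP => _; rewrite ?subr0 // subrr nsq0 nsq_ge0.
Qed.

(** Bounded increasing sequences are Cauchy. *)
Lemma hn_tail_small c (B eps : R) : (forall N, hn N c <= B) -> 0 < eps ->
  \forall N \near \oo, forall M, (N <= M)%N ->
    hn M (fun n => c n - trunc N c n) <= eps.
Proof.
move=> cB e0.
have nd : nondecreasing_seq (fun N => hn N c).
  by apply/nondecreasing_seqP => N; exact: hn_mono.
have cv : cvgn (fun N => hn N c).
  by apply: nondecreasing_is_cvgn => //; exists B => _ [N _ <-].
have /cvgrPdist_le/(_ _ e0) := cv.
apply: filterS => N hN M NM; rewrite hn_tail //.
have := nondecreasing_cvgn_le nd cv M; move: hN; rewrite ler_norml.
by move=> /andP[_ h1] h2; lra.
Qed.

Lemma pair_le N (kap : int -> R) (K : R) c d : 0 <= K ->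
  (forall n, `|kap n| <= K * wgt n) ->
  `|\sum_(n <- modes N) kap n * complex.Re (c n * (d n)^*)| <=
  K * (Num.sqrt (hn N c) * Num.sqrt (hn N d)).
Proof.
move=> K0 hkap; apply: le_trans (ler_norm_sum _ _ _) _.
have [w [w0 wE]] : exists w : int -> R,
    (forall n, 0 <= w n) /\ (forall n, w n ^+ 2 = wgt n).
  exists (fun n => Num.sqrt (wgt n)); split=> n; first exact: sqrtr_ge0.
  by rewrite sqr_sqrtr ?wgt_ge0.
apply: (@le_trans _ _ (K * \sum_(n <- modes N)
    (w n * Normc.normc (c n)) * (w n * Normc.normc (d n)))).
  rewrite mulr_sumr; apply: ler_sum => n _; rewrite normrM.
  rewrite (_ : K * _ = (K * wgt n) * (Normc.normc (c n) * Normc.normc (d n))).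
    by apply: ler_pM; rewrite ?normr_ge0 ?Re_normc_le.
  by rewrite -wE; ring.
rewrite ler_wpM2l // -sqrtrM ?hn_ge0 //.
apply: le_trans (ler_norm _) _; rewrite -sqrtr_sqr ler_wsqrtr //.
apply: le_trans (sum_CS _ _ _) _; rewrite le_eqVlt; apply/orP; left.
by apply/eqP; congr (_ * _); apply: eq_bigr => n _; rewrite exprMn wE normc_nsq.
Qed.

End Truncation.

(** * Affine changes of variable and local integrability *)

Section AffineChange.
Context {R : realType}.
Local Notation mu := (@lebesgue_measure R).
Implicit Types (a b : R) (D : set R) (f : R -> R).

Definition aff a b (x : R) : R := a * x + b.

Lemma measurable_aff a b :
  measurable_fun [set: measurableTypeR R] (aff a b : _ -> measurableTypeR R).
Proof.
have c : rcont (aff a b) by rewrite /aff; auto with cont.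
exact: (continuous_measurable_fun c).
Qed.

Lemma aff_preimage_itv a b (u v : R) (bu bv : bool) : 0 < a ->
  aff a b @^-1` [set` Interval (BSide bu (aff a b u)) (BSide bv (aff a b v))] =
  [set` Interval (BSide bu u) (BSide bv v)].
Proof.
move=> a0; apply/seteqP; split => x /=;
  by rewrite !itv_boundlr; case: bu; case: bv;
    rewrite !bnd_simp /aff ?lerD2r ?ltrD2r ?ler_pM2l ?ltr_pM2l.
Qed.

Lemma lebesgue_measure_aff a b D : 0 < a -> measurable D ->
  mu (aff a b @^-1` D) = (a^-1%:E * mu D)%E.
Proof.
move=> a0 mD.
pose nu : {measure set (measurableTypeR R) -> \bar R} :=
  mscale (NngNum (ltW a0))
    (pushforward mu (aff a b : measurableTypeR R -> measurableTypeR R)).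
have h : mu D = (a%:E * mu (aff a b @^-1` D))%E.
  refine (@lebesgue_measure_unique R (nu (measurable_aff a b)) _ D mD).
  move=> _ [[u v] /= uv <-].
  pose w (y : R) := (y - b) / a.
  have wE y : aff a b (w y) = y.
    by rewrite /aff /w mulrC divfK ?gt_eqF // subrK.
  have P : aff a b @^-1` `]u, v] = `]w u, w v]%classic.
    by rewrite -{1}[u]wE -{1}[v]wE aff_preimage_itv.
  transitivity (a%:E * mu (aff a b @^-1` `]u, v]))%E; last by [].
  rewrite P.
  rewrite !lebesgue_measure_itv /= !lte_fin /w.
  rewrite ltr_pM2r ?invr_gt0 // ltrD2r; case: ifP => _; last by rewrite mule0.
  by rewrite -!EFinD -EFinM; congr EFin; field; rewrite gt_eqF.
rewrite h muleA -EFinM mulVf ?mul1e //.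
by rewrite gt_eqF.
Qed.

Lemma ge0_integral_aff a b D (f : R -> \bar R) : 0 < a -> measurable D ->
  measurable_fun D f -> (forall x, (0 <= f x)%E) ->
  (\int[mu]_(x in aff a b @^-1` D) f (aff a b x) =
  a^-1%:E * \int[mu]_(x in D) f x)%E.
Proof.
move=> a0 mD mf f0.
have ai0 : 0 <= a^-1 by rewrite invr_ge0 ltW.
have := @ge0_integral_pushforward _ _ (measurableTypeR R) (measurableTypeR R) R
  _ (measurable_aff a b) mu D f mD mf (fun y _ => f0 y).
rewrite /comp => <-.
have := @ge0_integral_mscale _ (measurableTypeR R) R mu D mD
  (NngNum ai0) f mf (fun y _ => f0 y).
rewrite /= => <-.
apply: eq_measure_integral => [|mphi A mA _]; first exact: measurable_aff.
exact: (lebesgue_measure_aff b a0 mA).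
Qed.

Lemma integrable_aff a b D f : 0 < a -> measurable D -> measurable_fun setT f ->
  mu.-integrable D (EFin \o f) ->
  mu.-integrable (aff a b @^-1` D) (EFin \o (f \o aff a b)).
Proof.
move=> a0 mD mf fi; have /integrableP[_ foo] := fi.
apply/integrableP; split.
  apply/measurable_EFinP; apply: measurable_funTS.
  by apply: (measurableT_comp mf); exact: measurable_aff.
have mabs := measurable_int mu (integrable_abse fi).
have := @ge0_integral_aff a b D (abse \o (EFin \o f)) a0 mD mabs
  (fun _ => abse_ge0 _).
rewrite [LHS](_ : _ = \int[mu]_(x in aff a b @^-1` D)
  `|(EFin \o (f \o aff a b)) x|)%E // => ->.
by rewrite lte_mul_pinfty ?lee_fin ?invr_ge0 ?ltW.
Qed.

Lemma Rintegral_aff a b D f : 0 < a -> measurable D -> measurable_fun setT f ->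
  mu.-integrable D (EFin \o f) ->
  \int[mu]_(x in aff a b @^-1` D) f (aff a b x) =
  a^-1 * \int[mu]_(x in D) f x.
Proof.
move=> a0 mD mf fi.
have fp : (\int[mu]_(x in D) (EFin \o f)^\+ x)%E \is a fin_num.
  exact: integrable_pos_fin_num.
have fn : (\int[mu]_(x in D) (EFin \o f)^\- x)%E \is a fin_num.
  exact: integrable_neg_fin_num.
rewrite /Rintegral integralE.
rewrite [X in (X - _)%E](_ : _ =
    (a^-1%:E * \int[mu]_(x in D) (EFin \o f)^\+ x)%E); last first.
  rewrite -(@ge0_integral_aff a b) //; last first.
    by apply: (measurable_int mu); apply: integrable_funepos.
  by apply: eq_integral => x _; rewrite !funeposE.
rewrite [X in (_ - X)%E](_ : _ =
    (a^-1%:E * \int[mu]_(x in D) (EFin \o f)^\- x)%E); last first.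
  rewrite -(@ge0_integral_aff a b) //; last first.
    by apply: (measurable_int mu); apply: integrable_funeneg.
  by apply: eq_integral => x _; rewrite !funenegE.
rewrite [in RHS]integralE -(fineK fp) -(fineK fn) -!EFinM -!EFinB /=.
by rewrite mulrBr.
Qed.

(** Local integrability together with measurability on the whole line, which a
    set-based definition of integrability does not provide. *)
Definition lint f := measurable_fun [set: R] f /\
  forall a b, mu.-integrable `[a, b] (EFin \o f).

Lemma lint_rint f : lint f -> rint f.
Proof. by move=> [_ h]; exact: h. Qed.

Lemma lint_cont f : rcont f -> lint f.
Proof.
move=> cf; split; first exact: continuous_measurable_fun.
move=> a b; apply: continuous_compact_integrable; first exact: segment_compact.
exact: continuous_subspaceT.
Qed.

Lemma lint_shift f a : lint f -> lint (fun x => f (x + a)).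
Proof.
move=> [mf fi]; have E : (fun x => f (x + a)) = f \o aff 1 a.
  by apply/funext => x /=; rewrite /aff mul1r.
rewrite E; split; first exact: (measurableT_comp mf (measurable_aff 1 a)).
move=> u v; rewrite -(aff_preimage_itv a u v _ _ ltr01).
by apply: integrable_aff.
Qed.

Lemma Rintegral_shift f a (u v : R) (bu bv : bool) : lint f ->
  \int[mu]_(x in [set` Interval (BSide bu u) (BSide bv v)]) f (x + a) =
  \int[mu]_(x in [set` Interval (BSide bu (u + a)) (BSide bv (v + a))]) f x.
Proof.
move=> [mf fi].
have E x : aff 1 a x = x + a by rewrite /aff mul1r.
rewrite -(aff_preimage_itv a u v _ _ ltr01) !E.
transitivity (1^-1 * \int[mu]_(x in
   [set` Interval (BSide bu (u + a)) (BSide bv (v + a))]) f x).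
  rewrite -(@Rintegral_aff 1 a) //.
    by apply: eq_Rintegral => x _; rewrite E.
  apply: integrableS (fi (u + a) (v + a)) => //.
  by apply: subset_itv; rewrite bnd_simp; case: bu; case: bv.
by rewrite invr1 mul1r.
Qed.

Lemma rmean_shift f a : lint f -> (forall x, f (x + 2 * pi) = f x) ->
  0 <= a <= 2 * pi -> rmean (fun x => f (x + a)) = rmean f.
Proof.
move=> lf per /andP[a0 a2]; rewrite /rmean; congr (_ * _).
rewrite Rintegral_shift // add0r.
have [mf fi] := lf.
have p0 : (0 : R) <= 2 * pi by exact/ltW/pi2_gt0.
have i0 u v (bu bv : bool) :
    mu.-integrable [set` Interval (BSide bu u) (BSide bv v)] (EFin \o f).
  apply: integrableS (fi u v) => //.
  by apply: subset_itv; rewrite bnd_simp; case: bu; case: bv.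
have h1 := @Rintegral_itvB _ f (BLeft 0) (BRight (2 * pi + a)) a (i0 _ _ _ _).
have h2 := @Rintegral_itvB _ f (BLeft 0) (BRight (2 * pi + a)) (2 * pi) (i0 _ _ _ _).
have h3 : \int[mu]_(x in `]2 * pi, 2 * pi + a]) f x = \int[mu]_(x in `[0, a]) f x.
  rewrite -Rintegral_itv_obnd_cbnd; last exact: i0.
  rewrite -[in RHS](_ : (fun x => f (x + 2 * pi)) = f); last exact/funext.
  by rewrite Rintegral_shift // add0r (addrC a).
rewrite -Rintegral_itv_obnd_cbnd; last exact: i0.
rewrite -h1 ?bnd_simp //; last by rewrite lerDr.
rewrite -h3 -h2 ?bnd_simp //; last by rewrite lerDl.
by ring.
Qed.

End AffineChange.

(** * Conservation laws *)

Section Conservation.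
Context {R : realType} (p k e : R) (q qd f : R -> int -> R[i]).
Hypotheses (e100 : e <= 1 / 100) (hp : `|p - 1| <= e) (hk : `|k - 1| <= e).
Hypothesis ode : forall t n,
  qd t n = (0 -i* 1) * ((lam p k n)%:C * q t n + f t n).
Hypothesis dq : forall n, cis_derive (q^~ n) (qd^~ n).
Hypothesis qB : forall s, exists B, forall N, hn N (q s) <= B.
Hypothesis qC : forall s0 (eps : R), 0 < eps ->
  \forall s \near s0, forall N, hn N (fun n => q s n - q s0 n) <= eps.
Hypothesis qF : forall s n, ccvg (fun M => Fc M (q s) n) (f s n).
Implicit Types (s t : R) (N M : nat).

(** What the truncation of the solution to finitely many modes lacks to satisfy
    the truncated equation. *)
Let err N s n : R[i] := f s n - Fc N (q s) n.

Lemma hn0 N : hn N (fun=> 0 : R[i]) = 0.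
Proof. by rewrite /hn big1 // => n _; rewrite nsq0 mulr0. Qed.

Lemma Fc0 N n : Fc N (fun=> 0 : R[i]) n = 0.
Proof.
rewrite /Fc (_ : (fun t => _) = fun=> 0).
  rewrite /fcoef (_ : (fun t => _) = fun=> 0) ?mean_cst //.
  by apply/funext => t; rewrite mul0r.
apply/funext => t; rewrite /tp big1 ?cubE ?mul0r // => m _; exact: mul0r.
Qed.

Lemma hn_Fc_le L M (c : int -> R[i]) :
  hn L (Fc M c) <= 40 ^+ 2 * hn M c ^+ 2 * hn M c.
Proof.
have := hn_Fc_lip L M c (fun=> 0); rewrite hn0 addr0.
rewrite (_ : (fun n => Fc M c n - _) = Fc M c); last first.
  by apply/funext => n; rewrite Fc0 subr0.
rewrite (_ : (fun n => c n - 0) = c) //.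
by apply/funext => n; rewrite subr0.
Qed.

Lemma locally_bounded s0 : exists2 B, 0 <= B &
  \forall s \near s0, forall N, hn N (q s) <= B.
Proof.
have [B hB] := qB s0; have B0 : 0 <= B by apply: le_trans (hn_ge0 0 _) (hB 0%N).
exists (2 * B + 2); first lra.
have := qC s0 ltr01; apply: filterS => s h N.
have -> : q s = fun n => q s0 n + (q s n - q s0 n).
  by apply/funext => n; ring.
by apply: le_trans (hnD _ _ _) _; have := h N; have := hB N; lra.
Qed.

(** The error is the limit in [M] of the differences [Fc M q - Fc N q], which the
    Lipschitz estimate bounds by the tail of [q] beyond [N]. This tail is small
    locally uniformly in time because the curve is continuous in H^1. *)
Lemma err_small s0 (eps : R) : 0 < eps ->
  \forall s \near s0 & N \near \oo, hn N (err N s) <= eps.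
Proof.
move=> e0; have [B B0 nearB] := locally_bounded s0.
have [B1 hB1] := qB s0.
pose K : R := 40 ^+ 2 * (B + B) ^+ 2.
have K0 : 0 <= K by rewrite mulr_ge0 // sqr_ge0.
pose eta := eps / (4 * K + 1).
have K1 : 0 < 4 * K + 1 by rewrite ltr_wpDl // mulr_ge0.
have eta0 : 0 < eta by rewrite divr_gt0.
have etaE : K * (4 * eta) <= eps.
  have : eps = eta * (4 * K + 1) by rewrite /eta divfK // gt_eqF.
  by lra.
have nearC := qC s0 eta0.
have nearT := hn_tail_small hB1 eta0.
exists ([set s | (forall N, hn N (q s) <= B) /\
  (forall N, hn N (fun n => q s n - q s0 n) <= eta)],
  [set N | forall M, (N <= M)%N ->
    hn M (fun n => q s0 n - trunc N (q s0) n) <= eta]).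
  by split=> //=; near=> s; split; near: s.
move=> [s N] /= [[sB sC] sT].
apply: (hn_lim_le (u := fun M => Fc M (q s))); first exact: qF.
exists N => // M /= NM; rewrite -(Fc_trunc _ NM).
apply: le_trans (hn_Fc_lip _ _ _ _) _.
have t1 : hn M (fun n => q s n - trunc N (q s) n) <= 4 * eta.
  pose d n := q s n - q s0 n.
  have -> : (fun n => q s n - trunc N (q s) n) = fun n =>
      (q s0 n - trunc N (q s0) n) + (d n - trunc N d n).
    by apply/funext => n; rewrite /trunc /d; case: ifP => _; ring.
  apply: le_trans (hnD _ _ _) _; have := sT M NM.
  have := hn_tail_le N M d; have := sC M; rewrite -/d; lra.
apply: le_trans etaE; apply: ler_pM => //; first last.
- rewrite /K ler_wpM2l // ?sqr_ge0 //.
  apply: lerXn2r; rewrite ?nnegrE ?addr_ge0 ?hn_ge0 //.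
  by apply: lerD => //; apply: le_trans (hn_trunc_le _ _ _) _.
- exact: hn_ge0.
- by rewrite mulr_ge0 // sqr_ge0.
Unshelve. all: by end_near.
Qed.

Let J1 N t := \sum_(n <- modes N) nsq (q t n).
Let J2 N t := \sum_(n <- modes N) n%:~R * nsq (q t n).
Let J3 N t := Lam p k N (q t).
Let mi n (z : int -> R[i]) : R[i] := (0 +i* 1) * z n.
Let dJ1 N t := 2 * \sum_(n <- modes N)
  1 * complex.Re (err N t n * (mi n (q t))^*).
Let dJ2 N t := 2 * \sum_(n <- modes N)
  n%:~R * complex.Re (err N t n * (mi n (q t))^*).
Let dJ3 N t := 2 * (\sum_(n <- modes N)
  lam p k n * complex.Re (err N t n * (mi n (q t))^*) +
  \sum_(n <- modes N) 1 * complex.Re (err N t n * (mi n (Fc N (q t)))^*)).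

Let fE N t n : f t n = Fc N (q t) n + err N t n.
Proof. by rewrite /err; ring. Qed.

Lemma dJ1E N t : is_derive t 1 (J1 N) (dJ1 N t).
Proof.
apply: (is_derive_fun _ _ (is_derive_sum_seq (modes N)
  (fun n => is_derive_nsq (dq n t).1 (dq n t).2))) => //.
rewrite -mulr_sumr /dJ1; congr (2 * _).
rewrite -[RHS]add0r -[X in _ = X + _](sum_Fc_charge N (q t)) -big_split.
apply: eq_bigr => n _ /=.
by rewrite ode (fE N) /mi !ReImE /=; ring.
Qed.

Lemma dJ2E N t : is_derive t 1 (J2 N) (dJ2 N t).
Proof.
apply: (is_derive_fun _ _ (is_derive_sum_seq (modes N)
  (fun n => is_deriveZfun n%:~R (is_derive_nsq (dq n t).1 (dq n t).2)))) => //.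
have -> : dJ2 N t = 2 * (\sum_(n <- modes N)
    complex.Re (Fc N (q t) n * (dcoef (q t) n)^*) + \sum_(n <- modes N)
    n%:~R * complex.Re (err N t n * (mi n (q t))^*)).
  by rewrite sum_Fc_momentum add0r.
rewrite -big_split mulr_sumr.
apply: eq_bigr => n _ /=.
by rewrite ode (fE N) /mi /dcoef !ReImE /=; ring.
Qed.

(** Expand [Lam] at the point [q t]: the terms of second order do not contribute to
    the derivative at [t]. *)
Lemma is_derive_Lam N t :
  is_derive t 1 (J3 N) (2 * dLam p k N (q t) (qd t)).
Proof.
pose d s n := q s n - q t n.
have dd n : is_derive t 1 (fun s => complex.Re (d s n)) (complex.Re (qd t n)) /\
    is_derive t 1 (fun s => complex.Im (d s n)) (complex.Im (qd t n)).
  have [h1 h2] := dq n t; split.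
    apply: (is_derive_fun _ _ (is_deriveBfun h1
      (is_derive_cst (complex.Re (q t n)) t (1 : R)))).
      by move=> s; rewrite cReD cReN.
    by rewrite subr0.
  apply: (is_derive_fun _ _ (is_deriveBfun h2
      (is_derive_cst (complex.Im (q t n)) t (1 : R)))).
    by move=> s; rewrite cImD cImN.
  by rewrite subr0.
have d0 n : d t n = 0 by rewrite /d subrr.
have dnsq n : is_derive t 1 (fun s => nsq (d s n)) 0.
  apply: (is_derive_fun _ _ (is_derive_nsq (dd n).1 (dd n).2)) => //.
  by rewrite d0 mul0r mulr0.
have h1 : is_derive t 1 (fun s => dLam p k N (q t) (d s))
    (dLam p k N (q t) (qd t)).
  apply: (is_derive_fun (fun s => dLamE p k N (q t) (d s)) (esym (dLamE _ _ _ _ _))).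
  apply: is_derive_sum_seq => n; set x := _ + _.
  apply: (is_derive_fun _ _ (is_deriveDfun
    (is_deriveZfun (complex.Re x) (dd n).1)
    (is_deriveZfun (complex.Im x) (dd n).2))).
    by move=> s; rewrite !ReImE; ring.
  by rewrite !ReImE; ring.
have h2 : is_derive t 1 (fun s => \sum_(n <- modes N) lam p k n * nsq (d s n)) 0.
  apply: (is_derive_fun _ _ (is_derive_sum_seq (modes N)
    (fun n => is_deriveZfun (lam p k n) (dnsq n)))) => //.
  by rewrite big1 // => n _; rewrite mulr0.
have h3 : is_derive t 1 (fun s => rmean (qrem N (q t) (d s))) 0.
  apply: (is_derive_squeeze (g := fun s =>
    (50 * hn N (q t) + 10 * hn N (d s)) * l2n N (d s))).
  - by move=> s; rewrite rmean_ge0 ?rmean_qrem_le // => z; exact: qrem_ge0.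
  - rewrite /l2n big1 ?mulr0 // => n _; by rewrite d0 nsq0.
  - have g1 : is_derive t 1 (fun s => hn N (d s)) 0.
      apply: (is_derive_fun _ _ (is_derive_sum_seq (modes N)
        (fun n => is_deriveZfun (wgt n) (dnsq n)))) => //.
      by rewrite big1 // => n _; rewrite mulr0.
    have g2 : is_derive t 1 (fun s => l2n N (d s)) 0.
      apply: (is_derive_fun _ _ (is_derive_sum_seq (modes N) dnsq)) => //.
      by rewrite big1.
    apply: (is_derive_fun _ _ (is_deriveMfun (is_deriveDfun
      (is_derive_cst (50 * hn N (q t)) t (1 : R)) (is_deriveZfun 10 g1)) g2)) => //.
    by rewrite !mulr0 !addr0 mul0r.
apply: (is_derive_fun _ _ (is_deriveDfun (is_deriveDfun (is_deriveDfun
  (is_derive_cst (Lam p k N (q t)) t (1 : R)) (is_deriveZfun 2 h1)) h2)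
  (is_deriveZfun 2^-1 h3))).
  move=> s; rewrite /J3 -Lam_expand; congr (Lam _ _ _ _).
  by apply/funext => n; rewrite /d; ring.
by rewrite mulr0 !addr0 add0r.
Qed.

(** The energy is preserved by the truncated equation exactly, because the velocity
    is its gradient turned by a right angle: only the error contributes. *)
Lemma dJ3E N t : is_derive t 1 (J3 N) (dJ3 N t).
Proof.
apply: (is_derive_fun _ _ (is_derive_Lam N t)) => //.
rewrite dLamE /dJ3 -big_split; congr (2 * _); apply: eq_bigr => n _ /=.
by rewrite ode (fE N) /mi !ReImE /=; ring.
Qed.

Lemma hn_mi N (z : int -> R[i]) : hn N (fun n => mi n z) = hn N z.
Proof.
apply: eq_bigr => n _; rewrite /mi nsqM (_ : nsq (0 +i* 1) = 1) ?mul1r //.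
by rewrite /nsq /= expr0n expr1n add0r.
Qed.

Lemma dJ_small (dJ : nat -> R -> R) : (forall N t, `|dJ N t| <=
    2 * (20 * (Num.sqrt (hn N (err N t)) * Num.sqrt (hn N (q t))) +
    1 * (Num.sqrt (hn N (err N t)) * Num.sqrt (hn N (Fc N (q t)))))) ->
  forall s0 eps : R, 0 < eps ->
    \forall s \near s0 & N \near \oo, `|dJ N s| <= eps.
Proof.
move=> hdJ s0 eps e0; have [B B0 nearB] := locally_bounded s0.
pose D := 20 * Num.sqrt B + Num.sqrt (40 ^+ 2 * B ^+ 2 * B).
have D0 : 0 <= D by rewrite addr_ge0 ?mulr_ge0 ?sqrtr_ge0.
pose eta := eps / (2 * D + 1).
have K1 : 0 < 2 * D + 1 by rewrite ltr_wpDl // mulr_ge0.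
have eta0 : 0 < eta by rewrite divr_gt0.
have etaE : 2 * (eta * D) <= eps.
  have : eps = eta * (2 * D + 1) by rewrite /eta divfK // gt_eqF.
  by lra.
have := err_small s0 (exprn_gt0 2 eta0).
have : \forall s \near s0 & N \near \oo, forall N, hn N (q s) <= B.
  exists ([set s | forall N, hn N (q s) <= B], setT) => /=.
    by split => //; exact: filterT.
  by move=> [s N] [].
apply: filterS2 => -[s N] /= sB small.
apply: le_trans (hdJ N s) _; apply: le_trans etaE.
rewrite ler_wpM2l // mul1r (mulrCA 20) -mulrDr.
apply: ler_pM.
- exact: sqrtr_ge0.
- by rewrite addr_ge0 ?mulr_ge0 ?sqrtr_ge0.
- by rewrite -(ger0_norm (ltW eta0)) -sqrtr_sqr ler_wsqrtr.
rewrite lerD ?ler_wpM2l ?ler_wsqrtr //.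
apply: le_trans (hn_Fc_le _ _ _) _.
apply: ler_pM; [by rewrite mulr_ge0 ?sqr_ge0|exact: hn_ge0| |exact: sB].
rewrite ler_wpM2l ?sqr_ge0 //.
by apply: lerXn2r; rewrite ?nnegrE ?hn_ge0.
Qed.

(** On finitely many modes the three quantities are preserved up to the error of
    truncation, which disappears in the limit. *)
Lemma conservation t (eps : R) : 0 < eps -> \forall N \near \oo,
  [/\ `|\sum_(n <- modes N) nsq (q t n) - \sum_(n <- modes N) nsq (q 0 n)| <= eps,
      `|\sum_(n <- modes N) n%:~R * nsq (q t n) -
        \sum_(n <- modes N) n%:~R * nsq (q 0 n)| <= eps &
      `|Lam p k N (q t) - Lam p k N (q 0)| <= eps].
Proof.
move=> e0.
have pos1 N s : 0 <= Num.sqrt (hn N (err N s)) * Num.sqrt (hn N (q s)).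
  by rewrite mulr_ge0 ?sqrtr_ge0.
have pos2 N s : 0 <= Num.sqrt (hn N (err N s)) * Num.sqrt (hn N (Fc N (q s))).
  by rewrite mulr_ge0 ?sqrtr_ge0.
have h1 : forall s0 eps : R, 0 < eps ->
    \forall s \near s0 & N \near \oo, `|dJ1 N s| <= eps.
  apply: dJ_small => N s; rewrite /dJ1 normrM normr_nat ler_wpM2l //.
  have w1 n : `|1 : R| <= 1 * wgt n by rewrite normr1 mul1r wgt_ge1.
  have := pair_le N (err N s) (fun n => mi n (q s)) ler01 w1.
  by rewrite hn_mi; have := pos1 N s; have := pos2 N s; lra.
have h2 : forall s0 eps : R, 0 < eps ->
    \forall s \near s0 & N \near \oo, `|dJ2 N s| <= eps.
  apply: dJ_small => N s; rewrite /dJ2 normrM normr_nat ler_wpM2l //.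
  have w1 n : `|n%:~R : R| <= 1 * wgt n.
    by rewrite mul1r; apply: le_trans (intr_norm_le_sqr _) _; rewrite lerDr.
  have := pair_le N (err N s) (fun n => mi n (q s)) ler01 w1.
  by rewrite hn_mi; have := pos1 N s; have := pos2 N s; lra.
have h3 : forall s0 eps : R, 0 < eps ->
    \forall s \near s0 & N \near \oo, `|dJ3 N s| <= eps.
  apply: dJ_small => N s; rewrite /dJ3 normrM normr_nat ler_wpM2l //.
  apply: le_trans (ler_normD _ _) _; apply: lerD.
    rewrite -(hn_mi N (q s)); apply: pair_le => // n.
    exact: (lam_le e100 hp hk).
  rewrite -(hn_mi N (Fc N (q s))); apply: pair_le => // n.
  by rewrite normr1 mul1r wgt_ge1.
have c1 := cvg_variation0 dJ1E h1 t e0.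
have c2 := cvg_variation0 dJ2E h2 t e0.
have c3 := cvg_variation0 dJ3E h3 t e0.
near=> N; split; near: N; [exact: c1|exact: c2|exact: c3].
Unshelve. all: by end_near.
Qed.

End Conservation.

(** * Orbital stability for sequences of coefficients *)

Section Angles.
Context {R : realType}.

Lemma expi_2pi (a : R) : expi (a + 2 * pi) = expi a.
Proof. by have := expi_periodicz 1 a; rewrite mul1r. Qed.

(** Arguments of complex numbers, from the inverse of the cosine and the sign of
    the sine. *)
Lemma polar (z : R[i]) : exists2 a : R, 0 <= a <= 2 * pi &
  z = (Normc.normc z)%:C * expi a.
Proof.
have p0 := pi_gt0 R.
have [->|z0] := eqVneq z 0.
  exists 0; first by rewrite lexx mulr_ge0 // ltW.
  by rewrite Normc.normc0 mul0r.
have r0 : 0 < Normc.normc z.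
  rewrite lt_def normc_ge0 andbT; apply: contraNneq z0 => /Normc.eq0_normc.
  by move=> ->.
set r := Normc.normc z in r0 *.
have rE : r ^+ 2 = complex.Re z ^+ 2 + complex.Im z ^+ 2 by exact: normc_nsq.
have xr : `|complex.Re z| <= r.
  rewrite -ler_sqr ?nnegrE ?normr_ge0 ?(ltW r0) // rE -normrX ger0_norm ?sqr_ge0 //.
  by rewrite lerDl sqr_ge0.
have x1 : -1 <= complex.Re z / r <= 1.
  by rewrite ler_pdivlMr // ler_pdivrMr // mulN1r mul1r -ler_norml.
have c := acosK x1; have a0 := acos_ge0 x1; have api := acos_lepi x1.
have s : sin (acos (complex.Re z / r)) = `|complex.Im z| / r.
  rewrite sin_acos // -[in RHS](gtr0_norm r0) -normrV ?unitfE ?gt_eqF // -normrM.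
  rewrite -sqrtr_sqr; congr Num.sqrt.
  rewrite !exprMn exprVn; apply/eqP.
  by rewrite subr_eq -mulrDl addrC -rE divff // sqrf_eq0 gt_eqF.
have [y0|y0] := leP 0 (complex.Im z).
  exists (acos (complex.Re z / r)); first by rewrite a0 /=; lra.
  apply: complexP; rewrite !ReImE /= ?c ?s ?(ger0_norm y0).
    by rewrite mul0r subr0 mulrC divfK // gt_eqF.
  by rewrite mul0r addr0 mulrC divfK // gt_eqF.
exists (2 * pi - acos (complex.Re z / r)); first by apply/andP; split; lra.
rewrite addrC expi_2pi; apply: complexP; rewrite !ReImE /= ?cosN ?sinN ?c ?s.
  by rewrite mul0r subr0 mulrC divfK // gt_eqF.
by rewrite (ltr0_norm y0) mulNr opprK mul0r addr0 mulrC divfK // gt_eqF.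
Qed.

(** Turning [w] by the right angle makes it parallel to [z]. The offset [b] is
    subtracted in advance: the angle for the mode -1 is the sum of the phase
    and of the translation. *)
Lemma align (z w : R[i]) (b : R) : 0 <= b <= 2 * pi ->
  exists2 a : R, 0 <= a <= 2 * pi &
  nsq (z - expi (a + b) * w) = (Normc.normc z - Normc.normc w) ^+ 2.
Proof.
move=> /andP[b0 b2]; have p0 := pi_gt0 R.
have [al /andP[al0 al2] zE] := polar z; have [be /andP[be0 be2] wE] := polar w.
have main a : expi (a + b) * expi be = expi al ->
    nsq (z - expi (a + b) * w) = (Normc.normc z - Normc.normc w) ^+ 2.
  move=> h; rewrite [in LHS]zE [in LHS]wE.
  rewrite (_ : _ - _ = (Normc.normc z - Normc.normc w)%:C * expi al).
    by rewrite nsqM nsq_expi nsqC mulr1.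
  by rewrite mulrCA h rmorphB mulrBl.
have [h|h] := leP 0 (al - be - b).
  exists (al - be - b); first by rewrite h /=; lra.
  by apply: main; rewrite -expiD; congr expi; ring.
have [h2|h2] := leP 0 (al - be - b + 2 * pi).
  exists (al - be - b + 2 * pi); first by rewrite h2 /=; lra.
  by apply: main; rewrite -expiD -[RHS]expi_2pi; congr expi; ring.
exists (al - be - b + 2 * pi + 2 * pi); first by apply/andP; split; lra.
by apply: main; rewrite -expiD -[RHS]expi_2pi -[RHS]expi_2pi; congr expi; ring.
Qed.

End Angles.

Section OrbitalStability.
Context {R : realType} (p k e : R) (q qd f : R -> int -> R[i]).
Context (w fw : int -> R[i]) (r0 : R).
Hypotheses (e100 : e <= 1 / 100) (hp : `|p - 1| <= e) (hk : `|k - 1| <= e).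
Hypothesis e88 : e * 88 ^+ 2 <= 1.
Hypothesis ode : forall t n,
  qd t n = (0 -i* 1) * ((lam p k n)%:C * q t n + f t n).
Hypothesis dq : forall n, cis_derive (q^~ n) (qd^~ n).
Hypothesis qB : forall s, exists B, forall N, hn N (q s) <= B.
Hypothesis qC : forall s0 (eps : R), 0 < eps ->
  \forall s \near s0, forall N, hn N (fun n => q s n - q s0 n) <= eps.
Hypothesis qF : forall s n, ccvg (fun M => Fc M (q s) n) (f s n).
Hypothesis wB : forall N, hn N w <= 1 / 100.
Hypothesis wE : forall n, (lam p k n)%:C * w n + fw n = 0.
Hypothesis wF : forall n, ccvg (fun M => Fc M w n) (fw n).
Hypothesis hr0 : 0 <= r0 < 1.
Hypothesis init : forall N, hn N (fun n => q 0 n - w n) <= r0 ^+ 2.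

(** [err_small] for the wave, seen as a constant curve. *)
Let wave_err (eps : R) : 0 < eps ->
  \forall N \near \oo, hn N (fun n => fw n - Fc N w n) <= eps.
Proof.
move=> e0.
have qB' (s : R) : exists B, forall N, hn N w <= B by exists (1 / 100).
have qC' (s0 eps1 : R) : 0 < eps1 ->
    \forall s \near s0, forall N, hn N (fun n => w n - w n) <= eps1.
  move=> h; near=> s => N; rewrite /hn big1 ?ltW // => n _.
  by rewrite subrr nsq0 mulr0.
have [[A B] /= [nA nB] AB] := @err_small R (fun=> w) (fun=> fw) qB' qC'
  (fun _ n => wF n) 0 eps e0.
apply: filterS nB => N BN.
by apply: (AB (0, N)); split => //=; exact: nbhs_singleton.
Unshelve. all: by end_near.
Qed.

(** The wave satisfies the truncated equation up to a small error, so that it is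
    almost a critical point of [Lam] among the trigonometric polynomials of
    high degree. *)
Let dLam_small (D eps : R) : 0 < eps -> \forall N \near \oo,
  forall d, hn N d <= D -> `|dLam p k N w d| <= eps.
Proof.
move=> e0; pose s := Num.sqrt D + 1.
have s0 : 0 < s by rewrite ltr_wpDl ?sqrtr_ge0.
have eta0 : 0 < (eps / s) ^+ 2 by rewrite exprn_gt0 // divr_gt0.
have := wave_err eta0; apply: filterS => N hN d hd.
rewrite dLamE.
have -> : \sum_(n <- modes N)
      complex.Re (((lam p k n)%:C * w n + Fc N w n) * (d n)^*) =
    - \sum_(n <- modes N) 1 * complex.Re ((fw n - Fc N w n) * (d n)^*).
  rewrite -sumrN; apply: eq_bigr => n _; rewrite mul1r -cReN -mulNr opprB.
  have -> : (lam p k n)%:C * w n = - fw n by apply/eqP; rewrite -addr_eq0 wE.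
  by rewrite (addrC _ (Fc N w n)).
rewrite normrN; apply: le_trans (pair_le _ _ _ ler01 _) _.
  by move=> n; rewrite normr1 mul1r wgt_ge1.
rewrite mul1r -[leRHS](divfK (lt0r_neq0 s0)); apply: ler_pM.
- exact: sqrtr_ge0.
- exact: sqrtr_ge0.
- rewrite -[leRHS]ger0_norm ?divr_ge0 ?(ltW e0) ?(ltW s0) //.
  by rewrite -sqrtr_sqr ler_wsqrtr.
- by apply: le_trans (ler_wsqrtr hd) _; rewrite lerDl.
Qed.

(** The phase and the translation are chosen so as to align the modes 0 and -1 with
    those of the wave. The invariances of [Lam] allow to apply
    [finite_stability] with any [rho > r0] on sufficiently many modes, and
    [rho] then tends to [r0]. *)
Lemma orbital_seq t : exists phi xi : R,
  [/\ 0 <= phi <= 2 * pi, 0 <= xi <= 2 * pi & forall N,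
    hn N (fun n => q t n - expi (phi - n%:~R * xi) * w n) <= (220 * r0) ^+ 2].
Proof.
have pi2 : 0 <= (0 : R) <= 2 * pi.
  by apply/andP; split => //; exact/ltW/pi2_gt0.
have [phi hphi al0] := align (q t 0) (w 0) pi2.
have [xi hxi al1] := align (q t (-1)) (w (-1)) hphi.
exists phi, xi; split=> //.
pose rot n : R[i] := expi (phi - n%:~R * xi).
pose S n := conjc (rot n) * q t n.
have rotK n : rot n * conjc (rot n) = 1.
  by rewrite mulcJ /rot nsq_expi.
have rotJ n : conjc (rot n) = conjc (expi phi) * expi (n%:~R * xi).
  by rewrite /rot -!expiN -expiD; congr expi; ring.
have SE n : rot n * S n = q t n by rewrite mulrA rotK mul1r.
have nS n : nsq (S n) = nsq (q t n) by rewrite nsqM nsqJ nsq_expi mul1r.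
have nSw n : nsq (q t n - rot n * w n) = nsq (S n - w n).
  by rewrite -SE -mulrBr nsqM nsq_expi mul1r.
have hS N : hn N (fun n => q t n - rot n * w n) = hn N (fun n => S n - w n).
  by apply: eq_bigr => n _; rewrite nSw.
have LS N : Lam p k N S = Lam p k N (q t).
  rewrite /Lam; congr (_ + 2^-1 * _); first by apply: eq_bigr => n _; rewrite nS.
  have cP := ccont_tp N (q t).
  rewrite -(@rmean_shift _ (fun z => nsq (tp N (q t) z) ^+ 2) xi) //.
  - congr rmean; apply/funext => z.
    have -> : tp N S z = conjc (expi phi) * tp N (q t) (z + xi).
      rewrite /tp mulr_sumr; apply: eq_bigr => n _.
      by rewrite /S rotJ /en mulrDr expiD; ring.
    by rewrite nsqM nsqJ nsq_expi mul1r.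
  - by apply: lint_cont; auto with cont.
  - by move=> z; rewrite tp_periodic.
have [B hB] := qB t.
have B0 : 0 <= B by apply: le_trans (hn_ge0 0 _) (hB 0%N).
have hSB N : hn N S <= B.
  by rewrite (_ : hn N S = hn N (q t)) //; apply: eq_bigr => n _; rewrite nS.
have main (rho : R) : r0 < rho -> rho <= 1 -> \forall N \near \oo,
    hn N (fun n => S n - w n) <= (220 * rho) ^+ 2.
  move=> r0rho rho1; have /andP[r00 _] := hr0.
  have rho0 : 0 < rho by apply: le_lt_trans r0rho.
  have rho2 : 0 < rho ^+ 2 / 2 by rewrite divr_gt0 // exprn_gt0.
  have cons := conservation e100 hp hk ode dq qB qC qF t rho2.
  have crit := dLam_small (2 * B + 2) rho2.
  near=> N.
  have critN : forall d, hn N d <= 2 * B + 2 -> `|dLam p k N w d| <= rho ^+ 2.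
    move=> d hd; have /(_ d hd) : forall d, hn N d <= 2 * B + 2 ->
      `|dLam p k N w d| <= rho ^+ 2 / 2 by near: N; exact: crit.
    by have := rho2; lra.
  have [hA hM hL] : [/\ `|\sum_(n <- modes N) nsq (q t n) -
        \sum_(n <- modes N) nsq (q 0 n)| <= rho ^+ 2 / 2,
      `|\sum_(n <- modes N) n%:~R * nsq (q t n) -
        \sum_(n <- modes N) n%:~R * nsq (q 0 n)| <= rho ^+ 2 / 2 &
      `|Lam p k N (q t) - Lam p k N (q 0)| <= rho ^+ 2 / 2].
    by near: N; exact: cons.
  have N0 : (0 < N)%N by near: N; exact: nbhs_infty_gt.
  have hR : hn N (fun n => q 0 n - w n) <= rho ^+ 2.
    apply: le_trans (init N) _; apply: lerXn2r; rewrite ?nnegrE //; exact: ltW.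
  have r21 : rho ^+ 2 <= 1 by rewrite expr_le1 // ltW.
  apply: (@finite_stability _ p k e e100 hp hk N w (q 0)) => //.
  - by move: hL; rewrite LS ler_norml => /andP[_]; have := rho2; lra.
  - rewrite (_ : \sum_(n <- modes N) nsq (S n) =
      \sum_(n <- modes N) nsq (q t n)) //.
    by apply: eq_bigr => n _; rewrite nS.
  - rewrite (_ : \sum_(n <- modes N) _ * nsq (S n) =
      \sum_(n <- modes N) n%:~R * nsq (q t n)) //.
    by apply: eq_bigr => n _; rewrite nS.
  - rewrite lerNl; apply: le_trans (ler_norm _) _; rewrite normrN critN //.
    apply: le_trans (hnB _ _ _) _; have := hSB N; have := wB N; lra.
  - by apply: le_trans (ler_norm _) _; rewrite critN //; move: hR r21 B0; lra.
  - apply: le_trans (ler_norm _) _; rewrite critN //.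
    have : hn N (high w) <= hn N w.
      apply: ler_sum => n _; rewrite ler_wpM2l ?wgt_ge0 // /high.
      by case: ifP => // _; rewrite nsq0 nsq_ge0.
    by have := wB N; move: B0; lra.
  - rewrite -nSw /rot mul0r subr0; move: al0; rewrite addr0 => ->.
    by rewrite !normc_sqrt nS.
  - rewrite -nSw /rot rmorphN1 mulN1r opprK (addrC phi) al1.
    by rewrite !normc_sqrt nS.
have K0 : (0 : R) < 220 by rewrite ltr0n.
have {}hS N : hn N (fun n => S n - w n) <= (220 * r0) ^+ 2 ->
    hn N (fun n => q t n - rot n * w n) <= (220 * r0) ^+ 2 by rewrite hS.
move=> N; apply: hS; move: main K0; move: (220 : R) => K main K0.
have /andP[r00 r01] := hr0; have K1 := ltW K0.
have h0 := hn_ge0 N (fun n => S n - w n).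
rewrite -(sqr_sqrtr h0); apply: lerXn2r; rewrite ?nnegrE ?sqrtr_ge0 ?mulr_ge0 //.
apply/ler_addgt0Pr => eps eps0.
pose rho := Num.min 1 (r0 + eps / K).
have rhor : r0 < rho by rewrite lt_min r01 ltrDl divr_gt0.
have rho1 : rho <= 1 by rewrite ge_min lexx.
have [M _ hM] := main rho rhor rho1.
have rhoe : K * rho <= K * r0 + eps.
  have : rho <= r0 + eps / K by rewrite ge_min lexx orbT.
  rewrite -(ler_pM2l K0) mulrDr => h; apply: le_trans h _.
  by rewrite lerD2l mulrC divfK // gt_eqF.
apply: le_trans rhoe.
have rho00 : 0 <= K * rho.
  by rewrite mulr_ge0 //; apply: ltW; apply: le_lt_trans rhor.
rewrite -(ger0_norm rho00) -sqrtr_sqr ler_wsqrtr //.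
apply: le_trans (hn_mono _ (leq_maxr M N)) _.
by apply: hM; rewrite /= leq_maxl.
Unshelve. all: by end_near.
Qed.

End OrbitalStability.

(** * Smooth functions *)

Section Smooth.
Context {R : realType}.
Implicit Types (f g : R -> R) (a b c x y : R).

(** A record rather than a bare conjunction, so that unification does not unfold
    it. *)
Record smooth f : Prop := Smooth {
  smooth_derivable : forall (n : nat) (x : R), derivable (derive1n n f) x 1 }.

(** Coinduction: a class of functions that is stable under derivation consists of
    smooth functions. This replaces formulas for the iterated derivatives. *)
Lemma smooth_coind (S : (R -> R) -> Prop) f :
  (forall g, S g -> exists2 dg, S dg & forall x, is_derive x 1 g (dg x)) ->
  S f -> smooth f.
Proof.
move=> Sd Sf; split=> n; suff Sn : S (derive1n n f).
  by have [dg _ h] := Sd _ Sn; move=> x; have [] := h x.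
elim: n => [//|n IH]; rewrite derive1nS.
have [dg Sdg h] := Sd _ IH.
rewrite (_ : derive1 _ = dg) //.
by apply/funext => x; rewrite derive1E; have [] := h x.
Qed.

Lemma smooth_is_derive f x : smooth f -> is_derive x 1 f (derive1 f x).
Proof.
by case=> sf; rewrite derive1E; apply: derivableP; exact: (sf 0%N).
Qed.

Lemma smooth_derive1 f : smooth f -> smooth (derive1 f).
Proof.
case=> sf; split=> n x; have := sf n.+1 x.
by rewrite /derive1n iterSr.
Qed.

Lemma smooth_cont f : smooth f -> rcont f.
Proof.
case=> sf x; apply/differentiable_continuous/derivable1_diffP.
exact: (sf 0%N).
Qed.

Lemma derive1_eq f g : (forall x, is_derive x 1 f (g x)) -> derive1 f = g.
Proof. by move=> h; apply/funext => x; rewrite derive1E; have [] := h x. Qed.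

Lemma smooth_prim f g : (forall x, is_derive x 1 f (g x)) -> smooth g -> smooth f.
Proof.
move=> h sg; apply: (@smooth_coind (fun u => u = f \/ smooth u)); last by left.
move=> u [->|su]; first by exists g => //; right.
exists (derive1 u); first by right; exact: smooth_derive1.
by move=> x; exact: smooth_is_derive.
Qed.

Lemma smooth_cst c : smooth (fun=> c).
Proof.
apply: (@smooth_coind (fun u => exists c, u = fun=> c)); last by exists c.
move=> _ [d ->]; exists (fun=> 0); first by exists 0.
by move=> x; exact: is_derive_cst.
Qed.

Lemma smoothD f g : smooth f -> smooth g -> smooth (fun x => f x + g x).
Proof.
move=> sf sg; apply: (@smooth_coind (fun u => exists h k,
  [/\ smooth h, smooth k & u = fun x => h x + k x])); last by exists f, g.
move=> _ [h [k [sh sk ->]]]; exists (fun x => derive1 h x + derive1 k x).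
  by exists (derive1 h), (derive1 k); split=> //; exact: smooth_derive1.
by move=> x; apply: is_deriveDfun; exact: smooth_is_derive.
Qed.

(** The class needed to apply [smooth_coind] to a product, by the Leibniz rule. *)
Inductive smooth_products : (R -> R) -> Prop :=
| SmoothProduct f g : smooth f -> smooth g ->
    smooth_products (fun x => f x * g x)
| SmoothProductD u v : smooth_products u -> smooth_products v ->
    smooth_products (fun x => u x + v x).

Lemma smoothM f g : smooth f -> smooth g -> smooth (fun x => f x * g x).
Proof.
move=> sf sg; apply: (@smooth_coind smooth_products); last exact: SmoothProduct.
move=> w {f g sf sg}; elim=> {w} [f g sf sg|u v _ [du Su hu] _ [dv Sv hv]].
  exists (fun x => derive1 f x * g x + f x * derive1 g x).
    by apply: SmoothProductD; apply: SmoothProduct => //; exact: smooth_derive1.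
  by move=> x; apply: is_deriveMfun; exact: smooth_is_derive.
exists (fun x => du x + dv x).
  exact: SmoothProductD.
by move=> x; exact: is_deriveDfun.
Qed.

Lemma smoothZ c f : smooth f -> smooth (fun x => c * f x).
Proof. by move=> sf; apply: smoothM => //; exact: smooth_cst. Qed.

Lemma smoothB f g : smooth f -> smooth g -> smooth (fun x => f x - g x).
Proof.
move=> sf sg; rewrite (_ : (fun x => _) = fun x => f x + (-1) * g x).
  by apply: smoothD => //; exact: smoothZ.
by apply/funext => x; rewrite mulN1r.
Qed.

Lemma is_derive_aff f a b x (d : R) : is_derive (a * x + b) 1 f d ->
  is_derive x 1 (fun y => f (a * y + b)) (a * d).
Proof.
move=> h; apply: (is_derive_comp (g := fun y => a * y + b) h).
apply: (is_derive_fun _ _ (is_deriveDfun (is_derive_lin a x)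
  (is_derive_cst b x (1 : R)))) => //.
by rewrite addr0.
Qed.

Lemma smooth_aff f a b : smooth f -> smooth (fun x => f (a * x + b)).
Proof.
move=> sf; apply: (@smooth_coind (fun u => exists c h, smooth h /\
  u = fun x => c * h (a * x + b))).
  move=> _ [c [h [sh ->]]].
  exists (fun x => c * a * derive1 h (a * x + b)).
    by exists (c * a), (derive1 h); split => //; exact: smooth_derive1.
  move=> x; rewrite -mulrA; apply: is_deriveZfun.
  by apply: is_derive_aff; exact: smooth_is_derive.
by exists 1, f; split=> //; apply/funext => x; rewrite mul1r.
Qed.

Lemma smooth_cos_sin c (d : R) : smooth (fun x => c * cos x + d * sin x).
Proof.
apply: (@smooth_coind (fun u => exists c d, u = fun x : R => c * cos x + d * sin x)).
  move=> _ [c1 [d1 ->]]; exists (fun x => d1 * cos x + - c1 * sin x).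
    by exists d1, (- c1).
  move=> x; apply: (is_derive_fun _ _ (is_deriveDfun
    (is_deriveZfun c1 (is_derive_cos x)) (is_deriveZfun d1 (is_derive_sin x)))) => //.
  by ring.
by exists c, d.
Qed.

Lemma smooth_cos : smooth (@cos R).
Proof.
rewrite (_ : cos = fun x => 1 * cos x + 0 * sin x); first exact: smooth_cos_sin.
by apply/funext => x; rewrite mul1r mul0r addr0.
Qed.

Lemma smooth_sin : smooth (@sin R).
Proof.
rewrite (_ : sin = fun x => 0 * cos x + 1 * sin x); first exact: smooth_cos_sin.
by apply/funext => x; rewrite mul1r mul0r add0r.
Qed.

(** Derivation sends a function of this form to another one, whence smoothness
    by coinduction. *)
Definition flat (P : {poly R}) x : R :=
  if 0 < x then P.[x^-1] * expR (- x^-1) else 0.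

Lemma poly_expR_bounded (P : {poly R}) : exists2 M, 0 <= M &
  forall y, 0 <= y -> `|P.[y] * expR (- y)| <= M.
Proof.
exists (\sum_(i < size P) `|P`_i| * i`!%:R).
  by apply: sumr_ge0 => i _; rewrite mulr_ge0.
move=> y y0; rewrite horner_coef mulr_suml.
apply: le_trans (ler_norm_sum _ _ _) _; apply: ler_sum => i _.
rewrite -mulrA normrM ler_wpM2l // ger0_norm; last first.
  by rewrite mulr_ge0 ?exprn_ge0 ?expR_ge0.
rewrite expRN ler_pdivrMr ?expR_gt0 //.
case: (nat_of_ord i) => [|j].
  by rewrite expr0 fact0 mul1r; have := expR_ge1Dx y; lra.
rewrite mulrC -ler_pdivrMr ?ltr0n ?fact_gt0 //.
by apply: le_trans (expR_ge1Dxn j y0); rewrite lerDr.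
Qed.

Lemma flat_quadratic (P : {poly R}) : exists2 M, 0 <= M &
  forall x, `|flat P x| <= M * x ^+ 2.
Proof.
have [M M0 hM] := poly_expR_bounded ('X^2 * P); exists M => // x.
rewrite /flat; case: ltP => x0; last by rewrite normr0 mulr_ge0 ?sqr_ge0.
have x1 : 0 <= x^-1 by rewrite invr_ge0 ltW.
have := hM _ x1; rewrite hornerM hornerXn => h.
have -> : P.[x^-1] * expR (- x^-1) =
    (x^-1 ^+ 2 * P.[x^-1] * expR (- x^-1)) * x ^+ 2.
  by field; rewrite gt_eqF.
by rewrite normrM (ger0_norm (sqr_ge0 x)) ler_wpM2r ?sqr_ge0.
Qed.

(** At the origin the function is bounded by a multiple of [x ^+ 2], by comparison of
    the exponential with its Taylor polynomials. *)
Lemma flat_derive (P : {poly R}) x :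
  is_derive x 1 (flat P) (flat ('X^2 * (P - P^`())) x).
Proof.
have [x0|x0|x0] := ltgtP x 0.
- have -> : flat ('X^2 * (P - P^`())) x = 0 by rewrite /flat ltNge (ltW x0).
  apply: (@near_eq_is_derive _ _ _ (fun=> 0)).
  near=> y; have y0 : y < 0 by near: y; exact: lt_nbhsl.
  by rewrite /flat ltNge (ltW y0).
- have -> : flat ('X^2 * (P - P^`())) x =
      (P^`().[x^-1] * (- (x ^- 2))) * expR (- x^-1) +
      P.[x^-1] * ((- - (x ^- 2)) * expR (- x^-1)).
    rewrite /flat x0 hornerM hornerXn hornerD hornerN exprVn; ring.
  apply: (@near_eq_is_derive _ _ _ (fun y => P.[y^-1] * expR (- y^-1))).
    near=> y; have y0 : 0 < y by near: y; exact: lt_nbhsr.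
    by rewrite /flat y0.
  have xN : x != 0 by rewrite gt_eqF.
  have dV : is_derive x 1 (fun y : R => y^-1) (- (x ^- 2)).
    apply: (is_derive_fun _ _ (is_deriveV _ (is_derive_id x (1 : R)))) => //.
    by rewrite /GRing.scale /= mulr1.
  have h1 : is_derive x 1 (fun y => P.[y^-1]) (P^`().[x^-1] * (- x ^- 2)).
    rewrite mulrC; exact: (is_derive_comp (is_derive_poly P x^-1) dV).
  have h2 := is_derive_comp (g := fun y => - y^-1)
    (is_derive_expR (- x^-1)) (is_deriveNfun dV).
  exact: (is_deriveMfun h1 h2).
- rewrite x0; have -> : flat ('X^2 * (P - P^`())) 0 = 0 by rewrite /flat ltxx.
  have [M M0 hM] := flat_quadratic P.
  have f0 : flat P 0 = 0 by rewrite /flat ltxx.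
  apply/is_deriveP; apply/cvgrPdist_le => eps e0; near=> h.
  rewrite addr0 f0 subr0 sub0r normrN normrM.
  have hN : h != 0 by near: h; exact: nbhs_dnbhs_neq.
  apply: (@le_trans _ _ (`|h^-1| * (M * h ^+ 2))); first by rewrite ler_wpM2l.
  rewrite -(real_normK (num_real h)) normfV.
  rewrite (_ : `|h|^-1 * _ = M * `|h|); last by field; rewrite normr_eq0.
  apply: (@le_trans _ _ ((M + 1) * `|h|)); first by rewrite ler_wpM2r // lerDl.
  rewrite mulrC -ler_pdivlMr ?ltr_wpDl //.
  by near: h; apply: dnbhs0_le; rewrite divr_gt0 // ltr_wpDl.
Unshelve. all: by end_near.
Qed.

Lemma smooth_flat (P : {poly R}) : smooth (flat P).
Proof.
apply: (@smooth_coind (fun u => exists P, u = flat P)); last by exists P.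
move=> _ [Q ->]; exists (flat ('X^2 * (Q - Q^`()))); last exact: flat_derive.
by exists ('X^2 * (Q - Q^`())).
Qed.

Lemma flat1_ge0 x : 0 <= flat 1 x.
Proof. by rewrite /flat; case: ifP => // _; rewrite hornerE mul1r expR_ge0. Qed.
Lemma flat1_gt0 x : 0 < x -> 0 < flat 1 x.
Proof. by move=> x0; rewrite /flat x0 hornerE mul1r expR_gt0. Qed.
Lemma flat1_0 x : x <= 0 -> flat 1 x = 0.
Proof. by move=> x0; rewrite /flat ltNge x0. Qed.

End Smooth.

(** * Smooth steps *)

Section Step.
Context {R : realType}.
Local Notation mu := (@lebesgue_measure R).
Implicit Types (x y : R).

Definition bump0 x : R := flat 1 x * flat 1 (1 - x).

Lemma smooth_bump0 : smooth bump0.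
Proof.
apply: smoothM; first exact: smooth_flat.
rewrite (_ : (fun x => _) = fun x => flat 1 (-1 * x + 1)).
  by apply: smooth_aff; exact: smooth_flat.
by apply/funext => x; rewrite mulN1r addrC.
Qed.

Lemma bump0_ge0 x : 0 <= bump0 x.
Proof. by rewrite mulr_ge0 ?flat1_ge0. Qed.
Lemma bump0_gt0 x : 0 < x < 1 -> 0 < bump0 x.
Proof. by move=> /andP[x0 x1]; rewrite mulr_gt0 // flat1_gt0 // subr_gt0. Qed.
Lemma bump0_le0 x : x <= 0 -> bump0 x = 0.
Proof. by move=> x0; rewrite /bump0 flat1_0 // mul0r. Qed.
Lemma bump0_ge1 x : 1 <= x -> bump0 x = 0.
Proof.
by move=> x0; rewrite /bump0 (@flat1_0 _ (1 - x)) ?mulr0 // subr_le0.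
Qed.

Definition step0 x : R := \int[mu]_(t in `[-1, x]) bump0 t.

Lemma step0_le0 x : x <= 0 -> step0 x = 0.
Proof.
move=> x0; rewrite /step0 (@eq_Rintegral _ _ _ _ _ (fun=> 0)).
  by rewrite Rintegral_cst // mul0r.
move=> t; rewrite inE /= in_itv /= => /andP[_ tx].
by rewrite bump0_le0 // (le_trans tx).
Qed.

Lemma is_derive_step0 x : is_derive x 1 step0 (bump0 x).
Proof.
have [x1|x1] := ltP (-1) x.
  have ib := (lint_cont (smooth_cont smooth_bump0)).2 (-1) (x + 1).
  have xx1 : x < x + 1 by rewrite ltrDl.
  have [h1 h2] := continuous_FTC1_closed xx1 ib x1
    (@smooth_cont _ _ smooth_bump0 x).
  split; first exact: h1.
  by rewrite -h2 derive1E.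
have x0 : x < 0 by apply: le_lt_trans x1 _; rewrite oppr_lt0.
rewrite bump0_le0 ?(ltW x0) //.
apply: (@near_eq_is_derive _ _ _ (fun=> 0)).
near=> y; have y0 : y < 0 by near: y; exact: lt_nbhsl.
by rewrite step0_le0 // ltW.
Unshelve. all: by end_near.
Qed.

Lemma step0_MVT x y : x <= y ->
  exists2 c, x <= c <= y & step0 y - step0 x = bump0 c * (y - x).
Proof.
move=> xy; have cs : {within `[x, y], continuous step0}.
  apply: continuous_subspaceT => z.
  by apply/differentiable_continuous/derivable1_diffP; have [] := is_derive_step0 z.
have [c cxy E] := MVT_segment xy (fun z _ => is_derive_step0 z) cs.
by exists c => //; move: cxy; rewrite in_itv.
Qed.

Lemma step0_1gt0 : 0 < step0 1.
Proof.
have l1 : 1 / 2 <= 1 :> R by lra.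
have l2 : 1 / 4 <= 1 / 2 :> R by lra.
have l3 : 0 <= 1 / 4 :> R by lra.
have [c1 _ h1] := step0_MVT l1; have [c2 c2i h2] := step0_MVT l2.
have [c3 _ h3] := step0_MVT l3.
have p1 : 0 <= bump0 c1 * (1 - 1 / 2) by rewrite mulr_ge0 ?bump0_ge0 //; lra.
have p2 : 0 < bump0 c2 * (1 / 2 - 1 / 4).
  by rewrite mulr_gt0 ?bump0_gt0 //; lra.
have p3 : 0 <= bump0 c3 * (1 / 4 - 0) by rewrite mulr_ge0 ?bump0_ge0 //; lra.
have := step0_le0 (lexx 0); lra.
Qed.

(** The normalised primitive of the bump: it goes from 0 on the left of 0 to 1 on
    the right of 1. *)
Definition step x : R := step0 x / step0 1.
Definition mollifier x : R := bump0 x / step0 1.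

Lemma is_derive_step x : is_derive x 1 step (mollifier x).
Proof.
apply: (is_derive_fun _ _ (is_deriveZfun (step0 1)^-1 (is_derive_step0 x))).
  by move=> y; rewrite /step mulrC.
by rewrite /mollifier mulrC.
Qed.

Lemma smooth_mollifier : smooth mollifier.
Proof.
rewrite (_ : mollifier = fun x => (step0 1)^-1 * bump0 x).
  exact: smoothZ smooth_bump0.
by apply/funext => x; rewrite mulrC.
Qed.

Lemma smooth_step : smooth step.
Proof. exact: smooth_prim is_derive_step smooth_mollifier. Qed.

Lemma step_le0 x : x <= 0 -> step x = 0.
Proof. by move=> x0; rewrite /step step0_le0 ?mul0r. Qed.

Lemma step_ge1 x : 1 <= x -> step x = 1.
Proof.
move=> x1; have [c /andP[c1 _]] := step0_MVT x1.
rewrite bump0_ge1 // mul0r => /eqP; rewrite subr_eq0 => /eqP E.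
by rewrite /step E divff // gt_eqF // step0_1gt0.
Qed.

Lemma mollifier_ge0 x : 0 <= mollifier x.
Proof. by rewrite divr_ge0 ?bump0_ge0 // ltW // step0_1gt0. Qed.
Lemma mollifier_le0 x : x <= 0 -> mollifier x = 0.
Proof. by move=> x0; rewrite /mollifier bump0_le0 ?mul0r. Qed.
Lemma mollifier_ge1 x : 1 <= x -> mollifier x = 0.
Proof. by move=> x0; rewrite /mollifier bump0_ge1 ?mul0r. Qed.

Lemma step_homo x y : x <= y -> step x <= step y.
Proof.
move=> xy; rewrite ler_pM2r ?invr_gt0 ?step0_1gt0 //.
have [c _ h] := step0_MVT xy.
by rewrite -subr_ge0 h mulr_ge0 ?bump0_ge0 // subr_ge0.
Qed.

Lemma step_ge0 x : 0 <= step x.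
Proof.
have [x0|x0] := leP x 0; first by rewrite step_le0.
by rewrite -(step_le0 (lexx 0)) step_homo // ltW.
Qed.
Lemma step_le1 x : step x <= 1.
Proof.
have [x1|x1] := leP 1 x; first by rewrite step_ge1.
by rewrite -(step_ge1 (lexx 1)) step_homo // ltW.
Qed.

Lemma mollifier_bounded : exists2 M, 0 < M & forall x, mollifier x <= M.
Proof.
have cK : compact `[0, 1 : R]%classic by exact: segment_compact.
have cfK : {within `[0, 1 : R]%classic, continuous mollifier}.
  exact: continuous_subspaceT (smooth_cont smooth_mollifier).
have /compact_bounded[M [Mr Mb]] := continuous_compact cfK cK.
exists (`|M| + 1); first by rewrite ltr_wpDl.
move=> x; have [x0|x0] := ltP x 0; first by rewrite mollifier_le0 ?ltW // ltr_wpDl.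
have [x1|x1] := ltP 1 x; first by rewrite mollifier_ge1 ?ltW // ltr_wpDl.
apply: le_trans (ler_norm _) _; apply: Mb.
  by apply: le_lt_trans (ler_norm M) _; rewrite ltrDl.
by exists x => //=; rewrite in_itv /= x0.
Qed.

End Step.

Section LocalIntegrability.
Context {R : realType}.
Local Notation mu := (@lebesgue_measure R).
Implicit Types (u v f g : R -> R) (x y a b : R).

Lemma Rintegral_supp f a b : (forall x, ~~ (a <= x <= b) -> f x = 0) ->
  \int[mu]_x f x = \int[mu]_(x in `[a, b]) f x.
Proof.
move=> h; rewrite [RHS]Rintegral_mkcond; apply: eq_Rintegral => x _.
rewrite patchE; case: ifPn => // /negP hx; rewrite h //.
by apply/negP => hab; apply: hx; rewrite inE /= in_itv.
Qed.

Lemma lintM f g : lint f -> rcont g -> lint (fun x => f x * g x).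
Proof.
move=> [mf fi] cg; split.
  by apply: measurable_funM => //; exact: continuous_measurable_fun.
move=> a b; apply: (integrableMl _ (fi a b)) => //.
  by apply: measurable_funTS; exact: continuous_measurable_fun.
have cK : compact `[a, b : R]%classic by exact: segment_compact.
have cfK : {within `[a, b : R]%classic, continuous g} by exact: continuous_subspaceT.
have /compact_bounded[M [Mr Mb]] := continuous_compact cfK cK.
by exists M; split => // x Mx y Dy; apply: Mb => //; exists y.
Qed.

Lemma lintD f g : lint f -> lint g -> lint (fun x => f x + g x).
Proof.
move=> [mf fi] [mg gi]; split; first exact: measurable_funD.
by move=> a b; exact: (integrableD _ (fi a b) (gi a b)).
Qed.
Lemma lintZ c f : lint f -> lint (fun x => c * f x).
Proof.
move=> [mf fi]; split; first exact: measurable_funM.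
by move=> a b; exact: (integrableZl _ c (fi a b)).
Qed.
Lemma lintB f g : lint f -> lint g -> lint (fun x => f x - g x).
Proof.
move=> hf hg; have := lintD hf (lintZ (-1) hg).
by congr lint; apply/funext => x; rewrite mulN1r.
Qed.
Lemma lint_norm f : lint f -> lint (fun x => `|f x|).
Proof.
move=> [mf fi]; split; first exact: measurableT_comp.
by move=> a b; exact: (integrable_norm (fi a b)).
Qed.

Lemma lint_locally f : lint f -> locally_integrable [set: R] f.
Proof.
move=> [mf fi]; split => //; first exact: openT.
move=> K _ cK; have [M [_ hM]] := compact_bounded cK.
have mK : measurable K by exact: compact_measurable.
have KS : K `<=` `[- (`|M| + 1), `|M| + 1]%classic.
  move=> x Kx; rewrite /= in_itv /= -ler_norml; apply: hM => //.
  by apply: le_lt_trans (ler_norm M) _; rewrite ltrDl.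
have /integrableP[_] : mu.-integrable K (EFin \o f).
  by apply: integrableS (fi (- (`|M| + 1)) (`|M| + 1)) => //; exact: KS.
exact.
Qed.

Lemma Rintegral_cvg a b (f_ : nat -> R -> R) f g :
  (forall j, mu.-integrable `[a, b] (EFin \o f_ j)) ->
  mu.-integrable `[a, b] (EFin \o f) ->
  mu.-integrable `[a, b] (EFin \o g) ->
  {ae mu, forall x, a <= x <= b -> f_ j x @[j --> \oo] --> f x} ->
  (forall j x, a <= x <= b -> `|f_ j x| <= g x) ->
  \int[mu]_(x in `[a, b]) f_ j x @[j --> \oo] -->
  \int[mu]_(x in `[a, b]) f x.
Proof.
move=> fi_ fi gi cv dom.
have cvE : {ae mu, forall x, `[a, b]%classic x ->
    (EFin \o f_ j) x @[j --> \oo] --> (EFin \o f) x}.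
  move: cv; apply: (@filterS _ _ (ae_filter_ringOfSetsType mu)) => x cvx /=.
  rewrite in_itv => abx.
  by apply: cvg_EFin; [near=> j|exact: cvx].
have domE : {ae mu, forall x j, `[a, b]%classic x ->
    (`|(EFin \o f_ j) x| <= (EFin \o g) x)%E}.
  by apply: aeW => x j /=; rewrite in_itv lee_fin => abx; exact: dom.
have [_ _ h] := @dominated_convergence _ (measurableTypeR R) R mu `[a, b]%classic
  (measurable_itv _) (fun j => EFin \o f_ j) (EFin \o f) (EFin \o g)
  (fun j => measurable_int mu (fi_ j)) (measurable_int mu fi) cvE gi domE.
have ffin : (\int[mu]_(x in `[a, b]) (EFin \o f) x)%E \is a fin_num.
  by apply: integrable_fin_num.
by apply: fine_cvg; rewrite fineK.
Unshelve. all: by end_near.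
Qed.

End LocalIntegrability.

(** * Test functions and mollification *)

Section Approximation.
Context {R : realType}.
Local Notation mu := (@lebesgue_measure R).
Implicit Types (f g psi : R -> R) (x y a b r : R).

Definition supp_in a b f := forall x, ~~ (a <= x <= b) -> f x = 0.

Lemma smooth_test psi a b : smooth psi -> supp_in a b psi -> test_function psi.
Proof.
move=> sp h; split; first by case: sp.
apply: (@subclosed_compact _ _ `[a, b]%classic).
- exact: closed_closure.
- exact: segment_compact.
rewrite [X in _ `<=` X](closure_id _).1; last exact: itv_closed.
apply: closureS => x /= px; rewrite in_itv /=.
by apply: contraNT px => abx; rewrite h.
Qed.

(** The record and the explicit interval are easier to handle than the closure of
    the support. *)
Lemma test_smooth psi : test_function psi -> smooth psi.
Proof. by case=> h _; split. Qed.

Lemma test_supp psi : test_function psi -> exists a b, supp_in a b psi.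
Proof.
case=> _ /compact_bounded[M [_ hM]]; exists (- (`|M| + 1)), (`|M| + 1) => x.
apply: contraNeq => px; rewrite -ler_norml; apply: hM.
  by apply: le_lt_trans (ler_norm M) _; rewrite ltrDl.
exact: subset_closure.
Qed.

Lemma supp_derive1 a b psi : supp_in a b psi -> supp_in a b (derive1 psi).
Proof.
move=> h x; rewrite negb_and -!ltNge => /orP xab.
have : is_derive x 1 psi 0.
  apply: (@near_eq_is_derive _ _ _ (fun=> 0)).
  case: xab => xab; near=> y; rewrite h // negb_and -!ltNge; apply/orP.
    by left; near: y; exact: lt_nbhsl.
  by right; near: y; exact: lt_nbhsr.
by rewrite derive1E; case.
Unshelve. all: by end_near.
Qed.

Lemma davgE f x r : lint f -> 0 < r ->
  davg f x r = ((r *+ 2)^-1 * \int[mu]_(y in ball x r) `|f y - f x|)%:E.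
Proof.
move=> [mf fi] r0; rewrite /davg /iavg lebesgue_measure_ball ?ltW //.
have r2 : r *+ 2 != 0 by rewrite gt_eqF // mulrn_wgt0.
rewrite inver (negbTE r2) /Rintegral EFinM fineK //.
have -> : ball x r = `]x - r, x + r[%classic by rewrite ball_itv.
have c : lint (fun y => `|f y - f x|).
  by apply: lint_norm; apply: lintB => //; apply: lint_cont; exact: rcont_cst.
apply: (@integrable_fin_num _ _ _ mu) => //.
apply: integrableS (c.2 (x - r) (x + r)) => //.
by apply: subset_itv; rewrite bnd_simp.
Qed.

(** An approximation of the unit mass at [x], supported on the right of [x]. *)
Definition ker (j : nat) x (s : R) : R := j.+1%:R * mollifier (j.+1%:R * (s - x)).

(** At a Lebesgue point the convolution with a shrinking kernel converges: the
    kernel is at most a multiple of the inverse of the length of its support, so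
    that the error is dominated by the mean deviation. *)
Lemma mollify f x : lint f -> lebesgue_pt f x ->
  \int[mu]_(s in `[x, x + j.+1%:R^-1]) (f s * ker j x s)
    @[j --> \oo] --> f x.
Proof.
move=> lf fx; have [M M0 hM] := @mollifier_bounded R.
pose h r := (r *+ 2)^-1 * \int[mu]_(y in ball x r) `|f y - f x|.
pose u (j : nat) : R := 2 / j.+1%:R.
have u0 j : 0 < u j by rewrite divr_gt0.
have uc : u j @[j --> \oo] --> 0.
  rewrite -[X in _ --> X](mulr0 2); apply: cvgM; first exact: cvg_cst.
  exact: cvg_harmonic.
have hu : h (u j) @[j --> \oo] --> 0.
  have : fine (davg f x r) @[r --> 0^'+] --> fine 0%E by exact: fine_cvg.
  move=> /cvg_at_rightP /(_ u) /(_ (conj u0 uc)).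
  by under eq_cvg do rewrite davgE //.
apply/cvgrPdist_le => eps e0.
have e1 : 0 < eps / (4 * M) by rewrite divr_gt0 // mulr_gt0.
move/cvgrPdist_le : hu => /(_ _ e1); apply: filterS => j.
rewrite sub0r normrN => hj.
set K : R := j.+1%:R; have K0 : 0 < K by rewrite /K.
rewrite /ker -/K.
have cb : rcont (fun s => K * mollifier (K * (s - x))).
  apply: rcontM; first exact: rcont_cst.
  by apply: rcont_comp; [exact: (smooth_cont smooth_mollifier)|auto with cont].
have ltx : x < x + K^-1 by rewrite ltrDl invr_gt0.
have I1 : \int[mu]_(s in `[x, x + K^-1]) (K * mollifier (K * (s - x))) = 1.
  have d (s : R) : is_derive s 1 (fun s => step (K * (s - x)))
      (K * mollifier (K * (s - x))).
    have := is_derive_aff (a := K) (b := - (K * x)) (f := step) (x := s).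
    move=> /(_ _ (is_derive_step _)) H.
    rewrite (_ : K * (s - x) = K * s + - (K * x)); last by ring.
    by apply: is_derive_fun H => // y; congr step; ring.
  rewrite (Rintegral_derive ltx cb d).
  rewrite subrr mulr0 (step_le0 (lexx 0)) subr0 step_ge1 //.
  by rewrite [x + _]addrC addrK divff // gt_eqF.
have lk := lintM lf cb.
have lc : lint (fun s => f x * (K * mollifier (K * (s - x)))).
  by apply: lint_cont; apply: rcontM => //; exact: rcont_cst.
rewrite -[X in `|X - _|]mulr1 -I1 -RintegralZl //; last exact: (lint_cont cb).2.
rewrite -RintegralB //; [|exact: lc.2|exact: lk.2].
apply: le_trans (le_normr_Rintegral _ _) _ => //.
  exact: (lintB lc lk).2.
have ln : lint (fun s => K * M * `|f s - f x|).
  by apply/lintZ/lint_norm/lintB => //; apply: lint_cont; exact: rcont_cst.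
have ld : lint (fun s => `|f s - f x|).
  by apply/lint_norm/lintB => //; apply: lint_cont; exact: rcont_cst.
apply: (@le_trans _ _ (\int[mu]_(s in `[x, x + K^-1]) (K * M * `|f s - f x|))).
  apply: le_Rintegral => //; [exact: (lint_norm (lintB lc lk)).2|exact: ln.2|].
  move=> s _; rewrite -mulrBl normrM distrC [leRHS]mulrC ler_wpM2l //.
  rewrite normrM (ger0_norm (ltW K0)) (ger0_norm (mollifier_ge0 _)).
  by rewrite ler_wpM2l ?hM // ltW.
rewrite RintegralZl //; last exact: ld.2.
have le2 : \int[mu]_(s in `[x, x + K^-1]) `|f s - f x| <=
    \int[mu]_(s in ball x (u j)) `|f s - f x|.
  have mB : measurable (ball x (u j)) by exact: measurable_ball.
  have iB : mu.-integrable (ball x (u j)) (EFin \o (fun s => `|f s - f x|)).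
    apply: integrableS (ld.2 (x - u j) (x + u j)) => //.
    by rewrite ball_itv; apply: subset_itv; rewrite bnd_simp.
  rewrite /Rintegral; apply: fine_le.
  - by apply: (@integrable_fin_num _ _ _ mu) => //; exact: ld.2.
  - exact: (@integrable_fin_num _ _ _ mu).
  apply: ge0_subset_integral => //.
  - exact: (measurable_int mu iB).
  rewrite ball_itv; apply: subset_itv; rewrite bnd_simp.
    by rewrite ltrBlDr ltrDl.
  by rewrite ltrD2l -[ltLHS]mul1r ltr_pM2r ?invr_gt0 // ltr1n.
have I0 : 0 <= \int[mu]_(s in ball x (u j)) `|f s - f x|.
  by apply: Rintegral_ge0.
apply: (@le_trans _ _ (4 * M * h (u j))).
  rewrite /h mulrA (_ : 4 * M * (u j *+ 2)^-1 = K * M).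
    by rewrite ler_wpM2l // mulr_ge0 // ltW.
  by rewrite /u -/K -mulr_natr; field; rewrite gt_eqF.
have h0 : 0 <= h (u j).
  by apply: mulr_ge0 => //; rewrite invr_ge0 mulrn_wge0 // ltW.
by move: hj; rewrite ger0_norm // ler_pdivlMr ?mulr_gt0 // mulrC.
Qed.

End Approximation.

(** * Uniqueness of Fourier coefficients *)

Section Uniqueness.
Context {R : realType}.
Local Notation mu := (@lebesgue_measure R).
Implicit Types (f : R -> R) (w : R -> R[i]) (x y z d r : R).

(** Multiplication by [cos (z - c)] shifts the Fourier coefficients by one in both
    directions, so that functions with zero coefficients are preserved by
    multiplication by polynomials in it. *)
Lemma fcoef0_poly w (c : R) (F : {poly R}) : cint w -> (forall n, fcoef w n = 0) ->
  forall n, mean (fun z => w z * (en n z * (F.[cos (z - c)])%:C)) = 0.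
Proof.
move=> iw w0.
have cF (G : {poly R}) n : ccont (fun z => en n z * (G.[cos (z - c)])%:C).
  apply: ccontM; first exact: ccont_en.
  apply: ccontC; apply: (rcont_comp (f := fun y => G.[y])).
    exact: continuous_horner.
  by apply: rcont_cos; auto with cont.
have iF G n := cint_bounded (cF G n) iw.
elim/poly_ind: F => [|F a IH] n.
  rewrite (_ : (fun z => _) = fun=> 0); first exact: mean_cst.
  by apply/funext => z; rewrite horner0 !mulr0.
pose F1 (m : int) z := w z * (en m z * (F.[cos (z - c)])%:C).
rewrite (_ : (fun z => _) = (fun z => (2^-1)%:C * expi (- c) * F1 (n + 1) z +
  ((2^-1)%:C * expi c * F1 (n - 1) z + a%:C * (w z * (en n z * (1%:P : {poly R}).[cos (z - c)]%:C))))); last first.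
  apply/funext => z; rewrite /F1 !enD hornerMXaddC hornerC mulr1.
  have E : (cos (z - c))%:C =
      (2^-1)%:C * (expi (- c) * en 1 z + expi c * en (- 1) z).
    rewrite /en mulN1r mul1r -!expiD [- c + z]addrC -[c - z]opprB.
    by apply: complexP; rewrite !ReImE /= ?cosN ?sinN; field.
  by rewrite rmorphD rmorphM /= E; ring.
have i1 := cintZ ((2^-1)%:C * expi (- c)) (iF F (n + 1)).
have i2 := cintZ ((2^-1)%:C * expi c) (iF F (n - 1)).
have i3 := cintZ a%:C (iF 1%:P n).
rewrite (meanD i1 (cintD i2 i3)) (meanD i2 i3).
rewrite (meanZ _ (iF F (n + 1))) (meanZ _ (iF F (n - 1))) (meanZ _ (iF 1%:P n)).
rewrite !IH !mulr0 !add0r.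
rewrite (_ : (fun z => _) = fun z => w z * en (- - n) z).
  by rewrite -[mean _]/(fcoef w (- n)) w0 mulr0.
by apply/funext => z; rewrite opprK hornerC mulr1.
Qed.

(** The polynomials of the usual proof of the Stone-Weierstrass theorem: on the unit
    interval they stay between 0 and 1 and tend to the indicator of
    [x < 1/2], by Bernoulli's inequality. *)
Definition cutoff (j : nat) : {poly R} := (1 - 'X^j) ^+ (2 ^ j).

Lemma cutoffE j x : (cutoff j).[x] = (1 - x ^+ j) ^+ (2 ^ j).
Proof. by rewrite /cutoff horner_exp !hornerE. Qed.

Lemma bernoulli_ge n y : 0 <= y <= 1 -> 1 - n%:R * y <= (1 - y) ^+ n.
Proof.
move=> /andP[y0 y1]; elim: n => [|n IH]; first by rewrite mul0r subr0.
rewrite exprS; apply: (@le_trans _ _ ((1 - y) * (1 - n%:R * y))); last first.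
  by rewrite ler_wpM2l ?subr_ge0.
rewrite -natr1 -subr_ge0.
rewrite (_ : _ - _ = n%:R * y ^+ 2); last by ring.
by rewrite mulr_ge0 ?sqr_ge0.
Qed.

Lemma bernoulli_le n y : 0 <= y <= 1 -> (1 - y) ^+ n * (1 + n%:R * y) <= 1.
Proof.
move=> /andP[y0 y1]; elim: n => [|n IH]; first by rewrite mul0r expr0 addr0 mulr1.
apply: le_trans IH; rewrite exprSr -mulrA ler_wpM2l ?exprn_ge0 ?subr_ge0 //.
rewrite -natr1 -subr_ge0.
rewrite (_ : _ - _ = (n%:R + 1) * y ^+ 2); last by ring.
by rewrite mulr_ge0 ?sqr_ge0 // addr_ge0.
Qed.

Lemma cutoff_itv j x : 0 <= x <= 1 -> 0 <= (cutoff j).[x] <= 1.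
Proof.
move=> /andP[x0 x1]; rewrite cutoffE.
have h1 := exprn_ge0 j x0; have h2 := exprn_ile1 j x0 x1.
by rewrite exprn_ge0 ?subr_ge0 // exprn_ile1 ?subr_ge0 // lerBlDr lerDl.
Qed.

Lemma cutoff_cvg x : 0 <= x <= 1 -> x != 2^-1 ->
  (cutoff j).[x] @[j --> \oo] --> (if x < 2^-1 then 1 else 0 : R).
Proof.
move=> x01 x2; have /andP[x0 x1] := x01.
have yj j : 0 <= x ^+ j <= 1 by rewrite exprn_ge0 // exprn_ile1.
have E j : (2 ^ j)%:R * x ^+ j = (2 * x) ^+ j by rewrite natrX exprMn.
have cvg_e (y : R) : 0 <= y < 1 -> y ^+ j @[j --> \oo] --> (0 : R).
  by move=> /andP[y0 y1]; apply: cvg_expr; rewrite ger0_norm.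
case: ltP => xh.
  have c1 : 1 - (2 * x) ^+ j @[j --> \oo] --> (1 : R).
    rewrite -[X in _ --> X]subr0; apply: cvgB; first exact: cvg_cst.
    by apply: cvg_e; rewrite mulr_ge0 //= mulrC -ltr_pdivlMr // mul1r.
  apply: (squeeze_cvgr _ c1 (cvg_cst (1 : R))); apply: nearW => j.
  have /andP[_ ->] := cutoff_itv j x01; rewrite andbT cutoffE.
  by rewrite -E bernoulli_ge.
have {}xh : 2^-1 < x by rewrite lt_neqAle eq_sym x2.
have x2p : 1 < 2 * x by rewrite mulrC -ltr_pdivrMr // mul1r.
have c1 : ((2 * x)^-1) ^+ j @[j --> \oo] --> (0 : R).
  apply: cvg_e; rewrite invr_ge0 mulr_ge0 //= invf_lt1 //.
  exact: lt_trans x2p.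
apply: (squeeze_cvgr _ (cvg_cst (0 : R)) c1); apply: nearW => j.
have /andP[-> _] := cutoff_itv j x01; rewrite cutoffE /=.
have := bernoulli_le (2 ^ j) (yj j); rewrite E => h.
have p : 0 < (2 * x) ^+ j by apply: exprn_gt0; exact: lt_trans x2p.
rewrite exprVn -[leRHS]mul1r ler_pdivlMr //; apply: le_trans h.
rewrite ler_wpM2l ?lerDr //.
by apply: exprn_ge0; rewrite subr_ge0; have /andP[] := yj j.
Qed.

(** Among the points of the period, those where the cosine of [z - z0] exceeds that of
    [d] form the interval of radius [d] around [z0]. *)
Lemma cos_near z0 d z : 0 < d -> 0 <= z0 - d -> z0 + d <= 2 * pi ->
  0 < z < 2 * pi ->
  ((cos d < cos (z - z0)) = (`|z0 - z| < d)) *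
  ((cos d == cos (z - z0)) = (`|z0 - z| == d)).
Proof.
move=> d0 zd1 zd2 /andP[zp z2p]; set y := `|z0 - z|.
have -> : cos (z - z0) = cos y.
  rewrite /y -[z - z0]opprB cosN; case: (ger0P (z0 - z)) => // _.
  by rewrite cosN.
have dI : d \in `[0, pi] by rewrite in_itv /= ltW //=; lra.
have y0 : 0 <= y by exact: normr_ge0.
have y2 : y < 2 * pi - d by rewrite /y ltr_norml; lra.
have [ypi|ypi] := leP y pi.
  have yI : y \in `[0, pi] by rewrite in_itv /= y0.
  split; first exact: ltr_cos.
  by apply/eqP/eqP => [/(cos_inj dI yI)->|->].
have -> : cos y = cos (2 * pi - y).
  rewrite -[RHS]cosN opprB -[RHS](cosD2pi (y - 2 * pi)); congr cos; ring.
have yI : 2 * pi - y \in `[0, pi] by rewrite in_itv /=; lra.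
have dpi : d <= pi by move: dI; rewrite in_itv => /andP[].
split; first by rewrite ltr_cos //; apply/idP/idP; lra.
rewrite [RHS]gt_eqF ?(le_lt_trans dpi) //; apply/eqP => /(cos_inj dI yI); lra.
Qed.

(** The cut-off polynomials in [cos (z - z0)] converge boundedly to the indicator of
    an interval, so that the integral over it vanishes by dominated
    convergence. *)
Lemma fcoef0_ball w z0 d : cint w -> (forall n, fcoef w n = 0) ->
  0 < d -> 0 <= z0 - d -> z0 + d <= 2 * pi ->
  \int[mu]_(z in ball z0 d) complex.Re (w z) = 0.
Proof.
move=> iw w0 d0 zd1 zd2; set f := fun z => complex.Re (w z).
pose G : {poly R} := (cos d / 4 + 2^-1)%:P - 4^-1 *: 'X.
pose p z : R := 2^-1 + (cos d - cos (z - z0)) / 4.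
pose q j z : R := (cutoff j).[p z].
have p01 z : 0 <= p z <= 1.
  have := cos_le1 d; have := cos_geN1 d; have := cos_le1 (z - z0).
  have := cos_geN1 (z - z0); rewrite /p; lra.
have cq j : rcont (q j).
  apply: (rcont_comp (f := fun y => (cutoff j).[y])); first exact: continuous_horner.
  rewrite /p; apply: rcontD; first exact: rcont_cst.
  apply: rcontM; last exact: rcont_cst.
  by apply: rcontB; [exact: rcont_cst|apply: rcont_cos; auto with cont].
have fint : rint f by case: iw.
have iq j : rint (fun z => f z * q j z).
  have [h _] := cint_bounded (ccontC (cq j)) iw; move: h.
  rewrite (_ : (fun z => complex.Re _) = fun z => f z * q j z) //.
  by apply/funext => z; rewrite cReM /= mulr0 subr0.
have Iq j : \int[mu]_(z in `[0, 2 * pi]) (f z * q j z) = 0.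
  have := fcoef0_poly z0 (cutoff j \Po G) iw w0 0.
  move/(congr1 (@complex.Re R)); rewrite Re_mean /rmean /= => /eqP.
  rewrite mulf_eq0 invr_eq0 gt_eqF ?pi2_gt0 //= => /eqP E; rewrite -[RHS]E.
  apply: eq_Rintegral => z _; rewrite en0 mul1r cReM /= mulr0 subr0.
  rewrite horner_comp; congr (f z * (cutoff j).[_]).
  by rewrite /p /G !hornerE; ring.
have c1 : \int[mu]_(z in `[0, 2 * pi]) (f z * q j z) @[j --> \oo] -->
    \int[mu]_(z in `[0, 2 * pi]) (f \_ (ball z0 d)) z.
  have mB : measurable (ball z0 d) by exact: measurable_ball.
  apply: (Rintegral_cvg (g := fun z => `|f z|)) => //.
  - rewrite -restrict_EFin; apply: (iffLR (@integrable_restrict _ (measurableTypeR R) R mu (ball z0 d) mB `[0, 2 * pi]%classic _ (EFin \o f))) => //.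
    by apply: integrableS fint => //; exact: measurableI.
  - exact: (integrable_norm fint).
  - have : mu.-negligible [set z0 - d; z0 + d; 0; 2 * pi].
      apply/negligibleP.
        by do 3?apply: measurableU; exact: measurable_set1.
      apply: countable_lebesgue_measure0.
      exact/finite_set_countable.
    apply: negligibleS => z /= /not_implyP[/andP[zp z2p] hz].
    have [->|z0N] := eqVneq z 0; first by left; right.
    have [->|z2N] := eqVneq z (2 * pi); first by right.
    have zI : 0 < z < 2 * pi by rewrite !lt_neqAle eq_sym z0N zp z2N.
    have [c1 c2] := cos_near d0 zd1 zd2 zI.
    have [yd|yd] := eqVneq `|z0 - z| d.
      left; left; move: yd; case: (ger0P (z0 - z)) => _ h; [left|right]; lra.
    exfalso; apply: hz.
    have -> : (f \_ (ball z0 d)) z = f z * (if p z < 2^-1 then 1 else 0).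
      rewrite patchE (_ : (z \in (ball z0 d : set R)) = (p z < 2^-1)).
        by case: ifP => _; rewrite ?mulr1 ?mulr0.
      apply/idP/idP; rewrite inE /ball /= -c1 /p; lra.
    apply: cvgM; first exact: cvg_cst.
    apply: cutoff_cvg => //; apply: contraNneq yd => pz.
    rewrite -c2; apply/eqP; move: pz; rewrite /p; lra.
  - move=> j z _; rewrite normrM ler_piMr //.
    by have /andP[h0 h1] := cutoff_itv j (p01 z); rewrite ger0_norm.
have c2 : \int[mu]_(z in `[0, 2 * pi]) (f z * q j z) @[j --> \oo] --> (0 : R).
  by under eq_cvg do rewrite Iq; exact: cvg_cst.
have := cvg_unique _ c1 c2; rewrite -Rintegral_mkcondr => <- //.
rewrite setIidr // ball_itv; apply: subset_itv; rewrite bnd_simp; lra.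
Qed.

End Uniqueness.

Section Recover.
Context {R : realType}.
Local Notation mu := (@lebesgue_measure R).
Implicit Types (f : R -> R) (u w S : R -> R[i]) (c : int -> R[i]) (x y z d r : R).

Definition clint u := lint (fun x => complex.Re (u x)) /\
  lint (fun x => complex.Im (u x)).

Lemma clint_cint u : clint u -> cint u.
Proof. by case=> h1 h2; split; exact: lint_rint. Qed.

Lemma lebesgue_pt_eq0 f x : lint f -> lebesgue_pt f x ->
  (\forall r \near 0^'+, \int[mu]_(z in ball x r) f z = 0) -> f x = 0.
Proof.
move=> lf fx f0; have ld : lint (fun y => f y - f x).
  by apply: lintB => //; apply: lint_cont; exact: rcont_cst.
have h : fine (davg f x r) @[r --> 0^'+] --> (0 : R) by exact: (fine_cvg fx).
apply/eqP; rewrite -normr_eq0; apply/eqP/le_anti; rewrite normr_ge0 andbT.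
apply: (cvgr_to_ge h).
near=> r; have r0 : 0 < r by near: r; exact: nbhs_right_gt.
rewrite davgE //= mulrC ler_pdivlMr ?mulrn_wgt0 //.
have mB : measurable (ball x r) by exact: measurable_ball.
have iB g : lint g -> mu.-integrable (ball x r) (EFin \o g).
  move=> [_ gi]; apply: integrableS (gi (x - r) (x + r)) => //.
  by rewrite ball_itv; apply: subset_itv; rewrite bnd_simp.
apply: (le_trans _ (le_normr_Rintegral _ (iB _ ld))); last exact: measurable_ball.
rewrite RintegralB //; [|exact: iB|].
  have -> : \int[mu]_(z in ball x r) f z = 0 by near: r.
  have mE : fine (mu (ball x r)) = r *+ 2 by rewrite lebesgue_measure_ball ?ltW.
  rewrite sub0r normrN Rintegral_cst // normrM ler_wpM2l //.
  rewrite -mE; exact: ler_norm.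
by apply: iB; apply: lint_cont; exact: rcont_cst.
Unshelve. all: by end_near.
Qed.

Lemma fcoef0_Re_ae w : clint w -> (forall n, fcoef w n = 0) ->
  {ae mu, forall z, 0 < z < 2 * pi -> complex.Re (w z) = 0}.
Proof.
move=> lw w0; have := lebesgue_differentiation (lint_locally lw.1).
apply: (@filterS _ _ (ae_filter_ringOfSetsType mu)) => z Lz /andP[z0 z2].
apply: (@lebesgue_pt_eq0 (fun z => complex.Re (w z))) => //; first by case: lw.
near=> r; apply: fcoef0_ball => //.
- exact: clint_cint.
- by rewrite subr_ge0; near: r; apply: nbhs_right_le.
- rewrite addrC -lerBrDr; near: r; apply: nbhs_right_le; lra.
Unshelve. all: by end_near.
Qed.

Lemma clintZ a u : clint u -> clint (fun x => a * u x).
Proof.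
move=> [h1 h2]; split.
  under eq_fun do rewrite cReM; apply: lintB; exact: lintZ.
by under eq_fun do rewrite cImM; apply: lintD; exact: lintZ.
Qed.

Lemma clintB u w : clint u -> clint w -> clint (fun x => u x - w x).
Proof.
move=> [h1 h2] [k1 k2]; split.
  by under eq_fun do rewrite cReD cReN; apply: lintB.
by under eq_fun do rewrite cImD cImN; apply: lintB.
Qed.

(** All the integrals over intervals vanish, so that the function vanishes at its
    Lebesgue points. *)
Lemma fcoef0_ae w : clint w -> (forall n, fcoef w n = 0) ->
  {ae mu, forall z, 0 < z < 2 * pi -> w z = 0}.
Proof.
move=> lw w0; have h1 := fcoef0_Re_ae lw w0.
have w0' n : fcoef (fun z => (0 -i* 1) * w z) n = 0.
  by rewrite fcoefZ ?w0 ?mulr0 //; exact: clint_cint.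
have h2 := fcoef0_Re_ae (clintZ (0 -i* 1) lw) w0'.
move: h1 h2; apply: (@filterS2 _ _ (ae_filter_ringOfSetsType mu)) => z h1 h2 zI.
apply: complexP; first exact: h1.
by have := h2 zI; rewrite cReM /= mul0r sub0r mulN1r opprK.
Qed.

Lemma tpB_trunc N M c z : (N <= M)%N ->
  tp M c z - tp N c z = tp M (fun n => c n - trunc N c n) z.
Proof. by move=> NM; rewrite tpB tp_trunc. Qed.

(** The Sobolev embedding turns the tails of the norm of H^1 into uniform bounds. *)
Lemma tp_limit c (B : R) : (forall N, hn N c <= B) ->
  exists S, forall eps : R, 0 < eps ->
    \forall N \near \oo, forall z, nsq (tp N c z - S z) <= eps.
Proof.
move=> cB.
have C (eps : R) : 0 < eps -> \forall N \near \oo, forall M z, (N <= M)%N ->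
    nsq (tp M c z - tp N c z) <= eps.
  move=> e0; have e5 : 0 < eps / 5 by rewrite divr_gt0.
  have := hn_tail_small cB e5; apply: filterS => N h M z NM.
  rewrite tpB_trunc //; apply: le_trans (nsq_tp_le _ _ _) _.
  by rewrite mulrC -ler_pdivlMr // h.
have key z (g : R[i] -> R) : (forall a b, g a - g b = g (a - b)) ->
    (forall a, g a ^+ 2 <= nsq a) -> cvgn (fun N => g (tp N c z)).
  move=> gB gn; apply/cauchy_cvgP/cauchy_exP => e e0.
  have [N _ /(_ N (leqnn N)) hN] := C _ (exprn_gt0 2 (divr_gt0 e0 (ltr0n _ 2))).
  exists (g (tp N c z)); exists N => // M /= NM.
  rewrite /ball /= distrC gB.
  apply: (@le_lt_trans _ _ (e / 2)); last by lra.
  have e2 : 0 <= e / 2 by lra.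
  rewrite -[leRHS](ger0_norm e2) -ler_sqr ?nnegrE ?normr_ge0 //.
  rewrite !real_normK ?num_real //.
  by apply: le_trans (gn _) _; exact: hN.
have cR z : cvgn (fun N => complex.Re (tp N c z)).
  apply: key => [a b|a]; first by rewrite cReD cReN.
  by rewrite /nsq lerDl sqr_ge0.
have cI z : cvgn (fun N => complex.Im (tp N c z)).
  apply: key => [a b|a]; first by rewrite cImD cImN.
  by rewrite /nsq lerDr sqr_ge0.
exists (fun z => limn (fun N => complex.Re (tp N c z)) +i*
  limn (fun N => complex.Im (tp N c z))) => eps e0.
have := C _ e0; apply: filterS => N h z.
have cS : ccvg (fun M => tp M c z) (limn (fun N => complex.Re (tp N c z)) +i*
    limn (fun N => complex.Im (tp N c z))) by split; [exact: cR|exact: cI].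
rewrite -nsqN opprB.
have H := ccvg_nsqB cS (d := tp N c z); refine (cvgr_to_le H _).
by exists N => // M /= NM; exact: h.
Qed.

Lemma limit_ccont c S :
  (forall eps : R, 0 < eps -> \forall N \near \oo, forall z, nsq (tp N c z - S z) <= eps) ->
  ccont S.
Proof.
have key (g : R[i] -> R) (T : R -> R) : (forall N, rcont (fun z => g (tp N c z))) ->
    (forall e : R, 0 < e -> \forall N \near \oo, forall z,
      `|g (tp N c z) - T z| <= e) -> rcont T.
  move=> cg h x; apply/cvgrPdist_le => e e0.
  have e3 : 0 < e / 3 by rewrite divr_gt0.
  have [N _ /(_ N (leqnn N)) hN] := h _ e3.
  have := cg N x; move=> /cvgrPdist_le /(_ _ e3); apply: filterS => y hy.
  have h1 := hN x; have h2 := hN y; move: hy h1 h2; rewrite !ler_norml; lra.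
move=> hS; split.
  apply: (key (@complex.Re R)) => [N|e e0]; first by case: (ccont_tp N c).
  have := hS _ (exprn_gt0 2 e0); apply: filterS => N h z.
  rewrite -cReN -cReD -[leRHS](ger0_norm (ltW e0)) -ler_sqr ?nnegrE ?normr_ge0 //.
  rewrite !real_normK ?num_real //; apply: le_trans (h z).
  by rewrite /nsq lerDl sqr_ge0.
apply: (key (@complex.Im R)) => [N|e e0]; first by case: (ccont_tp N c).
have := hS _ (exprn_gt0 2 e0); apply: filterS => N h z.
rewrite -cImN -cImD -[leRHS](ger0_norm (ltW e0)) -ler_sqr ?nnegrE ?normr_ge0 //.
rewrite !real_normK ?num_real //; apply: le_trans (h z).
by rewrite /nsq lerDr sqr_ge0.
Qed.

Lemma nsq_fcoef_le u n : cint u -> rint (fun t => nsq (u t)) ->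
  nsq (fcoef u n) <= rmean (fun t => nsq (u t)).
Proof.
move=> iu iu2; apply: le_trans (bessel `|n|%N iu iu2).
rewrite /l2n (bigD1_seq n) ?uniq_modes ?mem_modes //= lerDl.
by apply: sumr_ge0 => m _; exact: nsq_ge0.
Qed.

End Recover.

(** * Weak derivatives of periodic functions *)

Section Sobolev.
Context {R : realType}.
Local Notation mu := (@lebesgue_measure R).
Implicit Types (f g h psi : R -> R) (u v w : R -> R[i]) (c : int -> R[i]).
Implicit Types (x y z a b : R).

(** The componentwise form of [L2loc], in terms of integrability on segments. *)
Definition l2loc u := [/\ lint (fun x => complex.Re (u x)),
  lint (fun x => complex.Im (u x)) & lint (fun x => nsq (u x))].

Lemma measurable_nsq u : cmeasurable u ->
  measurable_fun [set: R] (fun x => nsq (u x)).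
Proof.
by move=> [m1 m2]; apply: measurable_funD; apply: measurable_funX.
Qed.

Lemma L2locP u : L2loc u <-> l2loc u.
Proof.
split=> [[[m1 m2] hK]|[l1 l2 l3]].
  have l3 : lint (fun x => nsq (u x)).
    split; first exact: measurable_nsq.
    move=> a b; apply/integrableP; split.
      by apply/measurable_EFinP; apply: measurable_funTS; exact: measurable_nsq.
    apply: le_lt_trans (hK `[a, b]%classic _); last exact: segment_compact.
    by rewrite le_eqVlt; apply/orP; left; apply/eqP; apply: eq_integral => x _;
      rewrite /= ger0_norm ?nsq_ge0 // normc_nsq.
  have key (g : R[i] -> R) : measurable_fun [set: R] (fun x => g (u x)) ->
      (forall z : R[i], g z ^+ 2 <= nsq z) -> lint (fun x => g (u x)).
    move=> mg gn; split => // a b.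
    have l4 := lintD (lint_cont (@rcont_cst R 1)) l3.
    apply: le_integrable (l4.2 a b) => //.
      by apply/measurable_EFinP; exact: measurable_funTS.
    move=> x _ /=; rewrite lee_fin [leRHS](ger0_norm (addr_ge0 ler01 (nsq_ge0 _))).
    apply: (@le_trans _ _ (1 + g (u x) ^+ 2)); last by rewrite lerD2l.
    rewrite -[X in _ + X]real_normK ?num_real //.
    have := sqr_ge0 (`|g (u x)| - 2^-1); have := normr_ge0 (g (u x)).
    by move: `|_| => y; nra.
  split; last exact: l3.
    by apply: (key _ m1) => z; rewrite /nsq lerDl sqr_ge0.
  by apply: (key _ m2) => z; rewrite /nsq lerDr sqr_ge0.
split; first by split; [case: l1|case: l2].
move=> K cK; have [_ _ /(_ K)] := lint_locally l3.
move=> /(_ (@subsetT _ _) cK); apply: le_lt_trans.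
by rewrite le_eqVlt; apply/orP; left; apply/eqP; apply: eq_integral => x _;
  rewrite /= ger0_norm ?nsq_ge0 // normc_nsq.
Qed.

Lemma l2loc_clint u : l2loc u -> clint u. Proof. by case. Qed.

(** The real form of the weak derivative, with the support in an explicit
    interval. *)
Definition rweak f g := forall psi a b, smooth psi -> supp_in a b psi ->
  \int[mu]_x (f x * derive1 psi x) = - \int[mu]_x (g x * psi x).

Lemma weak_rweakP u v : weak_derivative u v <->
  rweak (fun x => complex.Re (u x)) (fun x => complex.Re (v x)) /\
  rweak (fun x => complex.Im (u x)) (fun x => complex.Im (v x)).
Proof.
have E1 (w : R -> R[i]) (q : R -> R) x :
  complex.Re (w x * (q x)%:C) = complex.Re (w x) * q x.
  by rewrite cReM /= mulr0 subr0.
have E2 (w : R -> R[i]) (q : R -> R) x :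
  complex.Im (w x * (q x)%:C) = complex.Im (w x) * q x.
  by rewrite cImM /= mulr0 add0r.
split=> [h|[h1 h2] psi tp].
  split=> psi a b sp ab; have := h _ (smooth_test sp ab); rewrite /cintegral.
    move=> /(congr1 (@complex.Re R)) /=.
    under eq_Rintegral do rewrite E1.
    by under [in X in _ = - X]eq_Rintegral do rewrite E1.
  move=> /(congr1 (@complex.Im R)) /=.
  under eq_Rintegral do rewrite E2.
  by under [in X in _ = - X]eq_Rintegral do rewrite E2.
have [a [b ab]] := test_supp tp; have sp := test_smooth tp.
apply: complexP; rewrite /cintegral /=.
  under eq_Rintegral do rewrite E1; rewrite (h1 _ a b sp ab).
  by under [in RHS]eq_Rintegral do rewrite E1.
under eq_Rintegral do rewrite E2; rewrite (h2 _ a b sp ab).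
by under [in RHS]eq_Rintegral do rewrite E2.
Qed.

Lemma lint_itv f a b (bu bv : bool) : lint f ->
  mu.-integrable [set` Interval (BSide bu a) (BSide bv b)] (EFin \o f).
Proof.
move=> [_ fi]; apply: integrableS (fi a b) => //.
by apply: subset_itv; rewrite bnd_simp; case: bu; case: bv.
Qed.

Lemma Rintegral_two_periods f : lint f ->
  \int[mu]_(x in `[0, 2 * pi + 2 * pi]) f x =
  \int[mu]_(x in `[0, 2 * pi]) f x + \int[mu]_(x in `[0, 2 * pi]) f (x + 2 * pi).
Proof.
move=> lf; have p0 : (0 : R) <= 2 * pi by exact/ltW/pi2_gt0.
have := @Rintegral_itvB _ f (BLeft 0) (BRight (2 * pi + 2 * pi)) (2 * pi)
  (lint_itv _ _ _ _ lf).
rewrite !bnd_simp => /(_ p0) H; have {}H := H _.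
rewrite -[X in _ = _ + X]Rintegral_itv_obnd_cbnd; last first.
  exact: (lint_itv _ _ _ _ (lint_shift (2 * pi) lf)).
rewrite Rintegral_shift // add0r -H ?lerDl //; ring.
Qed.

Lemma pi2_ge1 : (1 : R) <= 2 * pi.
Proof. by have := pi_ge2 R; lra. Qed.

(** The translates by the period of the cut-off [s x - s (x - 2 * pi)] add up to the
    constant [cs]. With a step for [s], this turns integrals over the line into
    integrals over a period; with a derivative of the step, it makes them
    vanish. *)
Lemma unroll h s (cs : R) : lint h -> (forall x, h (x + 2 * pi) = h x) ->
  rcont s -> (forall x, x <= 0 -> s x = 0) -> (forall x, 1 <= x -> s x = cs) ->
  \int[mu]_x (h x * (s x - s (x - 2 * pi))) = cs * \int[mu]_(x in `[0, 2 * pi]) h x.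
Proof.
move=> lh per cts s0 s1; have p1 := pi2_ge1.
have ct : rcont (fun x => s x - s (x - 2 * pi)).
  by apply: rcontB => //; apply: rcont_comp => //; auto with cont.
rewrite (@Rintegral_supp _ _ 0 (2 * pi + 2 * pi)); last first.
  move=> x; rewrite negb_and -!ltNge => /orP[x0|x4].
    by rewrite !s0 ?subrr ?mulr0 //; lra.
  by rewrite !s1 ?subrr ?mulr0 //; lra.
rewrite Rintegral_two_periods; last exact: lintM.
have E1 : \int[mu]_(x in `[0, 2 * pi]) (h x * (s x - s (x - 2 * pi))) =
    \int[mu]_(x in `[0, 2 * pi]) (h x * s x).
  apply: eq_Rintegral => x; rewrite inE /= in_itv /= => /andP[_ x2].
  by rewrite [s (x - _)]s0 ?subr0 //; lra.
have E2 : \int[mu]_(x in `[0, 2 * pi])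
      (h (x + 2 * pi) * (s (x + 2 * pi) - s (x + 2 * pi - 2 * pi))) =
    \int[mu]_(x in `[0, 2 * pi]) (cs * h x - h x * s x).
  apply: eq_Rintegral => x; rewrite inE /= in_itv /= => /andP[x0 _].
  by rewrite per addrK [s (x + _)]s1; [ring|lra].
rewrite E1 E2 RintegralB //; [|exact: (lintZ _ lh).2|exact: (lintM lh cts).2].
by rewrite RintegralZl //; [ring|exact: lh.2].
Qed.

Definition cut (j : nat) x : R := step (j.+1%:R * x).

Lemma smooth_cut j : smooth (cut j).
Proof.
rewrite (_ : cut j = fun x => step (j.+1%:R * x + 0)).
  exact/smooth_aff/smooth_step.
by apply/funext => x; rewrite addr0.
Qed.

Lemma is_derive_cut j x : is_derive x 1 (cut j) (ker j 0 x).
Proof.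
have := is_derive_aff (a := j.+1%:R) (b := 0) (f := step) (x := x).
move=> /(_ _ (is_derive_step _)) H; rewrite /ker subr0.
rewrite -[X in mollifier X]addr0.
by apply: is_derive_fun H => // y; rewrite addr0.
Qed.

Lemma smooth_ker0 j : smooth (ker j (0 : R)).
Proof.
rewrite (_ : ker j 0 = fun x => j.+1%:R * mollifier (j.+1%:R * x + 0)).
  exact/smoothZ/smooth_aff/smooth_mollifier.
by apply/funext => x; rewrite /ker subr0 addr0.
Qed.

Lemma cut_le0 j x : x <= 0 -> cut j x = 0.
Proof. by move=> x0; rewrite /cut step_le0 // mulr_ge0_le0. Qed.

Lemma cut_ge j x : j.+1%:R^-1 <= x -> cut j x = 1.
Proof.
by move=> x1; rewrite /cut step_ge1 // mulrC -ler_pdivrMr // div1r.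
Qed.

Lemma ker0_le0 j x : x <= 0 -> ker j 0 x = 0.
Proof.
by move=> x0; rewrite /ker subr0 mollifier_le0 ?mulr0 // mulr_ge0_le0.
Qed.

Lemma ker0_ge j x : j.+1%:R^-1 <= x -> ker j 0 x = 0.
Proof.
move=> x1; rewrite /ker subr0 mollifier_ge1 ?mulr0 //.
by rewrite mulrC -ler_pdivrMr // div1r.
Qed.

Lemma cut_ge1 j x : 1 <= x -> cut j x = 1.
Proof.
by move=> x1; apply: cut_ge; apply: le_trans x1; rewrite invf_le1 // ler1n.
Qed.

Lemma ker0_ge1 j x : 1 <= x -> ker j 0 x = 0.
Proof.
by move=> x1; apply: ker0_ge; apply: le_trans x1; rewrite invf_le1 // ler1n.
Qed.

Lemma cut_cvg x : cut j x @[j --> \oo] --> (if 0 < x then 1 else 0 : R).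
Proof.
case: ltP => x0; last first.
  by under eq_cvg do rewrite cut_le0 //; exact: cvg_cst.
apply: cvg_near_cst; near=> j; apply: cut_ge.
rewrite invf_ple ?posrE //; apply: (@le_trans _ _ j%:R).
  by near: j; exact: nbhs_infty_ger.
by rewrite ler_nat.
Unshelve. all: by end_near.
Qed.

(** Its translates by the period form a partition of unity; for large [j] it is
    close to the indicator of one period. *)
Definition window j x := cut j x - cut j (x - 2 * pi).

Lemma smooth_window j : smooth (window j).
Proof.
apply: smoothB; first exact: smooth_cut.
rewrite (_ : (fun x => _) = fun x => cut j (1 * x + - (2 * pi))).
  exact/smooth_aff/smooth_cut.
by apply/funext => x; rewrite mul1r.
Qed.

Lemma window_supp j : supp_in 0 (2 * pi + 2 * pi) (window j).
Proof.
have := pi2_ge1 => p1 x; rewrite /window negb_and -!ltNge => /orP[x0|x4].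
  by rewrite !cut_le0 ?subrr //; lra.
by rewrite !cut_ge1 ?subrr //; lra.
Qed.

Lemma derive1_window j : derive1 (window j) =
  fun x => ker j 0 x - ker j 0 (x - 2 * pi).
Proof.
apply: derive1_eq => x.
have := is_derive_aff (a := 1) (b := - (2 * pi)) (f := cut j) (x := x).
rewrite mul1r => /(_ _ (is_derive_cut _ _)) H.
have H' : is_derive x 1 (fun y => cut j (y - 2 * pi)) (ker j 0 (x - 2 * pi)).
  by apply: (is_derive_fun _ _ H) => [y|]; rewrite mul1r.
exact: (is_deriveBfun (is_derive_cut j x) H').
Qed.

Lemma sharp_cvg h : lint h ->
  \int[mu]_x (h x * window j x) @[j --> \oo] --> \int[mu]_(x in `[0, 2 * pi]) h x.
Proof.
move=> lh; have p0 := @pi2_gt0 R.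
have cw j : rcont (window j) by exact/smooth_cont/smooth_window.
have E j : \int[mu]_x (h x * window j x) =
    \int[mu]_(x in `[0, 2 * pi + 2 * pi]) (h x * window j x).
  by apply: Rintegral_supp => x xs; rewrite window_supp ?mulr0.
under eq_cvg do rewrite E.
pose h1 := h \_ (`]0, 2 * pi]%classic : set R).
have S : (`]0, 2 * pi] : set R) `<=` `[0, 2 * pi + 2 * pi].
  by apply: subset_itv; rewrite bnd_simp //; lra.
have -> : \int[mu]_(x in `[0, 2 * pi]) h x =
    \int[mu]_(x in `[0, 2 * pi + 2 * pi]) h1 x.
  rewrite -Rintegral_mkcondr setIidr //.
  by rewrite Rintegral_itv_obnd_cbnd //; exact: lint_itv.
apply: (Rintegral_cvg (g := fun x => `|h x|)).
- by move=> j; exact: (lintM lh (cw j)).2.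
- rewrite -restrict_EFin.
  apply: (iffLR (@integrable_restrict _ (measurableTypeR R) R mu
    (`]0, 2 * pi]%classic : set R) _ `[0, 2 * pi + 2 * pi]%classic _ (EFin \o h))) => //.
  by rewrite setIidr //; exact: lint_itv.
- exact: (lint_norm lh).2.
- apply: aeW => x /andP[x0 x4].
  have -> : h1 x = h x * ((if 0 < x then 1 else 0) - (if 0 < x - 2 * pi then 1 else 0)).
    rewrite /h1 patchE mem_setE in_itv /= subr_gt0.
    by case: (ltP 0 x) => x0'; case: (ltP (2 * pi) x) => x2 /=;
      rewrite ?subrr ?subr0 ?mulr1 ?mulr0 //; lra.
  by apply: cvgM; [exact: cvg_cst|apply: cvgB; exact: cut_cvg].
- move=> j x _; rewrite normrM ler_piMr // ler_norml /window.
  have := step_ge0 (j.+1%:R * x); have := step_le1 (j.+1%:R * x).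
  have := step_ge0 (j.+1%:R * (x - 2 * pi)).
  have := step_le1 (j.+1%:R * (x - 2 * pi)); rewrite /cut; lra.
Qed.

(** The test function [psi] is periodic, hence it has to be cut off; the derivative
    of the window does not contribute, by [unroll]. Letting the window become
    sharp avoids the proof that the weak derivative [g] is itself periodic. *)
Lemma weak_rmean f g psi : lint f -> lint g -> rweak f g ->
  (forall x, f (x + 2 * pi) = f x) -> smooth psi ->
  (forall x, psi (x + 2 * pi) = psi x) ->
  rmean (fun x => g x * psi x) = - rmean (fun x => f x * derive1 psi x).
Proof.
move=> lf lg w per sp pper; rewrite /rmean -mulrN; congr (_ * _).
have cp := smooth_cont sp; have cdp := smooth_cont (smooth_derive1 sp).
have E j : \int[mu]_x ((f x * derive1 psi x) * window j x) =
    - \int[mu]_x ((g x * psi x) * window j x).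
  have sw := smoothM sp (@smooth_window j).
  have pw : supp_in 0 (2 * pi + 2 * pi) (fun x => psi x * window j x).
    by move=> x xs; rewrite window_supp ?mulr0.
  have cw := smooth_cont (smooth_window j).
  have cdw := smooth_cont (smooth_derive1 (smooth_window j)).
  have D : derive1 (fun x => psi x * window j x) =
      fun x => derive1 psi x * window j x + psi x * derive1 (window j) x.
    apply: derive1_eq => x.
    exact: (is_deriveMfun (smooth_is_derive x sp)
      (smooth_is_derive x (@smooth_window j))).
  have := w _ _ _ sw pw; rewrite D => h.
  have -> : \int[mu]_x ((g x * psi x) * window j x) =
      \int[mu]_x (g x * (psi x * window j x)).
    by apply: eq_Rintegral => x _; rewrite mulrA.
  rewrite -h; have U := unroll (lintM lf cp) _ (smooth_cont (smooth_ker0 j))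
    (@ker0_le0 j) (@ker0_ge1 j).
  rewrite mul0r in U.
  rewrite -[LHS]addr0 -[X in _ + X]U => [|x]; last by rewrite per pper.
  rewrite (@Rintegral_supp _ (fun x => f x * derive1 psi x * window j x) 0 (2 * pi + 2 * pi)); last first.
    by move=> x xs; rewrite window_supp ?mulr0.
  rewrite (@Rintegral_supp _ (fun x => f x * psi x * _) 0 (2 * pi + 2 * pi)); last first.
    move=> x xs; have := supp_derive1 (@window_supp j) xs.
    by rewrite derive1_window => ->; rewrite mulr0.
  rewrite [RHS](@Rintegral_supp _ _ 0 (2 * pi + 2 * pi)); last first.
    move=> x xs; rewrite window_supp // (supp_derive1 (@window_supp j)) //.
    by rewrite !mulr0 addr0 mulr0.
  rewrite -RintegralD //.
  - by apply: eq_Rintegral => x _; rewrite derive1_window /=; ring.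
  - exact: (lintM (lintM lf cdp) cw).2.
  - have := (lintM (lintM lf cp) cdw).2 0 (2 * pi + 2 * pi).
    by rewrite derive1_window.
have c1 := sharp_cvg (lintM lf cdp).
have c2 : (- (\int[mu]_x ((f x * derive1 psi x) * window j x))) @[j --> \oo] -->
    \int[mu]_(x in `[0, 2 * pi]) (g x * psi x).
  by under eq_cvg do rewrite E opprK; exact: sharp_cvg (lintM lg cp).
exact: cvg_unique c2 (cvgN c1).
Qed.

(** The analogue of [fcoef_derive] for weak derivatives. *)
Lemma fcoef_weak u v n : clint u -> clint v ->
  rweak (fun x => complex.Re (u x)) (fun x => complex.Re (v x)) ->
  rweak (fun x => complex.Im (u x)) (fun x => complex.Im (v x)) ->
  (forall x, u (x + 2 * pi) = u x) ->
  fcoef v n = (0 +i* n%:~R) * fcoef u n.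
Proof.
move=> lu lv w1 w2 per.
pose C z : R := cos (n%:~R * z); pose S z : R := sin (n%:~R * z).
have cC : rcont C by apply: rcont_cos; auto with cont.
have cS : rcont S by apply: rcont_sin; auto with cont.
have sC : smooth C.
  rewrite (_ : C = fun z => cos (n%:~R * z + 0)); last first.
    by apply/funext => z; rewrite addr0.
  exact/smooth_aff/smooth_cos.
have sS : smooth S.
  rewrite (_ : S = fun z => sin (n%:~R * z + 0)); last first.
    by apply/funext => z; rewrite addr0.
  exact/smooth_aff/smooth_sin.
have E z : en (- n) z = C z -i* S z.
  by rewrite /en mulrNz mulNr expiN.
have per_en z : en (- n) (z + 2 * pi) = en (- n) z by exact: en_periodic.
have Cper z : C (z + 2 * pi) = C z.
  by have := congr1 (@complex.Re R) (per_en z); rewrite !E.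
have Sper z : S (z + 2 * pi) = S z.
  by have := congr1 (@complex.Im R) (per_en z); rewrite !E => /oppr_inj.
have dC : derive1 C = fun z => - n%:~R * S z.
  apply: derive1_eq => z; apply: (is_derive_fun _ _
    (is_derive_comp (is_derive_cos _) (is_derive_lin n%:~R z))) => //.
  by rewrite /S; ring.
have dS : derive1 S = fun z => n%:~R * C z.
  apply: derive1_eq => z; apply: (is_derive_fun _ _
    (is_derive_comp (is_derive_sin _) (is_derive_lin n%:~R z))) => //.
have r q T : lint q -> rcont T -> rint (fun z => q z * T z).
  by move=> lq cT; exact/lint_rint/lintM.
have F w : clint w -> fcoef w n =
    (rmean (fun z => complex.Re (w z) * C z) + rmean (fun z => complex.Im (w z) * S z))
    +i* (rmean (fun z => complex.Im (w z) * C z) - rmean (fun z => complex.Re (w z) * S z)).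
  move=> [l1 l2]; apply: complexP; rewrite /fcoef ?Re_mean ?Im_mean /=.
    rewrite -(rmeanD (r _ _ l1 cC) (r _ _ l2 cS)); congr rmean; apply/funext => z.
    by rewrite E cReM /=; ring.
  rewrite -(rmeanB (r _ _ l2 cC) (r _ _ l1 cS)); congr rmean; apply/funext => z.
  by rewrite E cImM /=; ring.
have pR z : complex.Re (u (z + 2 * pi)) = complex.Re (u z) by rewrite per.
have pI z : complex.Im (u (z + 2 * pi)) = complex.Im (u z) by rewrite per.
have M q T : lint q -> rcont T -> rmean (fun z => q z * (n%:~R * T z)) =
    n%:~R * rmean (fun z => q z * T z).
  move=> lq cT; rewrite -rmeanZ; last exact: r.
  by congr rmean; apply/funext => z; ring.
have M' q T : lint q -> rcont T -> rmean (fun z => q z * (- n%:~R * T z)) =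
    - (n%:~R * rmean (fun z => q z * T z)).
  move=> lq cT; rewrite -rmeanZ; last exact: r.
  rewrite -rmeanN; last exact/rintZ/r.
  by congr rmean; apply/funext => z; ring.
have [u1 u2] := lu; have [v1 v2] := lv.
rewrite (F v lv) (F u lu) (weak_rmean u1 v1 w1 pR sC Cper).
rewrite (weak_rmean u2 v2 w2 pI sS Sper) (weak_rmean u2 v2 w2 pI sC Cper).
rewrite (weak_rmean u1 v1 w1 pR sS Sper) dC dS.
rewrite !M' // !M //.
by apply: complexP; rewrite !ReImE /=; ring.
Qed.

End Sobolev.

(** * The space H^1 of the circle *)

Section SobolevPairs.
Context {R : realType}.
Local Notation mu := (@lebesgue_measure R).
Implicit Types (f g h psi : R -> R) (u v w : R -> R[i]) (c : int -> R[i]).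
Implicit Types (x y z a b : R).

Lemma Rintegral_test_lin f g psi (al be : R) a b : lint f -> lint g ->
  rcont psi -> supp_in a b psi ->
  \int[mu]_x ((al * f x + be * g x) * psi x) =
  al * \int[mu]_x (f x * psi x) + be * \int[mu]_x (g x * psi x).
Proof.
move=> lf lg cp sp; have l1 := lintM lf cp; have l2 := lintM lg cp.
have S h : \int[mu]_x (h x * psi x) = \int[mu]_(x in `[a, b]) (h x * psi x).
  by apply: Rintegral_supp => x xs; rewrite sp ?mulr0.
rewrite !S -!RintegralZl //; [|exact: l2.2|exact: l1.2].
rewrite -RintegralD //; [|exact: (lintZ _ l1).2|exact: (lintZ _ l2).2].
by apply: eq_Rintegral => x _; ring.
Qed.

Lemma rweak_lin f1 g1 f2 g2 (al be : R) :
  lint f1 -> lint g1 -> lint f2 -> lint g2 -> rweak f1 g1 -> rweak f2 g2 ->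
  rweak (fun x => al * f1 x + be * f2 x) (fun x => al * g1 x + be * g2 x).
Proof.
move=> lf1 lg1 lf2 lg2 w1 w2 psi a b sp ab.
rewrite (Rintegral_test_lin _ _ lf1 lf2 (smooth_cont (smooth_derive1 sp))
  (supp_derive1 ab)).
rewrite (Rintegral_test_lin _ _ lg1 lg2 (smooth_cont sp) ab).
by rewrite (w1 _ _ _ sp ab) (w2 _ _ _ sp ab); ring.
Qed.

Lemma Rintegral_translate h a b y : lint h -> supp_in a b h ->
  \int[mu]_x h (x + y) = \int[mu]_x h x.
Proof.
move=> lh sh; rewrite (Rintegral_supp sh).
rewrite (@Rintegral_supp _ _ (a - y) (b - y)) => [|x xs].
  by rewrite Rintegral_shift // !subrK.
by apply: sh; apply: contra xs; lra.
Qed.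

Lemma rweak_shift f g y : lint f -> lint g -> rweak f g ->
  rweak (fun x => f (x + y)) (fun x => g (x + y)).
Proof.
move=> lf lg w psi a b sp ab.
pose phi x := psi (1 * x + - y).
have sphi : smooth phi by exact: smooth_aff.
have dphi : derive1 phi = fun x => derive1 psi (1 * x + - y).
  apply: derive1_eq => x; have H := smooth_is_derive (1 * x + - y) sp.
  by have := is_derive_aff H; rewrite mul1r.
have ap : supp_in (a + y) (b + y) phi.
  by move=> x xs; apply: ab; apply: contra xs; lra.
have E x : 1 * (x + y) + - y = x by ring.
have := w _ _ _ sphi ap.
rewrite -(Rintegral_translate y (lintM lf (smooth_cont (smooth_derive1 sphi)))
  (a := a + y) (b := b + y)); last first.
  by move=> x xs; rewrite (supp_derive1 ap) ?mulr0.
rewrite -(Rintegral_translate y (lintM lg (smooth_cont sphi))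
  (a := a + y) (b := b + y)); last by move=> x xs; rewrite ap ?mulr0.
under eq_Rintegral do rewrite dphi E.
by under [in X in _ = - X]eq_Rintegral do rewrite /phi E.
Qed.

(** A function on the circle together with one of its weak derivatives. Keeping
    the derivative explicit avoids the choice that [wderive] makes, which is
    not compatible with the operations. *)
Record h1 u v : Prop := H1pair {
  h1_l2 : l2loc u;
  h1_l2d : l2loc v;
  h1_per : forall x, u (x + 2 * pi) = u x;
  h1_Re : rweak (fun x => complex.Re (u x)) (fun x => complex.Re (v x));
  h1_Im : rweak (fun x => complex.Im (u x)) (fun x => complex.Im (v x)) }.

Lemma h1_H1per u v : h1 u v -> H1per u.
Proof.
case=> lu lv per w1 w2; split=> //; split; first exact/L2locP.
by exists v; [exact/L2locP|exact/weak_rweakP].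
Qed.

Lemma H1per_h1 u : H1per u -> h1 u (wderive u).
Proof.
move=> [[Lu [v Lv uv]] per].
have [/L2locP Ld /weak_rweakP[w1 w2]] :=
  @xgetPex _ (fun=> 0) [set v | L2loc v /\ weak_derivative u v]
    (ex_intro _ v (conj Lv uv)).
by split=> //; exact/L2locP.
Qed.

Lemma l2loc_le u (g : R -> R) : clint u -> lint g -> (forall x, nsq (u x) <= g x) ->
  l2loc u.
Proof.
move=> [l1 l2] lg ug; split=> //.
have m : measurable_fun [set: R] (fun x => nsq (u x)).
  by apply: measurable_nsq; split; [case: l1|case: l2].
split=> // a b; apply: le_integrable (lg.2 a b) => //.
  by apply/measurable_EFinP; exact: measurable_funTS.
move=> x _ /=; rewrite lee_fin (ger0_norm (nsq_ge0 _)).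
by apply: le_trans (ug x) _; exact: ler_norm.
Qed.

Lemma l2locZ (al : R[i]) u : l2loc u -> l2loc (fun x => al * u x).
Proof.
move=> lu; have [_ _ l3] := lu.
apply: (l2loc_le (clintZ al (l2loc_clint lu)) (lintZ (nsq al) l3)) => x.
by rewrite nsqM.
Qed.

Lemma l2locB u w : l2loc u -> l2loc w -> l2loc (fun x => u x - w x).
Proof.
move=> lu lw; have [_ _ l3] := lu; have [_ _ k3] := lw.
apply: (l2loc_le (clintB (l2loc_clint lu) (l2loc_clint lw))
  (lintD (lintZ 2 l3) (lintZ 2 k3))) => x.
exact: nsqB_le.
Qed.

Lemma l2loc_shift u y : l2loc u -> l2loc (fun x => u (x + y)).
Proof.
move=> [l1 l2 l3]; split.
- exact: (lint_shift y l1).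
- exact: (lint_shift y l2).
- exact: (lint_shift y l3).
Qed.

Lemma h1Z (al : R[i]) u v : h1 u v -> h1 (fun x => al * u x) (fun x => al * v x).
Proof.
case=> lu lv per w1 w2; have [u1 u2 _] := lu; have [v1 v2 _] := lv.
split; [exact: l2locZ|exact: l2locZ|by move=> x; rewrite per| |].
  have := rweak_lin (complex.Re al) (- complex.Im al) u1 v1 u2 v2 w1 w2.
  by congr rweak; apply/funext => x; rewrite cReM mulNr.
have := rweak_lin (complex.Im al) (complex.Re al) u1 v1 u2 v2 w1 w2.
by congr rweak; apply/funext => x; rewrite cImM addrC.
Qed.

Lemma h1B u v u' v' : h1 u v -> h1 u' v' ->
  h1 (fun x => u x - u' x) (fun x => v x - v' x).
Proof.
case=> lu lv per w1 w2 [lu' lv' per' w1' w2'].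
have [u1 u2 _] := lu; have [v1 v2 _] := lv.
have [u1' u2' _] := lu'; have [v1' v2' _] := lv'.
split; [exact: l2locB|exact: l2locB|by move=> x; rewrite per per'| |].
  have := rweak_lin 1 (- 1) u1 v1 u1' v1' w1 w1'.
  by congr rweak; apply/funext => x; rewrite cReD cReN mul1r mulN1r.
have := rweak_lin 1 (- 1) u2 v2 u2' v2' w2 w2'.
by congr rweak; apply/funext => x; rewrite cImD cImN mul1r mulN1r.
Qed.

Lemma h1_shift y u v : h1 u v -> h1 (fun x => u (x + y)) (fun x => v (x + y)).
Proof.
case=> lu lv per w1 w2; have [u1 u2 _] := lu; have [v1 v2 _] := lv.
split; [exact: l2loc_shift|exact: l2loc_shift| | |].
- by move=> x; rewrite addrAC per.
- exact: (rweak_shift y u1 v1 w1).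
- exact: (rweak_shift y u2 v2 w2).
Qed.

Lemma normX_sqr u : H1per u -> normX u ^+ 2 =
  2 * pi * (rmean (fun x => nsq (u x)) + rmean (fun x => nsq (wderive u x))).
Proof.
move=> /H1per_h1[[_ _ l3] [_ _ k3] _ _ _].
rewrite -rmeanD ?(lint_rint l3) ?(lint_rint k3) //.
rewrite /rmean mulrA divff ?gt_eqF ?pi2_gt0 // mul1r /normX sqr_sqrtr.
  by apply: eq_Rintegral => x _; rewrite !normc_nsq.
by apply: Rintegral_ge0 => x _; rewrite addr_ge0 ?sqr_ge0.
Qed.

Lemma h1_fcoef u v n : h1 u v -> fcoef v n = (0 +i* n%:~R) * fcoef u n.
Proof.
by case=> /l2loc_clint lu /l2loc_clint lv per w1 w2; exact: fcoef_weak.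
Qed.

Lemma h1_hn_le u v N : h1 u v ->
  hn N (fcoef u) <= rmean (fun x => nsq (u x)) + rmean (fun x => nsq (v x)).
Proof.
move=> uv; have [lu lv _ _ _] := uv; have [_ _ u3] := lu; have [_ _ v3] := lv.
rewrite hnE lerD ?bessel //; try exact: lint_rint; try exact/clint_cint/l2loc_clint.
have -> : dcoef (fcoef u) = fcoef v.
  by apply/funext => n; rewrite (h1_fcoef n uv).
by apply: bessel; [exact/clint_cint/l2loc_clint|exact: lint_rint].
Qed.

(** Bessel's inequality for a function and its derivative. *)
Lemma normX_hn u N : H1per u -> 2 * pi * hn N (fcoef u) <= normX u ^+ 2.
Proof.
move=> Hu; rewrite normX_sqr // ler_pM2l ?pi2_gt0 //.
exact/h1_hn_le/H1per_h1.
Qed.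

Lemma fcoef_shift u xi n : clint u -> (forall x, u (x + 2 * pi) = u x) ->
  0 <= xi <= 2 * pi ->
  fcoef (fun z => u (z - xi)) n = expi (- (n%:~R * xi)) * fcoef u n.
Proof.
move=> lu per /andP[x0 x2]; pose F z := u z * en (- n) z.
have lF : clint F.
  have [l1 l2] := lu; have [c1 c2] := @ccont_en R (- n); split.
    by under eq_fun do rewrite cReM; apply: lintB; exact: lintM.
  by under eq_fun do rewrite cImM; apply: lintD; exact: lintM.
have pF z : F (z + 2 * pi) = F z by rewrite /F per en_periodic.
have sF : mean (fun z => F (z + (2 * pi - xi))) = mean F.
  have xi' : 0 <= 2 * pi - xi <= 2 * pi by lra.
  rewrite /mean; congr (_ +i* _).
    apply: (rmean_shift (f := fun z => complex.Re (F z))) => //; first by case: lF.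
    by move=> z; rewrite pF.
  apply: (rmean_shift (f := fun z => complex.Im (F z))) => //; first by case: lF.
  by move=> z; rewrite pF.
rewrite /fcoef -/F -sF -meanZ; last first.
  by apply: clint_cint; have [l1 l2] := lF; split;
    [exact: (lint_shift (2 * pi - xi) l1)|exact: (lint_shift (2 * pi - xi) l2)].
congr mean; apply/funext => z; rewrite /F.
have -> : z + (2 * pi - xi) = z - xi + 2 * pi by ring.
rewrite per en_periodic mulrCA; congr (_ * _); rewrite /en -expiD; congr expi.
by rewrite mulrNz; ring.
Qed.

Lemma measure0_aff a b (P : set R) : 0 < a -> mu.-negligible P ->
  mu.-negligible (aff a b @^-1` P).
Proof.
move=> a0 [N [mN N0 PN]]; exists (aff a b @^-1` N); split.
- by rewrite -[X in measurable X]setTI; exact: (measurable_aff a b).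
- by rewrite lebesgue_measure_aff // N0 mule0.
- by move=> x; exact: PN.
Qed.

Lemma ae_period (P : R -> Prop) : {ae mu, forall z, 0 < z < 2 * pi -> P z} ->
  {ae mu, forall z, 0 <= z <= 2 * pi -> P z}.
Proof.
have N : mu.-negligible [set 0; 2 * pi].
  apply/negligibleP; first by apply: measurableU; exact: measurable_set1.
  by apply: countable_lebesgue_measure0; exact/finite_set_countable.
have NA : {ae mu, forall z : R, z != 0 /\ z != 2 * pi}.
  apply: negligibleS N => z /= /not_andP[] /negP; rewrite negbK => /eqP ->.
    by left.
  by right.
move: NA; apply: (@filterS2 _ _ (ae_filter_ringOfSetsType mu)) => z [z0 z2] h.
by move=> /andP[h0 h2]; apply: h; rewrite !lt_neqAle eq_sym z0 h0 z2 h2.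
Qed.

Lemma rmean_ae f g : measurable_fun [set: R] f -> measurable_fun [set: R] g ->
  {ae mu, forall z, 0 < z < 2 * pi -> f z = g z} -> rmean f = rmean g.
Proof.
move=> mf mg /ae_period fg; rewrite /rmean /Rintegral; congr (_ * fine _).
apply: ae_eq_integral => //.
- by apply/measurable_EFinP; exact: measurable_funTS.
- by apply/measurable_EFinP; exact: measurable_funTS.
move: fg; apply: (@filterS _ _ (ae_filter_ringOfSetsType mu)) => z h /=.
by rewrite in_itv => /h ->.
Qed.

End SobolevPairs.

(** * Fourier series in H^1 *)

Section FourierSobolev.
Context {R : realType}.
Local Notation mu := (@lebesgue_measure R).
Implicit Types (f g h psi : R -> R) (u v w S : R -> R[i]) (c d : int -> R[i]).
Implicit Types (x y z a b : R).

Lemma nsq_small (al : R[i]) : (forall eps : R, 0 < eps -> nsq al <= eps) -> al = 0.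
Proof.
move=> h; have n0 : nsq al = 0.
  apply/le_anti; rewrite nsq_ge0 andbT leNgt; apply/negP => n0.
  by have := h _ (divr_gt0 n0 (ltr0n _ 2)); lra.
move/eqP: n0; rewrite /nsq paddr_eq0 ?sqr_ge0 // !sqrf_eq0 => /andP[/eqP h1 /eqP h2].
exact: complexP.
Qed.

Lemma nsq_ccvg (a_ : nat -> R[i]) (l : R[i]) :
  (forall eps : R, 0 < eps -> \forall M \near \oo, nsq (a_ M - l) <= eps) -> ccvg a_ l.
Proof.
move=> h; have key (g : R[i] -> R) : (forall a b : R[i], g a - g b = g (a - b)) ->
    (forall a : R[i], g a ^+ 2 <= nsq a) -> g (a_ M) @[M --> \oo] --> g l.
  move=> gB gn; apply/cvgrPdist_le => e e0.
  have := h _ (exprn_gt0 2 e0); apply: filterS => M hM.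
  rewrite distrC gB -[leRHS](ger0_norm (ltW e0)) -ler_sqr ?nnegrE ?normr_ge0 //.
  by rewrite !real_normK ?num_real //; apply: le_trans (gn _) _.
split; apply: key => [a b|a].
- by rewrite cReD cReN.
- by rewrite /nsq lerDl sqr_ge0.
- by rewrite cImD cImN.
- by rewrite /nsq lerDr sqr_ge0.
Qed.

Lemma ccont_clint u : ccont u -> clint u.
Proof. by case=> c1 c2; split; exact: lint_cont. Qed.

(** The uniform sum of the Fourier series is continuous and has the same
    coefficients. *)
Lemma h1_limit u v : h1 u v -> exists S, [/\ ccont S,
  forall eps : R, 0 < eps -> \forall N \near \oo, forall z,
    nsq (tp N (fcoef u) z - S z) <= eps &
  {ae mu, forall z, 0 < z < 2 * pi -> u z = S z}].
Proof.
move=> uv; have lu := l2loc_clint (h1_l2 uv).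
have [S hS] := tp_limit (fun N => h1_hn_le N uv).
have cS := limit_ccont hS; exists S; split=> //.
have E n : fcoef S n = fcoef u n.
  apply/eqP; rewrite -subr_eq0; apply/eqP/nsq_small => eps e0.
  have [N0 _ hN] := hS _ e0; pose N := maxn N0 `|n|%N.
  have cT := ccont_tp N (fcoef u).
  rewrite [X in _ - X](_ : _ = fcoef (tp N (fcoef u)) n); last first.
    by rewrite fcoef_tp leq_maxr.
  rewrite -fcoefB; try exact: cint_cont.
  have cD : ccont (fun t => S t - tp N (fcoef u) t) by auto with cont.
  apply: le_trans (nsq_fcoef_le _ _ _) _; first exact: cint_cont.
    exact/rint_cont/ccont_nsq.
  rewrite -[leRHS]rmean_cst; apply: rmean_le.
  - exact/rint_cont/ccont_nsq.
  - exact/rint_cont/rcont_cst.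
  move=> z; rewrite -nsqN opprB; exact: (hN N (leq_maxl _ _) z).
have := fcoef0_ae (clintB lu (ccont_clint cS)) => h.
have : {ae mu, forall z, 0 < z < 2 * pi -> u z - S z = 0}.
  apply: h => n; rewrite fcoefB ?E ?subrr //; first exact: clint_cint.
  exact: cint_cont.
apply: (@filterS _ _ (ae_filter_ringOfSetsType mu)) => z H /H /eqP.
by rewrite subr_eq0 => /eqP.
Qed.

Lemma fcoef_ae u w n : cmeasurable u -> cmeasurable w ->
  {ae mu, forall z, 0 < z < 2 * pi -> u z = w z} -> fcoef u n = fcoef w n.
Proof.
have M u1 : cmeasurable u1 -> cmeasurable (fun t => u1 t * en (- n) t).
  move=> [m1 m2]; have [c1 c2] := @ccont_en R (- n).
  have n1 := continuous_measurable_fun c1; have n2 := continuous_measurable_fun c2.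
  split.
    rewrite (_ : (fun x => _) = fun x => complex.Re (u1 x) * complex.Re (en (- n) x)
      - complex.Im (u1 x) * complex.Im (en (- n) x)).
      by apply: measurable_funB; exact: measurable_funM.
    by apply/funext => x; rewrite cReM.
  rewrite (_ : (fun x => _) = fun x => complex.Re (u1 x) * complex.Im (en (- n) x)
      + complex.Im (u1 x) * complex.Re (en (- n) x)).
    by apply: measurable_funD; exact: measurable_funM.
  by apply/funext => x; rewrite cImM.
move=> /M[u1 u2] /M[w1 w2] uw; rewrite /fcoef /mean; congr (_ +i* _).
  apply: rmean_ae => //; move: uw.
  by apply: (@filterS _ _ (ae_filter_ringOfSetsType mu)) => z H /H ->.
apply: rmean_ae => //; move: uw.
by apply: (@filterS _ _ (ae_filter_ringOfSetsType mu)) => z H /H ->.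
Qed.

Lemma clint_cmeasurable u : clint u -> cmeasurable u.
Proof. by case=> [[m1 _] [m2 _]]; split. Qed.

Lemma cmeasurable_cub u : cmeasurable u -> cmeasurable (fun t => cub (u t)).
Proof.
move=> mu'; have mn := measurable_nsq mu'; have [m1 m2] := mu'; split.
  rewrite (_ : (fun x => _) = fun x => nsq (u x) * complex.Re (u x)).
    exact: measurable_funM.
  by apply/funext => x; rewrite /cub cReM /= mul0r subr0.
rewrite (_ : (fun x => _) = fun x => nsq (u x) * complex.Im (u x)).
  exact: measurable_funM.
by apply/funext => x; rewrite /cub cImM /= mul0r addr0.
Qed.

(** The Fourier polynomials converge uniformly and stay bounded, and the
    nonlinearity is locally Lipschitz. *)
Lemma Fc_cvg u v n : h1 u v ->
  ccvg (fun M => Fc M (fcoef u) n) (fcoef (fun t => cub (u t)) n).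
Proof.
move=> uv; have lu := l2loc_clint (h1_l2 uv).
have [S [cS hS uS]] := h1_limit uv.
have ccS := ccont_cub cS.
rewrite (@fcoef_ae _ (fun t => cub (S t))); first last.
- move: uS; apply: (@filterS _ _ (ae_filter_ringOfSetsType mu)) => z H /H.
  by move=> ->.
- exact/clint_cmeasurable/ccont_clint.
- exact/cmeasurable_cub/clint_cmeasurable.
set B := rmean (fun x => nsq (u x)) + rmean (fun x => nsq (v x)).
have hB N : hn N (fcoef u) <= B by exact: h1_hn_le.
have B0 : 0 <= B by apply: le_trans (hB 0%N); exact: hn_ge0.
pose D := 3 * (15 * B + 2) ^+ 2.
have D0 : 0 < D by rewrite /D mulr_gt0 // exprn_gt0 // ltr_wpDl // mulr_ge0.
apply: nsq_ccvg => eps e0.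
have e1 : 0 < Num.min 1 (eps / D) by rewrite lt_min ltr01 divr_gt0.
have := hS _ e1; apply: filterS => M hM.
have cT := ccont_tp M (fcoef u); have ccT := ccont_cub cT.
rewrite /Fc -fcoefB; try exact: cint_cont.
have cD : ccont (fun t => cub (tp M (fcoef u) t) - cub (S t)) by exact: ccontB.
apply: le_trans (nsq_fcoef_le _ _ _) _; first exact: cint_cont.
  exact/rint_cont/ccont_nsq.
rewrite -[leRHS]rmean_cst; apply: rmean_le.
- exact/rint_cont/ccont_nsq.
- exact/rint_cont/rcont_cst.
move=> z; apply: le_trans (nsq_cubB_le _ _) _.
have := hM z; rewrite le_min => /andP[h1' h2].
have n1 : nsq (tp M (fcoef u) z) <= 5 * B.
  by apply: le_trans (nsq_tp_le _ _ _) _; rewrite ler_wpM2l.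
have n2 : nsq (S z) <= 10 * B + 2.
  have -> : S z = tp M (fcoef u) z - (tp M (fcoef u) z - S z) by ring.
  apply: le_trans (nsqB_le _ _) _.
  move: n1 h1'; move: (nsq _) (nsq _) => p q; move: B0; clear; move: B => B; lra.
have n0 := nsq_ge0 (S z); have n0' := nsq_ge0 (tp M (fcoef u) z).
apply: (@le_trans _ _ (D * nsq (tp M (fcoef u) z - S z))).
  have s1 := addr_ge0 n0' n0.
  have s2 : 0 <= 15 * B + 2 by rewrite addr_ge0 ?mulr_ge0.
  rewrite ler_wpM2r ?nsq_ge0 // /D ler_wpM2l // ler_sqr //.
  move: n1 n2; move: (nsq _) (nsq _) => p q; move: B0; clear; move: B => B; lra.
by rewrite mulrC -ler_pdivlMr.
Qed.

Lemma rmean_fatou (F_ : nat -> R -> R) f (B : R) :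
  (forall j, rcont (F_ j)) -> (forall j x, 0 <= F_ j x) -> (forall x, 0 <= f x) ->
  rint f -> {ae mu, forall z, 0 < z < 2 * pi -> F_ j z @[j --> \oo] --> f z} ->
  (forall j, rmean (F_ j) <= B) -> rmean f <= B.
Proof.
move=> cF F0 f0 fi /ae_period cv hB.
have p2 := @pi2_gt0 R; have p20 : 2 * pi != 0 :> R by rewrite gt_eqF.
have iF j := rint_cont (cF j).
pose I : set R := `[0, 2 * pi]%classic.
have E j : (\int[mu]_(x in I) (F_ j x)%:E)%E = (2 * pi * rmean (F_ j))%R%:E.
  rewrite /rmean mulrA divff // mul1r /Rintegral fineK //.
  by apply: integrable_fin_num => //; exact: iF.
have Ef : (\int[mu]_(x in I) (f x)%:E)%E = (2 * pi * rmean f)%R%:E.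
  rewrite /rmean mulrA divff // mul1r /Rintegral fineK //.
  by apply: integrable_fin_num.
have mF j : measurable_fun I (fun x => (F_ j x)%:E).
  exact: (measurable_int mu (iF j)).
have mf : measurable_fun I (fun x => (f x)%:E) by exact: (measurable_int mu fi).
have h := @fatou _ (measurableTypeR R) R mu I (measurable_itv _)
  (fun j x => (F_ j x)%:E) mF (fun j x _ => _).
have {}h := h (fun j x => F0 j x).
have e1 : (\int[mu]_(x in I) (f x)%:E =
    \int[mu]_(x in I) limn_einf (fun j => (F_ j x)%:E))%E.
  apply: (@ae_eq_integral _ (measurableTypeR R) R mu I) => //.
  - exact: measurable_itv.
  - apply: (@emeasurable_fun_cvg _ (measurableTypeR R) R I (fun m x => einfs (fun j => (F_ j x)%:E) m)).
      by move=> m; exact: measurable_fun_einfs.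
    by move=> x _; rewrite limn_einf_lim; exact: is_cvg_einfs.
  move: cv; apply: (@filterS _ _ (ae_filter_ringOfSetsType mu)) => z H /=.
  rewrite /I /= in_itv => /H cz; apply/esym.
  by apply: (cvg_limn_einf_sup _).1; apply: cvg_EFin => //; exact: nearW.
move: h; rewrite -e1 Ef; under eq_fun do rewrite E.
move=> h; rewrite -(ler_pM2l p2) -lee_fin; apply: le_trans h _.
have := @cvg_einfs_sup R (fun j => (2 * pi * rmean (F_ j))%R%:E).
move=> /cvg_lim; rewrite limn_einf_lim => -> //.
apply: ge_ereal_sup => _ [j _ <-].
apply: (@le_trans _ _ (2 * pi * rmean (F_ j))%:E).
  by apply: ereal_inf_lbound; exists j => /=.
by rewrite lee_fin ler_pM2l.
Qed.

End FourierSobolev.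

(** * An upper bound for the norm of H^1 *)

Section Converse.
Context {R : realType}.
Local Notation mu := (@lebesgue_measure R).
Implicit Types (f g h psi : R -> R) (u v w S : R -> R[i]) (c d : int -> R[i]).
Implicit Types (x y z a b : R).

Lemma Rintegral_rmean f : (forall x, ~~ (0 <= x <= 2 * pi) -> f x = 0) ->
  \int[mu]_x f x = 2 * pi * rmean f.
Proof.
move=> f0; rewrite (Rintegral_supp f0) /rmean mulrA divff ?mul1r //.
by rewrite gt_eqF ?pi2_gt0.
Qed.

Lemma ker0_supp j : supp_in 0 j.+1%:R^-1 (ker j (0 : R)).
Proof.
move=> x; rewrite negb_and -!ltNge => /orP[x0|x1].
  by rewrite ker0_le0 // ltW.
by rewrite ker0_ge // ltW.
Qed.

Lemma jV_le j : j.+1%:R^-1 <= 2 * pi :> R.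
Proof.
by apply: (le_trans _ (@pi2_ge1 R)); rewrite invf_le1 // ler1n.
Qed.

Lemma supp_period j h : supp_in 0 j.+1%:R^-1 h -> supp_in 0 (2 * pi) h.
Proof.
move=> sh x xs; apply: sh; apply: contra xs => /andP[-> x1] /=.
exact: le_trans x1 (jV_le j).
Qed.

Lemma weak_ker f g z j : lint f -> lint g -> rweak f g ->
  rmean (fun t => g (t + z) * ker j 0 t) =
  - rmean (fun t => f (t + z) * derive1 (ker j 0) t).
Proof.
move=> lf lg w; have h := rweak_shift z lf lg w (@smooth_ker0 R j) (@ker0_supp j).
have p2 : 2 * pi != 0 :> R by rewrite gt_eqF ?pi2_gt0.
apply: (mulfI p2); rewrite mulrN -!Rintegral_rmean.
- by rewrite h opprK.
- by move=> t ts; rewrite (supp_period (supp_derive1 (@ker0_supp j))) ?mulr0.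
- by move=> t ts; rewrite (supp_period (@ker0_supp j)) ?mulr0.
Qed.

(** [mollify], written as a mean over the period. *)
Lemma ker_cvg f x : lint f -> lebesgue_pt f x ->
  2 * pi * rmean (fun t => f (t + x) * ker j 0 t) @[j --> \oo] --> f x.
Proof.
move=> lf fx; have := mollify lf fx.
rewrite (_ : (fun j : nat => _) = fun j => 2 * pi * rmean (fun t => f (t + x) * ker j 0 t)) //.
apply/funext => j; rewrite -Rintegral_rmean; last first.
  by move=> t ts; rewrite (supp_period (@ker0_supp j)) ?mulr0.
rewrite (@Rintegral_supp _ _ 0 j.+1%:R^-1); last first.
  by move=> t ts; rewrite ker0_supp ?mulr0.
have cK : rcont (ker j x).
  rewrite /ker; apply: rcontM; first exact: rcont_cst.
  by apply: rcont_comp; [exact: (smooth_cont smooth_mollifier)|auto with cont].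
have := @Rintegral_shift _ (fun s => f s * ker j x s) x 0 j.+1%:R^-1 true false
  (lintM lf cK).
rewrite add0r [_ + x]addrC => <-.
by apply: eq_Rintegral => t _; rewrite /ker addrK subr0.
Qed.

Lemma rmean_ker j : 2 * pi * rmean (ker j (0 : R)) = 1.
Proof.
rewrite /rmean mulrA divff ?mul1r ?gt_eqF ?pi2_gt0 //.
rewrite (Rintegral_derive (@pi2_gt0 R) (smooth_cont (smooth_ker0 j)) (@is_derive_cut R j)).
by rewrite cut_ge ?jV_le // cut_le0 // subr0.
Qed.

(** The Fourier multiplier of the convolution with the kernel. *)
Definition kmul j (n : int) : R[i] :=
  (2 * pi)%:C * mean (fun t => en n t * (ker j 0 t)%:C).

Lemma cReCM (r : R) (w : R[i]) : complex.Re (r%:C * w) = r * complex.Re w.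
Proof. by rewrite cReM /= mul0r subr0. Qed.

Lemma ccont_ker j : ccont (fun t : R => (ker j 0 t)%:C).
Proof. exact/ccontC/smooth_cont/smooth_ker0. Qed.

Lemma ker_ge0 j (t : R) : 0 <= ker j 0 t.
Proof. by rewrite /ker mulr_ge0 ?mollifier_ge0. Qed.

(** The kernel is a density of probability and the modes have modulus one: pair
    the mean with its own conjugate. *)
Lemma nsq_kmul_le j n : nsq (kmul j n) <= 1.
Proof.
have p0 : 0 <= 2 * pi :> R by exact/ltW/pi2_gt0.
have c1 := ccontM (@ccont_en R n) (ccont_ker j).
set b := kmul j n.
have ck := smooth_cont (@smooth_ker0 R j).
have E : nsq b = 2 * pi * rmean (fun t => complex.Re (en n t * (ker j 0 t)%:C * conjc b)).
  transitivity (complex.Re (b * conjc b)); first by rewrite mulcJ.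
  rewrite {1}/b /kmul -mulrA cReCM; congr (_ * _).
  rewrite mulrC -meanZ; last exact: cint_cont.
  rewrite Re_mean; congr rmean; apply/funext => t.
  by rewrite [conjc b * _]mulrC.
have H : nsq b <= 2 * pi * rmean (fun t => (1 + nsq b) / 2 * ker j 0 t).
  rewrite {1}E ler_wpM2l //; apply: rmean_le.
  - by apply: rint_cont; have [] := ccontM c1 (ccont_cst (conjc b)).
  - by apply: rint_cont; apply: rcontM => //; exact: rcont_cst.
  move=> t; rewrite mulrAC mulrC cReCM mulrC.
  rewrite ler_wpM2r ?ker_ge0 //.
  have := ReMJ_le (en n t) b; rewrite nsq_en.
  have := ler_norm (complex.Re (en n t * conjc b)); lra.
move: H; rewrite rmeanZ; last exact: rint_cont.
by rewrite mulrCA rmean_ker mulr1; lra.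
Qed.

Lemma en_add n (t z : R) : en n (t + z) = en n z * en n t.
Proof. by rewrite /en -expiD; congr expi; ring. Qed.

Lemma tp_shift N c (t z : R) : tp N c (t + z) = tp N (fun n => c n * en n z) t.
Proof. by apply: eq_bigr => n _; rewrite en_add mulrA. Qed.

Lemma mean_tp_ker N d j (z : R) :
  (2 * pi)%:C * mean (fun t => tp N d (t + z) * (ker j 0 t)%:C) =
  tp N (fun n => d n * kmul j n) z.
Proof.
rewrite (_ : (fun t => _) = fun t => \sum_(n <- modes N)
    d n * en n z * (en n t * (ker j 0 t)%:C)); last first.
  apply/funext => t; rewrite tp_shift /tp mulr_suml; apply: eq_bigr => n _.
  by rewrite -!mulrA.
have ci n : cint (fun t => en n t * (ker j (0 : R) t)%:C).
  by apply: cint_cont; apply: ccontM; [exact: ccont_en|exact: ccont_ker].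
rewrite mean_sum; last by move=> n; exact: cintZ.
rewrite mulr_sumr; apply: eq_bigr => n _.
by rewrite meanZ // /kmul; ring.
Qed.

Lemma mean_tp_dker N c j (z : R) :
  mean (fun t => tp N c (t + z) * (derive1 (ker j 0) t)%:C) =
  - mean (fun t => tp N (dcoef c) (t + z) * (ker j 0 t)%:C).
Proof.
set c' := fun n => c n * en n z.
have E : (fun t => tp N (dcoef c) (t + z)) = tp N (dcoef c').
  apply/funext => t; rewrite tp_shift; congr tp; apply/funext => n.
  by rewrite /dcoef /c' mulrA.
have dk : cis_derive (fun t : R => (ker j 0 t)%:C) (fun t => (derive1 (ker j 0) t)%:C).
  move=> t; split=> /=; last exact: is_derive_cst.
  exact/smooth_is_derive/smooth_ker0.
have cdk : ccont (fun t : R => (derive1 (ker j 0) t)%:C).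
  exact/ccontC/smooth_cont/smooth_derive1/smooth_ker0.
have D := cis_deriveM (cis_derive_tp N c') dk.
have c1 : ccont (fun t => tp N (dcoef c') t * (ker j 0 t)%:C).
  by apply: ccontM; [exact: ccont_tp|exact: ccont_ker].
have c2 : ccont (fun t => tp N c' t * (derive1 (ker j 0) t)%:C).
  by apply: ccontM => //; exact: ccont_tp.
have := mean_derive (ccontD c1 c2) D.
rewrite (ker0_le0 j (lexx 0)) (ker0_ge (jV_le j)) !mulr0 => /(_ erefl).
rewrite meanD; try exact: cint_cont.
move/eqP; rewrite addrC addr_eq0 => /eqP H.
rewrite (_ : (fun t => tp N c (t + z) * _) = fun t => tp N c' t * (derive1 (ker j 0) t)%:C).
  rewrite H; congr (- mean _); apply/funext => t.
  by rewrite -E.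
by apply/funext => t; rewrite tp_shift.
Qed.

Lemma meanMC w (r : R -> R) : mean (fun t => w t * (r t)%:C) =
  rmean (fun t => complex.Re (w t) * r t) +i* rmean (fun t => complex.Im (w t) * r t).
Proof.
apply: complexP => /=; congr rmean; apply/funext => t.
  by rewrite mulrC cReCM mulrC.
by rewrite cImM /= mulr0 add0r.
Qed.

Lemma mean_fcoef0 w : mean w = fcoef w 0.
Proof. by congr mean; apply/funext => t; rewrite oppr0 en0 mulr1. Qed.

Lemma clintMC w (r : R -> R) : clint w -> rcont r -> clint (fun t => w t * (r t)%:C).
Proof.
move=> [l1 l2] cr; split.
  rewrite (_ : (fun x => _) = fun t => complex.Re (w t) * r t); first exact: lintM.
  by apply/funext => t; rewrite mulrC cReCM mulrC.
rewrite (_ : (fun x => _) = fun t => complex.Im (w t) * r t); first exact: lintM.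
by apply/funext => t; rewrite cImM /= mulr0 add0r.
Qed.

Lemma clint_shift w z : clint w -> clint (fun t => w (t + z)).
Proof.
by move=> [l1 l2]; split; [exact: (lint_shift z l1)|exact: (lint_shift z l2)].
Qed.

(** The converse of Bessel's inequality. At scale [1/j] the mollification of [v] is
    minus the pairing of [u] with the derivative of the kernel; [u] being the
    uniform sum of its Fourier series, this is, up to [1/j], a trigonometric
    polynomial whose coefficients are dominated by those of [v]. It converges
    to [v] at the Lebesgue points, and the bound on the coefficients passes to
    the limit by Fatou's lemma. *)
Lemma h1_norm_le u v (B : R) : h1 u v -> (forall N, hn N (fcoef u) <= B) ->
  rmean (fun x => nsq (u x)) + rmean (fun x => nsq (v x)) <= B.
Proof.
move=> uv hB; have [lu2 lv2 per wR wI] := uv.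
have lu := l2loc_clint lu2; have lv := l2loc_clint lv2.
have [u1 u2] := lu; have [v1 v2] := lv.
have [S [cS hS uS]] := h1_limit uv.
set c := fcoef u.
pose dk j : R -> R := derive1 (ker j 0).
have cdk j : rcont (dk j) by exact/smooth_cont/smooth_derive1/smooth_ker0.
pose L j := rmean (fun t => dk j t ^+ 2).
have L0 j : 0 <= L j by apply: rmean_ge0 => t; exact: sqr_ge0.
pose al : R := (2 * pi) ^+ 2.
have al0 : 0 < al by rewrite exprn_gt0 // pi2_gt0.
pose e j := (j.+1%:R * (1 + al * L j))^-1.
have d0 j : 0 < 1 + al * L j by rewrite ltr_wpDr // mulr_ge0 // ltW.
have e0 j : 0 < e j by rewrite invr_gt0 mulr_gt0.
have ex j : exists N, forall z, nsq (tp N c z - S z) <= e j.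
  by have [N _ hN] := hS _ (e0 j); exists N; exact: (hN N (leqnn N)).
have [N_ hN] := choice ex.
pose T j z := tp (N_ j) (fun n => dcoef c n * kmul j n) z.
pose F_ j z := nsq (tp (N_ j) c z) + nsq (T j z).
have harm : j.+1%:R^-1 @[j --> \oo] --> (0 : R) by exact: cvg_harmonic.
have e_le j : e j <= j.+1%:R^-1.
  rewrite lef_pV2 ?posrE ?mulr_gt0 // ler_peMr // lerDl mulr_ge0 //.
  exact: ltW.
have small (a_ : nat -> R[i]) l : (\forall j \near \oo, nsq (a_ j - l) <= j.+1%:R^-1) ->
    ccvg a_ l.
  move=> h; apply: nsq_ccvg => eps eps0.
  have : \forall j \near \oo, j.+1%:R^-1 <= eps by apply: (cvgr_le _ harm).
  by move: h; apply: filterS2 => j h1 h2; exact: le_trans h1 h2.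
have Cv (p q : nat -> R) (l : R) : p =1 q -> p j @[j --> \oo] --> l ->
    q j @[j --> \oo] --> l by move=> /funext ->.
have kernel_part z : 0 < z < 2 * pi -> lebesgue_pt (fun x => complex.Re (v x)) z ->
    lebesgue_pt (fun x => complex.Im (v x)) z -> ccvg (T^~ z) (v z).
  move=> /andP[z0 z2] zR zI.
  pose V j := (2 * pi)%:C * mean (fun t => v (t + z) * (ker j 0 t)%:C).
  have VE j : V j = (2 * pi)%:C *
      (rmean (fun t => complex.Re (v (t + z)) * ker j 0 t) +i*
       rmean (fun t => complex.Im (v (t + z)) * ker j 0 t)) by rewrite /V meanMC.
  have cV : ccvg V (v z).
    split.
      by apply: Cv (ker_cvg v1 zR) => j; rewrite VE cReCM.
    by apply: Cv (ker_cvg v2 zI) => j; rewrite VE cImM /= mul0r addr0.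
  have dT : ccvg (fun j => T j z - V j) 0.
    apply: small; have z3 : 0 < 2 * pi - z by lra.
    have : \forall j \near \oo, j.+1%:R^-1 < 2 * pi - z by apply: (cvgr_lt _ harm).
    apply: filterS => j hj; rewrite subr0.
    have ccdk : ccont (fun t : R => (dk j t)%:C) by exact/ccontC.
    have sdk : supp_in 0 j.+1%:R^-1 (dk j) by exact/supp_derive1/ker0_supp.
    have lS := l2loc_clint lu2.
    have VS : V j = - ((2 * pi)%:C * mean (fun t => S (t + z) * (dk j t)%:C)).
      rewrite VE (weak_ker z j u1 v1 wR) (weak_ker z j u2 v2 wI) -[RHS]mulrN.
      congr (_ * _).
      transitivity (- mean (fun t => u (t + z) * (dk j t)%:C)).
        by rewrite meanMC; apply: complexP.
      congr (- _); rewrite !mean_fcoef0; apply: fcoef_ae.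
      - exact/clint_cmeasurable/clintMC/cdk/clint_shift.
      - exact/clint_cmeasurable/clintMC/cdk/clint_shift/ccont_clint.
      have := @measure0_aff R 1 z _ ltr01 uS.
      apply: negligibleS => t /= /not_implyP[/andP[t0 t2] h].
      apply/not_implyP; rewrite /aff mul1r; split; last by move=> h'; apply: h; rewrite h'.
      have [tj|tj] := leP t j.+1%:R^-1; last first.
        by case: h; rewrite sdk ?mulr0 // negb_and -!ltNge tj orbT.
      by apply/andP; split; [exact: addr_gt0|move: tj hj; set q := _^-1; lra].
    have TE : T j z = - ((2 * pi)%:C * mean (fun t => tp (N_ j) c (t + z) * (dk j t)%:C)).
      by rewrite mean_tp_dker mulrN opprK mean_tp_ker.
    have cTt : ccont (fun t => tp (N_ j) c (t + z)).
      by apply: (ccont_comp (ccont_tp (N_ j) c)); auto with cont.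
    have cSt : ccont (fun t => S (t + z)) by apply: (ccont_comp cS); auto with cont.
    have cTd := ccontM cTt ccdk; have cSd := ccontM cSt ccdk.
    have cD := ccontB cSd cTd.
    rewrite TE VS opprK addrC -mulrBr -meanB; try exact: cint_cont.
    rewrite nsqM nsqC -/al mean_fcoef0.
    apply: (@le_trans _ _ (al * (e j * L j))).
      rewrite (ler_wpM2l (ltW al0)) //; apply: le_trans (nsq_fcoef_le _ _ _) _.
      - exact: cint_cont.
      - exact/rint_cont/ccont_nsq.
      rewrite /L -rmeanZ; last by apply/rint_cont/rcontX.
      apply: rmean_le; first exact/rint_cont/ccont_nsq.
        by apply/rint_cont; apply: rcontM; [exact: rcont_cst|exact: rcontX].
      move=> t; rewrite -mulrBl nsqM nsqC ler_wpM2r ?sqr_ge0 //.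
      by rewrite -nsqN opprB.
    rewrite /e invfM mulrCA -[leRHS]mulr1 -mulrA ler_wpM2l ?invr_ge0 //.
    rewrite ler_pdivrMl // mulr1; move: (al * L j) => q; lra.
  split.
    rewrite -[complex.Re (v z)]addr0; apply: Cv (cvgD cV.1 dT.1) => j.
    by rewrite -[X in X = _]cReD addrC subrK.
  rewrite -[complex.Im (v z)]addr0; apply: Cv (cvgD cV.2 dT.2) => j.
  by rewrite -[X in X = _]cImD addrC subrK.
have [_ _ u3] := lu2; have [_ _ v3] := lv2.
rewrite -(rmeanD (lint_rint u3) (lint_rint v3)).
apply: (@rmean_fatou _ F_).
- by move=> j; apply: rcontD; apply: ccont_nsq; exact: ccont_tp.
- by move=> j z; rewrite addr_ge0 ?nsq_ge0.
- by move=> z; rewrite addr_ge0 ?nsq_ge0.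
- exact: (lint_rint (lintD u3 v3)).
- have LR := lebesgue_differentiation (lint_locally v1).
  have LI := lebesgue_differentiation (lint_locally v2).
  have := @filterI _ _ (ae_filter_ringOfSetsType mu) _ _ uS
    (@filterI _ _ (ae_filter_ringOfSetsType mu) _ _ LR LI).
  apply: (@filterS _ _ (ae_filter_ringOfSetsType mu)) => z [uz [zR zI]] z02.
  have cu : ccvg (fun j => tp (N_ j) c z) (u z).
    by rewrite uz //; apply: small; apply: nearW => j; exact: le_trans (hN j z) (e_le j).
  have cv : ccvg (T^~ z) (v z).
    exact: kernel_part.
  have n1 := ccvg_nsqB (d := 0) cu; have n2 := ccvg_nsqB (d := 0) cv.
  move: n1 n2; rewrite !subr0 => n1 n2; apply: Cv (cvgD n1 n2) => j.
  by rewrite /= !subr0.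
- move=> j; rewrite /F_ rmeanD; try exact/rint_cont/ccont_nsq/ccont_tp.
  rewrite !rmean_nsq_tp; apply: le_trans (hB (N_ j)); rewrite hnE lerD2l.
  apply: ler_sum => n _; rewrite nsqM ler_piMr ?nsq_ge0 //; exact: nsq_kmul_le.
Qed.

End Converse.

(** * Complex integrals over the line *)

Section Pairings.
Context {R : realType}.
Local Notation mu := (@lebesgue_measure R).
Implicit Types (f g h psi r : R -> R) (u v w S F G : R -> R[i]).
Implicit Types (x y z a b : R).

Definition tint F := mu.-integrable setT (EFin \o (fun x => complex.Re (F x))) /\
  mu.-integrable setT (EFin \o (fun x => complex.Im (F x))).

Lemma supp_integrable f a b : lint f -> supp_in a b f ->
  mu.-integrable setT (EFin \o f).
Proof.
move=> [mf fi] sf; have mI : measurable (`[a, b]%classic : set R) by [].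
have -> : EFin \o f = (EFin \o f) \_ (`[a, b]%classic : set R).
  apply/funext => x; rewrite /= patchE; case: ifPn => // /negP xs.
  rewrite sf //; apply/negP => xI; apply: xs.
  by rewrite inE /= in_itv.
by apply: (iffLR (@integrable_mkcond _ (measurableTypeR R) R mu _ _ mI)).
Qed.

Lemma tint_test w r a b : clint w -> rcont r -> supp_in a b r ->
  tint (fun x => w x * (r x)%:C).
Proof.
move=> lw cr sr; have [l1 l2] := clintMC lw cr; split.
  by apply: (supp_integrable l1 (a := a) (b := b)) => x xs; rewrite sr ?mulr0.
by apply: (supp_integrable l2 (a := a) (b := b)) => x xs; rewrite sr ?mulr0.
Qed.

Lemma cintegralD F G : tint F -> tint G ->
  cintegral (fun x => F x + G x) = cintegral F + cintegral G.
Proof.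
move=> [f1 f2] [g1 g2]; apply: complexP; rewrite ?cReD ?cImD /cintegral /=.
  by rewrite -RintegralD //; apply: eq_Rintegral => x _; rewrite cReD.
by rewrite -RintegralD //; apply: eq_Rintegral => x _; rewrite cImD.
Qed.

Lemma tintD F G : tint F -> tint G -> tint (fun x => F x + G x).
Proof.
move=> [f1 f2] [g1 g2]; split.
  have := integrableD measurableT f1 g1; congr (integrable _ _ _).
  by apply/funext => x; rewrite /= cReD.
have := integrableD measurableT f2 g2; congr (integrable _ _ _).
by apply/funext => x; rewrite /= cImD.
Qed.

Lemma tintZ (al : R[i]) F : tint F -> tint (fun x => al * F x).
Proof.
move=> [f1 f2]; split.
  have := integrableB measurableT (integrableZl measurableT (complex.Re al) f1)
    (integrableZl measurableT (complex.Im al) f2); congr (integrable _ _ _).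
  by apply/funext => x; rewrite /= cReM.
have := integrableD measurableT (integrableZl measurableT (complex.Re al) f2)
  (integrableZl measurableT (complex.Im al) f1); congr (integrable _ _ _).
by apply/funext => x; rewrite /= cImM.
Qed.

Lemma cintegralZ (al : R[i]) F : tint F ->
  cintegral (fun x => al * F x) = al * cintegral F.
Proof.
move=> [f1 f2]; have Z q g (ig : mu.-integrable setT (EFin \o g)) :
  mu.-integrable setT (EFin \o (fun x => q * g x)) := integrableZl measurableT q ig.
apply: complexP; rewrite ?cReM ?cImM /cintegral /=.
  rewrite -!RintegralZl // -RintegralB //; [|exact: Z|exact: Z].
  by apply: eq_Rintegral => x _; rewrite cReM.
rewrite -!RintegralZl // -RintegralD //; [|exact: Z|exact: Z].
by apply: eq_Rintegral => x _; rewrite cImM.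
Qed.

Lemma cintegral_aff a F : 0 < a -> cmeasurable F -> tint F ->
  cintegral (fun x => F (a * x)) = (a^-1)%:C * cintegral F.
Proof.
move=> a0 [m1 m2] [f1 f2].
have E x : aff a 0 x = a * x by rewrite /aff addr0.
apply: complexP; rewrite ?cReCM ?cImM /cintegral /= ?mul0r ?addr0.
  rewrite -(Rintegral_aff 0 a0 measurableT m1 f1) preimage_setT.
  by apply: eq_Rintegral => x _; rewrite E.
rewrite -(Rintegral_aff 0 a0 measurableT m2 f2) preimage_setT.
by apply: eq_Rintegral => x _; rewrite E.
Qed.

Lemma lint_aff a b f : 0 < a -> lint f -> lint (fun x => f (aff a b x)).
Proof.
move=> a0 [mf fi]; split; first exact: (measurableT_comp mf (measurable_aff a b)).
move=> x y; rewrite -(aff_preimage_itv b x y _ _ a0).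
by apply: integrable_aff.
Qed.

Lemma clintM w u : clint w -> ccont u -> clint (fun x => w x * u x).
Proof.
move=> [l1 l2] [c1 c2]; split.
  by under eq_fun do rewrite cReM; apply: lintB; exact: lintM.
by under eq_fun do rewrite cImM; apply: lintD; exact: lintM.
Qed.

Lemma clint_scale a w : 0 < a -> clint w -> clint (fun x => w (a * x)).
Proof.
move=> a0 [l1 l2]; have E : (fun x => w (a * x)) = fun x => w (aff a 0 x).
  by apply/funext => x; rewrite /aff addr0.
by rewrite E; split; [exact: (lint_aff 0 a0 l1)|exact: (lint_aff 0 a0 l2)].
Qed.

Lemma cintegral_unroll w s (cs : R) : clint w -> (forall x, w (x + 2 * pi) = w x) ->
  rcont s -> (forall x, x <= 0 -> s x = 0) -> (forall x, 1 <= x -> s x = cs) ->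
  cintegral (fun x => w x * (s x - s (x - 2 * pi))%:C) =
  (cs * (2 * pi))%:C * mean w.
Proof.
move=> [l1 l2] per cts s0 s1.
have p2 : 2 * pi != 0 :> R by rewrite gt_eqF ?pi2_gt0.
have M q : cs * (2 * pi) * rmean q = cs * \int[mu]_(x in `[0, 2 * pi]) q x.
  by rewrite -(mulrA cs) /rmean (mulVKf p2).
apply: complexP; rewrite ?cReCM ?cImM /cintegral /= ?mul0r ?addr0.
  rewrite M -(unroll l1 _ cts s0 s1).
    by apply: eq_Rintegral => x _; rewrite mulrC cReCM mulrC.
  by move=> x; rewrite per.
rewrite M -(unroll l2 _ cts s0 s1).
  by apply: eq_Rintegral => x _; rewrite cImM /= mulr0 add0r.
by move=> x; rewrite per.
Qed.

Lemma periodic_int (T : Type) (u : R -> T) (m : int) x :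
  (forall x, u (x + 2 * pi) = u x) -> u (x + m%:~R * (2 * pi)) = u x.
Proof.
move=> per; have key (j : nat) y : u (y + j%:R * (2 * pi)) = u y.
  elim: j => [|j IH]; first by rewrite mul0r addr0.
  by rewrite -natr1 mulrDl mul1r addrA per.
case: m => j; first exact: key.
have -> : (Negz j)%:~R = - j.+1%:R :> R by rewrite NegzE mulrNz.
by rewrite mulNr -(key j.+1) subrK.
Qed.

(** The line is covered by countably many translates of the period. *)
Lemma ae_periodic (P : R -> Prop) : (forall x, P (x + 2 * pi) = P x) ->
  {ae mu, forall z, 0 < z < 2 * pi -> P z} -> {ae mu, forall z, P z}.
Proof.
move=> per /ae_period h; have p2 := @pi2_gt0 R.
pose F (i : nat) : set R := if unpickle i is Some m then
  aff 1 (m%:~R * (2 * pi)) @^-1` (~` [set z | 0 <= z <= 2 * pi -> P z]) else set0.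
have : mu.-negligible (\bigcup_i F i).
  apply: negligible_bigcup => i; rewrite /F; case: unpickle => [m|].
    exact: measure0_aff.
  exact: negligible_set0.
apply: negligibleS => z /= Pz.
pose m := Num.floor (z / (2 * pi)).
exists (pickle (- m)); first exact: I.
rewrite /F pickleK /= => H; apply: Pz.
rewrite -(periodic_int (- m) z per); have := H; rewrite /aff mul1r; apply.
have := floor_itv (z / (2 * pi)); rewrite -/m => /andP[h1 h2].
rewrite mulrNz mulNr subr_ge0 lerBlDl.
rewrite ler_pdivlMr // in h1; rewrite ltr_pdivrMr // in h2.
rewrite h1 /=; apply: ltW; apply: lt_le_trans h2 _.
by rewrite intrD mulrDl mul1r addrC.
Qed.

Lemma cintegral_ae F G : cmeasurable F -> cmeasurable G ->
  {ae mu, forall z, F z = G z} -> cintegral F = cintegral G.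
Proof.
move=> [f1 f2] [g1 g2] FG; rewrite /cintegral /Rintegral; congr (fine _ +i* fine _).
  apply: ae_eq_integral => //; [exact/measurable_EFinP|exact/measurable_EFinP|].
  by move: FG; apply: (@filterS _ _ (ae_filter_ringOfSetsType mu)) => z /= -> _.
apply: ae_eq_integral => //; [exact/measurable_EFinP|exact/measurable_EFinP|].
by move: FG; apply: (@filterS _ _ (ae_filter_ringOfSetsType mu)) => z /= -> _.
Qed.

End Pairings.

(** * Testing against plane waves *)

Section Probes.
Context {R : realType}.
Local Notation mu := (@lebesgue_measure R).
Variables (p k : R) (k0 : 0 < k) (n : int).
Implicit Types (f g psi Y : R -> R) (h u v w S F G : R -> R[i]).
Implicit Types (x y z b t : R).

Local Notation a := (2 * k).
Local Notation m := (a * n%:~R + p).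

Let a0 : 0 < a. Proof. by rewrite mulr_gt0. Qed.

(** A function on the circle, on the scale and with the phase in which it enters
    the equation. *)
Definition carrier h t x : R[i] := expi (p * x - t) * h (a * x).

Definition wave x : R[i] := expi (- (m * x)).

Lemma carrier_wave h t x :
  carrier h t x * wave x = expi (- t) * (h (a * x) * en (- n) (a * x)).
Proof.
rewrite /carrier /wave /en mulrAC -expiD mulrC -mulrA; rewrite mulrCA.
rewrite [LHS]mulrC [RHS]mulrCA -[RHS]mulrC -mulrA; congr (_ * _).
rewrite -expiD; congr expi; rewrite mulrNz; ring.
Qed.

Lemma clint_carrier h t : clint h -> clint (carrier h t).
Proof.
move=> lh; rewrite (_ : carrier h t = fun x => h (a * x) * expi (p * x - t)).
  by apply: clintM; [exact: clint_scale|apply: ccont_expi; auto with cont].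
by apply/funext => x; rewrite /carrier mulrC.
Qed.

Lemma ccont_wave : ccont wave.
Proof. by apply: ccont_expi; auto with cont. Qed.

Definition component Y h t x : R[i] := carrier h t x * wave x * (Y (a * x))%:C.

Lemma supp_scale Y b : supp_in 0 b Y -> supp_in 0 (b / a) (fun x => Y (a * x)).
Proof.
move=> sY x xs; apply: sY; apply: contra xs => /andP[h1 h2].
by rewrite -(pmulr_rge0 x a0) h1 ler_pdivlMr // mulrC.
Qed.

Lemma rcont_scale Y : rcont Y -> rcont (fun x => Y (a * x)).
Proof. by move=> cY; apply: rcont_comp => //; auto with cont. Qed.

Lemma component_tint Y h t b : clint h -> rcont Y -> supp_in 0 b Y ->
  tint (component Y h t).
Proof.
move=> lh cY sY; apply: tint_test (supp_scale sY).
  by apply: clintM; [exact: clint_carrier|exact: ccont_wave].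
exact: rcont_scale.
Qed.

Lemma component_int Y h t b : clint h -> rcont Y -> supp_in 0 b Y ->
  cintegral (component Y h t) =
  expi (- t) * ((a^-1)%:C * cintegral (fun z => h z * en (- n) z * (Y z)%:C)).
Proof.
move=> lh cY sY; pose G z := h z * en (- n) z * (Y z)%:C.
have lw : clint (fun z => h z * en (- n) z) by apply: clintM => //; exact: ccont_en.
have tG : tint G by exact: (tint_test lw cY sY).
have mG : cmeasurable G by exact/clint_cmeasurable/clintMC.
have -> : component Y h t = fun x => expi (- t) * G (a * x).
  by apply/funext => x; rewrite /component carrier_wave /G !mulrA.
rewrite cintegralZ ?cintegral_aff //.
have E x : aff a 0 x = a * x by rewrite /aff addr0.
have [g1 g2] := tG; have [m1 m2] := mG; split.
  have := integrable_aff 0 a0 measurableT m1 g1; rewrite preimage_setT.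
  by congr (integrable _ _ _); apply/funext => x; rewrite /= E.
have := integrable_aff 0 a0 measurableT m2 g2; rewrite preimage_setT.
by congr (integrable _ _ _); apply/funext => x; rewrite /= E.
Qed.

(** For the derivatives of cut-offs at the ends of their support. *)
Lemma rcont_zero_closed f (y : R) : rcont f ->
  (forall x, x < y -> f x = 0) \/ (forall x, y < x -> f x = 0) -> f y = 0.
Proof.
move=> cf [h|h].
  have c1 : f x @[x --> y^'-] --> f y := cvg_at_left_filter (cf y).
  apply: (cvg_unique _ c1) => //.
  apply: cvg_near_cst; near=> x; apply: h; near: x; exact: nbhs_left_lt.
have c1 : f x @[x --> y^'+] --> f y := cvg_at_right_filter (cf y).
apply: (cvg_unique _ c1) => //.
apply: cvg_near_cst; near=> x; apply: h; near: x; exact: nbhs_right_gt.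
Unshelve. all: by end_near.
Qed.

Let X : R -> R := window 0.
Let K : R -> R := ker 0 0.
Let dK : R -> R := derive1 K.

Let sK : smooth K. Proof. exact: smooth_ker0. Qed.
Let X1 : derive1 X = fun x => K x - K (x - 2 * pi).
Proof. exact: derive1_window. Qed.
Let X2 : derive1 (derive1 X) = fun x => dK x - dK (x - 2 * pi).
Proof.
rewrite X1; apply: derive1_eq => x; apply: is_deriveBfun.
  exact: smooth_is_derive.
have := is_derive_aff (a := 1) (b := - (2 * pi)) (f := K) (x := x).
rewrite mul1r => /(_ _ (smooth_is_derive _ sK)) H.
by apply: (is_derive_fun _ _ H) => [y|]; rewrite mul1r.
Qed.

Let dK_le0 x : x <= 0 -> dK x = 0.
Proof.
have cd := smooth_cont (smooth_derive1 sK).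
have h y : y < 0 -> dK y = 0.
  move=> y0; apply: (supp_derive1 (@ker0_supp R 0)).
  by rewrite negb_and -!ltNge y0.
rewrite le_eqVlt => /predU1P[->|]; last exact: h.
by apply: rcont_zero_closed => //; left.
Qed.

Let dK_ge1 x : 1 <= x -> dK x = 0.
Proof.
have cd := smooth_cont (smooth_derive1 sK).
have h y : 1 < y -> dK y = 0.
  move=> y0; apply: (supp_derive1 (@ker0_supp R 0)).
  by rewrite invr1 negb_and -!ltNge y0 orbT.
rewrite le_eqVlt => /predU1P[<-|]; last exact: h.
by apply: rcont_zero_closed => //; right.
Qed.

Let sX : smooth X. Proof. exact: smooth_window. Qed.
Let suppX : supp_in 0 (2 * pi + 2 * pi) X. Proof. exact: window_supp. Qed.

Let component_window h t : clint h -> (forall x, h (x + 2 * pi) = h x) ->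
  [/\ cintegral (component X h t) = expi (- t) * ((a^-1 * (2 * pi))%:C * fcoef h n),
    cintegral (component (derive1 X) h t) = 0 &
    cintegral (component (derive1 (derive1 X)) h t) = 0].
Proof.
move=> lh per.
have lw : clint (fun z => h z * en (- n) z) by apply: clintM => //; exact: ccont_en.
have pw x : h (x + 2 * pi) * en (- n) (x + 2 * pi) = h x * en (- n) x.
  by rewrite per en_periodic.
have cX := smooth_cont sX; have cX1 := smooth_cont (smooth_derive1 sX).
have cX2 := smooth_cont (smooth_derive1 (smooth_derive1 sX)).
rewrite (component_int t lh cX suppX) (component_int t lh cX1 (supp_derive1 suppX)).
rewrite (component_int t lh cX2 (supp_derive1 (supp_derive1 suppX))).
rewrite X2 X1.
rewrite (cintegral_unroll lw pw (smooth_cont (@smooth_cut R 0)) (@cut_le0 R 0) (@cut_ge1 R 0)).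
rewrite (cintegral_unroll lw pw (smooth_cont sK) (@ker0_le0 R 0) (@ker0_ge1 R 0)).
rewrite (cintegral_unroll lw pw (smooth_cont (smooth_derive1 sK)) dK_le0 dK_ge1).
rewrite !mul0r !mulr0 mul1r; split => //.
congr (_ * _); rewrite mulrA; congr (_ * _).
by apply: complexP; rewrite !ReImE /=; ring.
Qed.

Definition probe_cos x : R := X (a * x) * cos (m * x).
Definition probe_sin x : R := X (a * x) * sin (m * x).

Lemma is_derive_scale f x (d : R) : is_derive (a * x) 1 f d ->
  is_derive x 1 (fun y => f (a * y)) (a * d).
Proof.
move=> h; have := @is_derive_aff R f a 0 x d; rewrite addr0 => /(_ h).
by apply: is_derive_fun => // y; rewrite addr0.
Qed.

Lemma probe_derive2 (T T1 T2 : R -> R) : smooth T ->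
  (forall x, is_derive x 1 T (T1 x)) -> (forall x, is_derive x 1 T1 (T2 x)) ->
  derive1n 2 (fun x => X (a * x) * T x) = fun x =>
    a ^+ 2 * (derive1 (derive1 X) (a * x) * T x) +
    2 * a * (derive1 X (a * x) * T1 x) + X (a * x) * T2 x.
Proof.
move=> sT d1 d2; rewrite /derive1n /=.
have -> : derive1 (fun x => X (a * x) * T x) = fun x =>
    a * derive1 X (a * x) * T x + X (a * x) * T1 x.
  apply: derive1_eq => x; apply: is_deriveMfun => //.
  by apply: is_derive_scale; exact: smooth_is_derive.
apply: derive1_eq => x; have s1 := smooth_derive1 sX.
have e1 := is_deriveZfun a (is_derive_scale (smooth_is_derive (a * x) s1)).
have e0 := is_derive_scale (smooth_is_derive (a * x) sX).
have := is_deriveDfun (is_deriveMfun e1 (d1 x)) (is_deriveMfun e0 (d2 x)).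
by apply: is_derive_fun => //; ring.
Qed.

Lemma smooth_cosm : smooth (fun x => cos (m * x)).
Proof.
rewrite (_ : (fun x => _) = fun x => cos (m * x + 0)); last first.
  by apply/funext => z; rewrite addr0.
exact/smooth_aff/smooth_cos.
Qed.
Lemma smooth_sinm : smooth (fun x => sin (m * x)).
Proof.
rewrite (_ : (fun x => _) = fun x => sin (m * x + 0)); last first.
  by apply/funext => z; rewrite addr0.
exact/smooth_aff/smooth_sin.
Qed.

Let smooth_Xa : smooth (fun x => X (a * x)).
Proof.
rewrite (_ : (fun x => _) = fun x => X (a * x + 0)); last first.
  by apply/funext => z; rewrite addr0.
exact: smooth_aff.
Qed.

Lemma smooth_probe_cos : smooth probe_cos.
Proof. by apply: smoothM => //; exact: smooth_cosm. Qed.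
Lemma smooth_probe_sin : smooth probe_sin.
Proof. by apply: smoothM => //; exact: smooth_sinm. Qed.
Lemma supp_probe_cos : supp_in 0 ((2 * pi + 2 * pi) / a) probe_cos.
Proof. by move=> x xs; rewrite /probe_cos (supp_scale suppX) ?mul0r. Qed.
Lemma supp_probe_sin : supp_in 0 ((2 * pi + 2 * pi) / a) probe_sin.
Proof. by move=> x xs; rewrite /probe_sin (supp_scale suppX) ?mul0r. Qed.

Let ic : R[i] := 0 -i* 1.

(** The product of the carrier with the plane wave is periodic, so that the cut-off
    can be removed by [unroll]. *)
Lemma probe_fcoef h t : clint h -> (forall x, h (x + 2 * pi) = h x) ->
  cintegral (fun x => carrier h t x * (probe_cos x)%:C) +
    ic * cintegral (fun x => carrier h t x * (probe_sin x)%:C) =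
  expi (- t) * ((a^-1 * (2 * pi))%:C * fcoef h n).
Proof.
move=> lh per; have [<- _ _] := component_window t lh per.
have lc := clint_carrier t lh.
have t1 := tint_test lc (smooth_cont smooth_probe_cos) supp_probe_cos.
have t2 := tint_test lc (smooth_cont smooth_probe_sin) supp_probe_sin.
rewrite -cintegralZ // -cintegralD //; last exact: tintZ.
congr cintegral; apply/funext => x; rewrite /component /wave /probe_cos /probe_sin.
rewrite expiN /expi; move: (X (a * x)) (cos (m * x)) (sin (m * x)) (carrier h t x) => y co si [c1 c2].
by apply: complexP; rewrite !ReImE /=; ring.
Qed.

(** Only the second derivative of the plane wave contributes: the terms that contain
    derivatives of the cut-off vanish by [unroll]. *)
Lemma probe_fcoef2 h t : clint h -> (forall x, h (x + 2 * pi) = h x) ->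
  cintegral (fun x => carrier h t x * (derive1n 2 probe_cos x)%:C) +
    ic * cintegral (fun x => carrier h t x * (derive1n 2 probe_sin x)%:C) =
  (- m ^+ 2)%:C * (expi (- t) * ((a^-1 * (2 * pi))%:C * fcoef h n)).
Proof.
move=> lh per; have [<- I1 I2] := component_window t lh per.
have lc := clint_carrier t lh.
have s1 := smooth_derive1 (smooth_derive1 smooth_probe_cos).
have s2 := smooth_derive1 (smooth_derive1 smooth_probe_sin).
have t1 : tint (fun x => carrier h t x * (derive1n 2 probe_cos x)%:C).
  exact: (tint_test lc (smooth_cont s1) (supp_derive1 (supp_derive1 supp_probe_cos))).
have t2 : tint (fun x => carrier h t x * (derive1n 2 probe_sin x)%:C).
  exact: (tint_test lc (smooth_cont s2) (supp_derive1 (supp_derive1 supp_probe_sin))).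
have cX := smooth_cont sX; have cX1 := smooth_cont (smooth_derive1 sX).
have cX2 := smooth_cont (smooth_derive1 (smooth_derive1 sX)).
have T0 := component_tint t lh cX suppX.
have T1 := component_tint t lh cX1 (supp_derive1 suppX).
have T2 := component_tint t lh cX2 (supp_derive1 (supp_derive1 suppX)).
rewrite -(cintegralZ ic t2) -(cintegralD t1 (tintZ ic t2)).
transitivity (cintegral (fun x => (- m ^+ 2)%:C * component X h t x +
  ((2 * a * m)%:C * ic * component (derive1 X) h t x +
   (a ^+ 2)%:C * component (derive1 (derive1 X)) h t x))).
  have dc x : is_derive x 1 (fun x => cos (m * x)) (- m * sin (m * x)).
    apply: (is_derive_fun _ _ (is_derive_comp (is_derive_cos _) (is_derive_lin m x))) => //.
    by ring.
  have ds x : is_derive x 1 (fun x => sin (m * x)) (m * cos (m * x)).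
    exact: (is_derive_fun _ _ (is_derive_comp (is_derive_sin _) (is_derive_lin m x))).
  have d2c := probe_derive2 smooth_cosm dc (fun x => is_deriveZfun (- m) (ds x)).
  have d2s := probe_derive2 smooth_sinm ds (fun x => is_deriveZfun m (dc x)).
  congr cintegral; apply/funext => x; rewrite d2c d2s /component /wave.
  rewrite expiN /expi; move: (X (a * x)) (derive1 X (a * x)) (derive1 (derive1 X) (a * x)).
  move: (cos (m * x)) (sin (m * x)) (carrier h t x) => co si [c1 c2] y0 y1 y2.
  by apply: complexP; rewrite !ReImE /=; ring.
rewrite cintegralD; [|exact: tintZ|by apply: tintD; exact: tintZ].
rewrite cintegralD; [|exact: tintZ|exact: tintZ].
by rewrite !cintegralZ // I1 I2 !mulr0 !addr0.
Qed.

End Probes.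

(** * The differential equation of the coefficients *)

Section Evolution.
Context {R : realType}.
Local Notation mu := (@lebesgue_measure R).
Implicit Types (p k t x : R) (n : int) (u v w S W : R -> R[i]) (Q U : R -> R -> R[i]).

Lemma h1_limit_ae u v : h1 u v -> exists S, [/\ ccont S,
  forall x, S (x + 2 * pi) = S x & {ae mu, forall z, u z = S z}].
Proof.
move=> uv; have [S [cS hS uS]] := h1_limit uv.
have pS x : S (x + 2 * pi) = S x.
  apply/eqP; rewrite -subr_eq0; apply/eqP/nsq_small => e e0.
  have e4 : 0 < e / 4 by rewrite divr_gt0.
  have [N _ hN] := hS _ e4; have {}hN := hN N (leqnn N).
  have -> : S (x + 2 * pi) - S x =
      (tp N (fcoef u) x - S x) - (tp N (fcoef u) (x + 2 * pi) - S (x + 2 * pi)).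
    by rewrite tp_periodic; ring.
  apply: le_trans (nsqB_le _ _) _.
  by have := hN x; have := hN (x + 2 * pi); move: (nsq _) (nsq _) => q1 q2; lra.
exists S; split=> //; apply: ae_periodic uS => x.
by rewrite pS (h1_per uv).
Qed.

Lemma cub_expi (th : R) (z : R[i]) : cub (expi th * z) = expi th * cub z.
Proof. by rewrite /cub nsqM nsq_expi mul1r mulrCA. Qed.

Lemma cderivableP (u : R -> R[i]) : (forall x, cderivable u x) ->
  cis_derive u (cderive u).
Proof.
move=> h x; have [h1 h2] := h x; rewrite /cderive /= !derive1E.
by split; [exact: (DeriveDef h1 erefl)|exact: (DeriveDef h2 erefl)].
Qed.

Lemma cis_derive_fun u v u' v' : (forall x, u x = u' x) -> (forall x, v x = v' x) ->
  cis_derive u' v' -> cis_derive u v.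
Proof. by move=> /funext -> /funext ->. Qed.

Lemma cmeasurableM_cont w u : cmeasurable w -> ccont u ->
  cmeasurable (fun t => w t * u t).
Proof.
move=> [m1 m2] [c1 c2].
have n1 := continuous_measurable_fun c1; have n2 := continuous_measurable_fun c2.
split.
  rewrite (_ : (fun x => _) = fun x => complex.Re (w x) * complex.Re (u x)
    - complex.Im (w x) * complex.Im (u x)).
    by apply: measurable_funB; exact: measurable_funM.
  by apply/funext => x; rewrite cReM.
rewrite (_ : (fun x => _) = fun x => complex.Re (w x) * complex.Im (u x)
    + complex.Im (w x) * complex.Re (u x)).
  by apply: measurable_funD; exact: measurable_funM.
by apply/funext => x; rewrite cImM.
Qed.

Lemma combine_eqs (T : comPzRingType) (i mi z1 z2 I1 J1 I2 J2 a b : T) :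
  i * z1 + I1 - J1 = 0 -> i * z2 + I2 - J2 = 0 ->
  I1 + mi * I2 = a -> J1 + mi * J2 = b -> i * (z1 + mi * z2) = b - a.
Proof.
move=> e1 e2 <- <-.
transitivity ((i * z1 + I1 - J1) + mi * (i * z2 + I2 - J2)
   - (I1 + mi * I2) + (J1 + mi * J2)); first by ring.
by rewrite e1 e2; ring.
Qed.

(** Combine the equations for the real and the imaginary parts of a cut-off plane
    wave. In the cubic term the solution is replaced by its continuous
    representative, which makes it locally integrable. *)
Lemma nls_ode p k Q U n : 0 < k -> (forall t, H1per (Q^~ t)) ->
  (forall x t, U x t = expi (p * x - t) * Q (2 * k * x) t) -> NLS_solution U ->
  cis_derive (fun t => fcoef (Q^~ t) n)
    (fun t => (0 -i* 1) * ((lam p k n)%:C * fcoef (Q^~ t) n +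
       fcoef (fun z => cub (Q z t)) n)).
Proof.
move=> k0 HQ UQ sol; set a := 2 * k; set m := a * n%:~R + p.
have a0 : 0 < a by rewrite mulr_gt0.
have hQ t := H1per_h1 (HQ t).
have lQ t : clint (Q^~ t) := l2loc_clint (h1_l2 (hQ t)).
have UE t : (fun x => U x t) = carrier p k (Q^~ t) t by apply/funext => x; rewrite UQ.
have tc := smooth_test (smooth_probe_cos p k n) (supp_probe_cos p k0 n).
have ts := smooth_test (smooth_probe_sin p k n) (supp_probe_sin p k0 n).
set C := probe_cos p k n in tc; set Sn := probe_sin p k n in ts.
pose P1 t := cintegral (fun x => U x t * (C x)%:C).
pose P2 t := cintegral (fun x => U x t * (Sn x)%:C).
have s1 t : cderivable P1 t /\ (0 +i* 1) * cderive P1 t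
  + cintegral (fun x => U x t * (derive1n 2 C x)%:C)
  - cintegral (fun x => `|U x t| ^+ 2 * U x t * (C x)%:C) = 0 := sol _ tc t.
have s2 t : cderivable P2 t /\ (0 +i* 1) * cderive P2 t
  + cintegral (fun x => U x t * (derive1n 2 Sn x)%:C)
  - cintegral (fun x => `|U x t| ^+ 2 * U x t * (Sn x)%:C) = 0 := sol _ ts t.
have d1 := cderivableP (fun t => (s1 t).1).
have d2 := cderivableP (fun t => (s2 t).1).
pose P t := P1 t + (0 -i* 1) * P2 t.
pose dP t := cderive P1 t + (0 -i* 1) * cderive P2 t.
have dPP : cis_derive P dP by exact: (cis_deriveD d1 (cis_deriveZ _ d2)).
pose ga : R := a^-1 * (2 * pi).
have ga0 : ga != 0 by rewrite mulf_neq0 ?invr_eq0 ?gt_eqF ?pi2_gt0.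
have PE t : P t = expi (- t) * (ga%:C * fcoef (Q^~ t) n).
  rewrite -(probe_fcoef p k0 n t (lQ t) (h1_per (hQ t))) -UE.
  by rewrite /P /P1 /P2.
have P2E t : cintegral (fun x => U x t * (derive1n 2 C x)%:C) + (0 -i* 1) *
    cintegral (fun x => U x t * (derive1n 2 Sn x)%:C) =
    (- m ^+ 2)%:C * (expi (- t) * (ga%:C * fcoef (Q^~ t) n)).
  by rewrite -(probe_fcoef2 p k0 n t (lQ t) (h1_per (hQ t))) -UE.
have P3E t : cintegral (fun x => `|U x t| ^+ 2 * U x t * (C x)%:C) + (0 -i* 1) *
    cintegral (fun x => `|U x t| ^+ 2 * U x t * (Sn x)%:C) =
    expi (- t) * (ga%:C * fcoef (fun z => cub (Q z t)) n).
  have [S [cS pS QS]] := h1_limit_ae (hQ t).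
  have ccS := ccont_cub cS.
  have lcS := ccont_clint ccS.
  have pcS x : cub (S (x + 2 * pi)) = cub (S x) by rewrite pS.
  rewrite (@fcoef_ae _ _ (fun z => cub (S z))); first last.
  - move: QS; apply: (@filterS _ _ (ae_filter_ringOfSetsType mu)) => z -> _.
    by [].
  - exact/clint_cmeasurable.
  - exact/cmeasurable_cub/clint_cmeasurable/lQ.
  rewrite -(probe_fcoef p k0 n t lcS pcS).
  have E (T : R -> R) : rcont T ->
      cintegral (fun x => `|U x t| ^+ 2 * U x t * (T x)%:C) =
      cintegral (fun x => carrier p k (fun z => cub (S z)) t x * (T x)%:C).
    move=> cT; have F x : `|U x t| ^+ 2 * U x t = expi (p * x - t) * cub (Q (a * x) t).
      by rewrite nsq_normr -/(cub _) UQ cub_expi.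
    rewrite (_ : (fun x => `|_| ^+ 2 * _ * _) =
        fun x => carrier p k (fun z => cub (Q z t)) t x * (T x)%:C); last first.
      by apply/funext => x; rewrite F.
    have cE : ccont (fun x => expi (p * x - t)) by apply: ccont_expi; auto with cont.
    have M w : cmeasurable w -> cmeasurable (fun x => carrier p k w t x * (T x)%:C).
      move=> [m1 m2]; apply: cmeasurableM_cont; last exact: ccontC.
      rewrite (_ : carrier p k w t = fun x => w (a * x) * expi (p * x - t)); last first.
        by apply/funext => x; rewrite /carrier mulrC.
      apply: cmeasurableM_cont => //.
      have ma := measurable_aff a 0.
      have Ea x : a * x = aff a 0 x by rewrite /aff addr0.
      split.
        rewrite (_ : (fun x => _) = (fun z => complex.Re (w z)) \o aff a 0).
          exact: (measurableT_comp m1 ma).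
        by apply/funext => x; rewrite /= -Ea.
      rewrite (_ : (fun x => _) = (fun z => complex.Im (w z)) \o aff a 0).
        exact: (measurableT_comp m2 ma).
      by apply/funext => x; rewrite /= -Ea.
    apply: cintegral_ae.
    - exact/M/cmeasurable_cub/clint_cmeasurable/lQ.
    - exact/M/clint_cmeasurable.
    have := @measure0_aff R a 0 _ a0 QS.
    apply: negligibleS => x /= h; rewrite /aff addr0 => h'; apply: h.
    by rewrite /carrier h'.
  by rewrite !E //; exact/smooth_cont/test_smooth.
have EQ t : (0 +i* 1) * dP t =
    expi (- t) * (ga%:C * (fcoef (fun z => cub (Q z t)) n + (m ^+ 2)%:C * fcoef (Q^~ t) n)).
  have [_ e1] := s1 t; have [_ e2] := s2 t.
  rewrite (combine_eqs e1 e2 (P2E t) (P3E t)).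
  have -> : (- m ^+ 2)%:C = - (m ^+ 2)%:C :> R[i].
    by apply: complexP; rewrite !ReImE /= ?oppr0.
  move: (fcoef (Q^~ t) n) (fcoef (fun z => cub (Q z t)) n) => a1 a2.
  ring.
have ex t : expi (1 * t) * expi (- t) = 1 by rewrite mul1r -expiD subrr expi0.
have gi : (ga^-1)%:C * ga%:C = 1 :> R[i].
  by apply: complexP; rewrite !ReImE /= ?mulr0 ?mul0r ?subr0 ?addr0 ?mulVf.
have qE t : fcoef (Q^~ t) n = (ga^-1)%:C * (expi (1 * t) * P t).
  transitivity ((expi (1 * t) * expi (- t)) * ((ga^-1)%:C * ga%:C) * fcoef (Q^~ t) n).
    by rewrite ex gi !mul1r.
  rewrite PE; ring.
have D := cis_deriveZ (ga^-1)%:C (cis_deriveM (cis_derive_expi 1) dPP).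
apply: cis_derive_fun D => [t|t]; first exact: qE.
have dPE : dP t = (0 -i* 1) * (expi (- t) *
    (ga%:C * (fcoef (fun z => cub (Q z t)) n + (m ^+ 2)%:C * fcoef (Q^~ t) n))).
  rewrite -EQ mulrA (_ : (0 -i* 1) * (0 +i* 1) = 1) ?mul1r //.
  by apply: complexP; rewrite !ReImE /=; ring.
have lamE : (lam p k n)%:C = (m ^+ 2)%:C - 1.
  by apply: complexP; rewrite !ReImE /lam /= /m /a; ring.
rewrite dPE PE lamE.
move: (fcoef (Q^~ t) n) (fcoef (fun z => cub (Q z t)) n) => q f.
transitivity ((0 -i* 1) * ((m ^+ 2)%:C * q + f) + (0 +i* 1) * q).
  rewrite (_ : (0 +i* 1) = - (0 -i* 1)); first by ring.
  by apply: complexP; rewrite !ReImE /=; ring.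
transitivity ((expi (1 * t) * expi (- t)) * ((ga^-1)%:C * ga%:C) *
   ((0 -i* 1) * ((m ^+ 2)%:C * q + f) + (0 +i* 1) * q)); first by rewrite ex gi !mul1r.
ring.
Qed.

End Evolution.

(** * Standing waves and orbital stability *)

Section StandingWave.
Context {R : realType}.
Local Notation mu := (@lebesgue_measure R).
Implicit Types (p k t x : R) (n : int) (f g psi : R -> R) (u v w W : R -> R[i]).

Lemma cis_derive_ccont u v : cis_derive u v -> ccont u.
Proof.
move=> h; split=> x; apply/differentiable_continuous/derivable1_diffP.
  by have [[]] := h x.
by have [_ []] := h x.
Qed.

(** The derivative of [f psi' - f1 psi] has zero integral. *)
Lemma green f f1 f2 psi : (forall x, is_derive x 1 f (f1 x)) ->
  (forall x, is_derive x 1 f1 (f2 x)) -> rcont f -> rcont f1 -> rcont f2 ->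
  test_function psi ->
  \int[mu]_x (f x * derive1n 2 psi x) = \int[mu]_x (f2 x * psi x).
Proof.
move=> d1 d2 c0 c1 c2 tp; have sp := test_smooth tp.
have [a [b ab]] := test_supp tp; pose M := `|a| + `|b| + 1.
have aM : - M < a by have := ler_norm (- a); rewrite normrN /M; have := normr_ge0 b; lra.
have bM : b < M by have := ler_norm b; rewrite /M; have := normr_ge0 a; lra.
have M0 : - M < M by rewrite /M; have := normr_ge0 b; have := normr_ge0 a; lra.
have sub x : ~~ (- M <= x <= M) -> ~~ (a <= x <= b) by apply: contra; lra.
have e1 : psi (- M) = 0 by apply: ab; rewrite negb_and -!ltNge aM.
have e2 : psi M = 0 by apply: ab; rewrite negb_and -!ltNge bM orbT.
have dab := supp_derive1 ab.
have e3 : derive1 psi (- M) = 0 by apply: dab; rewrite negb_and -!ltNge aM.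
have e4 : derive1 psi M = 0 by apply: dab; rewrite negb_and -!ltNge bM orbT.
have ddab := supp_derive1 dab.
have s1 := smooth_derive1 sp; have s2 := smooth_derive1 s1.
have k0 := smooth_cont sp; have k1 := smooth_cont s1; have k2 := smooth_cont s2.
rewrite -[derive1n 2 psi]/(derive1 (derive1 psi)).
rewrite (@Rintegral_supp _ _ (- M) M); last first.
  by move=> x /sub xs; rewrite ddab ?mulr0.
rewrite [RHS](@Rintegral_supp _ _ (- M) M); last first.
  by move=> x /sub xs; rewrite ab ?mulr0.
have cl := rcontM c0 k2; have cr := rcontM c2 k0.
have d (x : R) : is_derive x 1 (fun x => f x * derive1 psi x - f1 x * psi x)
    (f x * derive1 (derive1 psi) x - f2 x * psi x).
  have h1 := is_deriveMfun (d1 x) (smooth_is_derive x s1).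
  have h2 := is_deriveMfun (d2 x) (smooth_is_derive x sp).
  by apply: (is_derive_fun _ _ (is_deriveBfun h1 h2)) => //; ring.
apply/eqP; rewrite -subr_eq0 -RintegralB //.
- apply/eqP; rewrite (Rintegral_derive M0 (rcontB cl cr) d).
  by rewrite e1 e2 e3 e4 !mulr0 subrr.
- exact: (lint_cont cl).2.
- exact: (lint_cont cr).2.
Qed.

(** Two integrations by parts; the phase accounts for the linear term of the
    stationary equation. *)
Lemma standing_wave W : stationary_solution W ->
  NLS_solution (fun x t => expi (- t) * W x).
Proof.
move=> [h1 [h2 eqW]]; have d1 := cderivableP h1; have d2 := cderivableP h2.
have E x : cderive (cderive W) x = cub (W x) - W x.
  have := eqW x; rewrite nsq_normr -/(cub _) => /eqP.
  by rewrite subr_eq0 => /eqP <-; rewrite addrK.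
have cW := cis_derive_ccont d1; have cW1 := cis_derive_ccont d2.
have ccW := ccont_cub cW.
have cW2 : ccont (cderive (cderive W)).
  by rewrite (_ : cderive (cderive W) = fun x => cub (W x) - W x);
    [exact: ccontB|exact/funext].
move=> psi tp; have sp := test_smooth tp; have [a [b ab]] := test_supp tp.
have cp := smooth_cont sp.
have tW := tint_test (ccont_clint cW) cp ab.
have tcW := tint_test (ccont_clint ccW) cp ab.
have s2 := smooth_derive1 (smooth_derive1 sp).
have tW2 : tint (fun x => W x * (derive1n 2 psi x)%:C).
  exact: (tint_test (ccont_clint cW) (smooth_cont s2) (supp_derive1 (supp_derive1 ab))).
set A := cintegral (fun x => W x * (psi x)%:C).
set B := cintegral (fun x => W x * (derive1n 2 psi x)%:C).
set C := cintegral (fun x => cub (W x) * (psi x)%:C).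
have ABC : A + B - C = 0.
  have -> : B = cintegral (fun x => cderive (cderive W) x * (psi x)%:C).
    have RC (w : R -> R[i]) (r : R -> R) x :
        complex.Re (w x * (r x)%:C) = complex.Re (w x) * r x.
      by rewrite mulrC cReCM mulrC.
    have IC (w : R -> R[i]) (r : R -> R) x :
        complex.Im (w x * (r x)%:C) = complex.Im (w x) * r x.
      by rewrite cImM /= mulr0 add0r.
    rewrite /B /cintegral; congr (_ +i* _).
      under eq_Rintegral do rewrite RC; under [RHS]eq_Rintegral do rewrite RC.
      have [q0 _] := cW; have [q1 _] := cW1; have [q2 _] := cW2.
      exact: (green (fun x => (d1 x).1) (fun x => (d2 x).1) q0 q1 q2 tp).
    under eq_Rintegral do rewrite IC; under [RHS]eq_Rintegral do rewrite IC.
    have [_ q0] := cW; have [_ q1] := cW1; have [_ q2] := cW2.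
    exact: (green (fun x => (d1 x).2) (fun x => (d2 x).2) q0 q1 q2 tp).
  rewrite (_ : (fun x => _) = fun x => cub (W x) * (psi x)%:C + (- 1) * (W x * (psi x)%:C)).
    rewrite cintegralD //; last exact: tintZ.
    by rewrite cintegralZ // mulN1r -/A -/C; ring.
  by apply/funext => x; rewrite E; ring.
have F (w : R -> R[i]) (r : R -> R) t : tint (fun x => w x * (r x)%:C) ->
    cintegral (fun x => expi (- t) * w x * (r x)%:C) =
    expi (- t) * cintegral (fun x => w x * (r x)%:C).
  by move=> tw; rewrite -cintegralZ //; congr cintegral; apply/funext => x; rewrite mulrA.
move=> pairing t.
have PE s : pairing s = A * expi (-1 * s) by rewrite /pairing F // mulN1r mulrC.
have D : cis_derive pairing (fun s => A * ((0 +i* (-1)) * expi (-1 * s))).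
  by apply: (cis_derive_fun PE _ (cis_deriveZ A (cis_derive_expi (-1)))).
have [D1 D2] := D t.
split; first by split; [case: D1|case: D2].
have -> : cderive pairing t = A * ((0 +i* (-1)) * expi (-1 * t)).
  by rewrite /cderive; apply: complexP; rewrite /= derive1E; [case: D1|case: D2].
rewrite F // -/B (_ : (fun x => `|_| ^+ 2 * _ * _) =
    fun x => expi (- t) * cub (W x) * (psi x)%:C); last first.
  by apply/funext => x; rewrite nsq_normr -/(cub _) cub_expi.
rewrite F // -/C mulN1r.
transitivity (expi (- t) * (A + B - C)); last by rewrite ABC mulr0.
have i2 : (0 +i* 1) * (0 +i* (-1)) = 1 :> R[i].
  by apply: complexP; rewrite !ReImE /=; ring.
transitivity (((0 +i* 1) * (0 +i* (-1))) * (A * expi (- t)) + expi (- t) * B - expi (- t) * C).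
  by ring.
by rewrite i2; ring.
Qed.

(** The coefficients of a standing wave are constant in time, so that their
    derivatives, given by [nls_ode], vanish. *)
Lemma stationary_fcoef p k w n : 0 < k -> H1per w ->
  stationary_solution (fun x => expi (p * x) * w (2 * k * x)) ->
  (lam p k n)%:C * fcoef w n + fcoef (fun z => cub (w z)) n = 0.
Proof.
move=> k0 Hw /standing_wave sol.
have D := @nls_ode R p k (fun z _ => w z) _ n k0 (fun=> Hw) _ sol.
have {}D := D _; set F := _ + _.
have H : cis_derive (fun=> fcoef w n) (fun=> (0 -i* 1) * F).
  by apply: D => x t; rewrite mulrA -expiD addrC.
have [[_ h1] [_ h2]] := H 0.
have z1 : complex.Re ((0 -i* 1) * F) = 0 by rewrite -h1 derive_cst.
have z2 : complex.Im ((0 -i* 1) * F) = 0 by rewrite -h2 derive_cst.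
move: z1; rewrite cReM /= mul0r sub0r mulN1r opprK => z1.
move: z2; rewrite cImM /= mul0r add0r mulN1r => /eqP; rewrite oppr_eq0 => /eqP z2.
by apply: complexP; [exact: z2|exact: z1].
Qed.

End StandingWave.

(** The inverse of [88 ^+ 2] will do. *)
Lemma small_size (R : realType) : exists e : R,
  [/\ 0 < e < 1, e <= 1 / 100, e * 88 ^+ 2 <= 1 & e ^+ 2 <= 1 / 100].
Proof.
have c10 : 10 <= 88 :> R by rewrite ler_nat.
have c100 : 100 = 10 ^+ 2 :> R by rewrite -natrX.
(* abstracting the numerals keeps the arithmetic symbolic *)
move: c10 c100; move: (88 : R) (100 : R) => c d c10 ->.
have c0 : 0 < c by apply: lt_le_trans c10; rewrite ltr0n.
have p10 : 0 < 10 :> R by rewrite ltr0n.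
have d0 : 0 < 10 ^+ 2 :> R by rewrite exprn_gt0.
have cc : 0 < c ^+ 2 by rewrite exprn_gt0.
have le1 : (c ^+ 2)^-1 <= 1 / 10 ^+ 2.
  by rewrite div1r lef_pV2 ?posrE // ler_sqr ?nnegrE ?(ltW c0) ?(ltW p10).
have c1 : 1 < c by apply: lt_le_trans c10; rewrite ltr1n.
exists (c ^+ 2)^-1; split=> //.
  by rewrite invr_gt0 cc invf_lt1 //; exact: exprn_egt1.
  by rewrite mulVf // gt_eqF.
apply: le_trans le1; rewrite expr2 ler_piMl ?invr_ge0 ?(ltW cc) //.
by rewrite invf_le1 //; apply: exprn_ege1; exact: ltW.
Qed.

Theorem theorem1 (R : realType) :
  exists C0 eps0 delta0 : R, 0 < C0 /\ 0 < eps0 /\ 0 < delta0 /\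
  forall (p k : R) (Qper : R -> R[i]),
    `|p - 1| <= delta0 -> `|k - 1| <= delta0 ->
    H1per Qper -> normX Qper <= delta0 ->
    stationary_solution (fun x => expi (p * x) * Qper (2 * k * x)) ->
  forall V : R -> R[i],
    H1per V -> normX V <= eps0 ->
  forall Q U : R -> R -> R[i],
    continuous_curve Q ->
    (forall x t, U x t = expi (p * x - t) * Q (2 * k * x) t) ->
    NLS_solution U ->
    {ae @lebesgue_measure R, forall x,
      U x 0 = expi (p * x) * (Qper (2 * k * x) + V (2 * k * x))} ->
  forall t : R,
    inf [set normX (fun z => Q z t - expi phi * Qper (z - xi))
        | phi in `[0, 2 * pi] & xi in `[0, 2 * pi]]
    <= C0 * normX V.
Proof.
have p2 := @pi2_gt0 R; have p1 := @pi2_ge1 R.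
have [e [/andP[e0 e1] e100 e88 ee]] := small_size R.
have : exists2 c : R, c = 220 & 0 < c by exists 220; rewrite ?ltr0n.
move=> [c cE c0].
(* the norm of X is [sqrt (2 pi)] times the norm on coefficients *)
exists (c * Num.sqrt (2 * pi)), 2^-1, e.
split; first by rewrite mulr_gt0 // sqrtr_gt0.
split; first by rewrite invr_gt0.
split; first exact: e0.
move=> p k Qper hp hk HP NP SP V HV NV Q U [HQ cQ] UQ sol init t.
have k0 : 0 < k by move: hk; rewrite ler_norml => /andP[h _]; clear -h e1; lra.
have n0 (u : R -> R[i]) : 0 <= normX u by exact: sqrtr_ge0.
have low (u : R -> R[i]) N : H1per u -> hn N (fcoef u) <= normX u ^+ 2.
  move=> Hu; apply: le_trans (normX_hn N Hu).
  by rewrite ler_peMl ?hn_ge0.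
pose q s n := fcoef (Q^~ s) n.
have hQ s := H1per_h1 (HQ s).
have lQ s : clint (Q^~ s) := l2loc_clint (h1_l2 (hQ s)).
have hP := H1per_h1 HP; have lP := l2loc_clint (h1_l2 hP).
have hV := H1per_h1 HV; have lV := l2loc_clint (h1_l2 hV).
have qB s : exists B, forall N, hn N (q s) <= B.
  exists (normX (Q^~ s) ^+ 2) => M; exact: low.
have HD s s0 : H1per (fun z => Q z s - Q z s0) by exact: h1_H1per (h1B (hQ s) (hQ s0)).
have qC s0 (eps : R) : 0 < eps ->
    \forall s \near s0, forall N, hn N (fun n => q s n - q s0 n) <= eps.
  move=> eps0; have se : 0 < Num.sqrt eps by rewrite sqrtr_gt0.
  have : \forall s \near s0, normX (fun z => Q z s - Q z s0) <= Num.sqrt eps.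
    by apply: (cvgr_le _ (cQ s0)).
  apply: filterS => s hs M.
  rewrite (_ : (fun n => _) = fcoef (fun z => Q z s - Q z s0)); last first.
    by apply/funext => n; rewrite fcoefB //; exact: clint_cint.
  apply: le_trans (low _ _ (HD s s0)) _; rewrite -[leRHS](sqr_sqrtr (ltW eps0)).
  by rewrite ler_sqr ?nnegrE // ltW.
have init0 : {ae @lebesgue_measure R, forall z, Q z 0 = Qper z + V z}.
  have i2k : 0 < (2 * k)^-1 by rewrite invr_gt0 mulr_gt0.
  have := measure0_aff 0 i2k init; apply: negligibleS => z /= h h'; apply: h.
  have kN : 2 * k != 0 by rewrite gt_eqF // mulr_gt0.
  move: h'; rewrite /aff addr0 UQ subr0 (mulVKf kN).
  move=> /(congr1 (fun x => expi (- (p * ((2 * k)^-1 * z))) * x)).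
  by rewrite !mulrA -expiD addNr expi0 !mul1r.
have qV n : q 0 n - fcoef Qper n = fcoef V n.
  rewrite /q (@fcoef_ae _ _ (fun z => Qper z + V z)).
  - by rewrite (fcoefD n (clint_cint lP) (clint_cint lV)) addrAC subrr add0r.
  - exact: (clint_cmeasurable (lQ 0)).
  - have [[[mP _] [mP' _]] [[mV _] [mV' _]]] := (lP, lV); split.
      rewrite (_ : (fun x => _) = fun x => complex.Re (Qper x) + complex.Re (V x)).
        exact: measurable_funD.
      by apply/funext => x; rewrite cReD.
    rewrite (_ : (fun x => _) = fun x => complex.Im (Qper x) + complex.Im (V x)).
      exact: measurable_funD.
    by apply/funext => x; rewrite cImD.
  move: init0; apply: (@filterS _ _ (ae_filter_ringOfSetsType _)) => z -> _.
  by [].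
have r0 : 0 <= normX V < 1.
  by rewrite n0 /=; apply: le_lt_trans NV _; rewrite invf_lt1 // ltr1n.
have wB N : hn N (fcoef Qper) <= 1 / 100.
  apply: le_trans (low _ _ HP) _; apply: le_trans ee.
  by rewrite ler_sqr ?nnegrE // ltW.
have init1 N : hn N (fun n => q 0 n - fcoef Qper n) <= normX V ^+ 2.
  by rewrite (_ : (fun n => _) = fcoef V); [exact: low|exact/funext].
have [phi [xi [hphi hxi hB]]] := orbital_seq e100 hp hk e88 (fun _ _ => erefl)
  (fun n => nls_ode n k0 HQ UQ sol) qB qC (fun s n => Fc_cvg n (hQ s)) wB
  (fun n => stationary_fcoef n k0 HP SP) (fun n => Fc_cvg n hP) r0 init1 t.
rewrite -cE in hB.
set D := fun z => Q z t - expi phi * Qper (z - xi).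
have hD : H1per D.
  by apply: h1_H1per (h1B (hQ t) (h1Z (expi phi) (h1_shift (- xi) hP))).
have fD : fcoef D = fun n => q t n - expi (phi - n%:~R * xi) * fcoef Qper n.
  apply/funext => n; have lS := clint_shift (- xi) lP.
  rewrite /D fcoefB; [|exact: clint_cint|exact/clint_cint/clintZ].
  rewrite fcoefZ; last exact: clint_cint.
  rewrite (fcoef_shift n lP (h1_per hP) hxi) mulrA -expiD.
  by [].
have nD : normX D <= c * Num.sqrt (2 * pi) * normX V.
  rewrite -ler_sqr ?nnegrE ?mulr_ge0 ?sqrtr_ge0 ?n0 ?(ltW c0) //.
  rewrite normX_sqr // !exprMn (sqr_sqrtr (ltW p2)).
  rewrite (_ : c ^+ 2 * (2 * pi) * _ = 2 * pi * (c * normX V) ^+ 2); last first.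
    by rewrite exprMn; move: (normX V) => y; ring.
  rewrite ler_pM2l //; apply: (h1_norm_le (H1per_h1 hD)) => N.
  by rewrite fD.
apply: le_trans nD; apply: ge_inf.
  by exists 0 => _ [a _ [b _ <-]]; exact: n0.
by exists phi; [|exists xi] => //=; rewrite in_itv.
Qed.
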